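(* Let $E=A\#_fH$ be a crossed product, and let $X_{rs}$ and $d^l_{rs}$ be the $E$-bimodules and $E$-bimodule maps defined in the context. Put $X_n=\bigoplus_{r+s=n}X_{rs}$ and $d_n=\sum_{r+s=n}\ \sum_{0\le l\le s,\ r+l>0}d^l_{rs}$ for $n\ge 1$. Then $$E\xleftarrow{-\mu}X_0\xleftarrow{d_1}X_1\xleftarrow{d_2}X_2\xleftarrow{d_3}X_3\xleftarrow{d_4}\cdots,$$ where $\mu:X_0=E\otimes E\to E$ is the multiplication map, is a relative projective resolution of the $E$-bimodule $E$.
   Context: $k$ is a commutative ring with unit, $\otimes=\otimes_k$, $H$ is a Hopf algebra with counit $\epsilon$ and Sweedler notation $\Delta(h)=h^{(1)}\otimes h^{(2)}$ (sum understood), $A$ is a $k$-algebra. A weak action of $H$ on $A$ is a bilinear map $(h,a)\mapsto a^h$, $H\times A\to A$, with $(ab)^h=a^{h^{(1)}}b^{h^{(2)}}$, $1^h=\epsilon(h)1$, $a^1=a$. Given a weak action and a $k$-linear map $f:H\otimes H\to A$, $A\#_fH$ is $A\otimes H$ (elements written $a\#h$) with product $(a\#h)(b\#l)=ab^{h^{(1)}}f(h^{(2)},l^{(1)})\#h^{(3)}l^{(2)}$; it is called a crossed product if it is associative with unit $1\#1$, equivalently: $f(h,1)=f(1,h)=\epsilon(h)1_A$; $f(l^{(1)},m^{(1)})^{h^{(1)}}f(h^{(2)},l^{(2)}m^{(2)})=f(h^{(1)},l^{(1)})f(h^{(2)}l^{(2)},m)$; and $(a^{l^{(1)}})^{h^{(1)}}f(h^{(2)},l^{(2)})=f(h^{(1)},l^{(1)})a^{h^{(2)}l^{(2)}}$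 for all $h,l,m\in H$, $a\in A$. Notation: $\overline B=B/k$ for a $k$-algebra $B$ (classes denoted by the same letter), $\overline B^l=\overline B\otimes\cdots\otimes\overline B$ ($l$ times). $\mathbf h_{ij}=h_i\otimes\cdots\otimes h_j$, $\mathbf a_{ij}=a_i\otimes\cdots\otimes a_j$. For $\mathbf h=h_i\otimes\cdots\otimes h_j$, $\mathbf h^{(1)}\otimes\mathbf h^{(2)}=(h_i^{(1)}\otimes\cdots\otimes h_j^{(1)})\otimes(h_i^{(2)}\otimes\cdots\otimes h_j^{(2)})$, and $a^{\overline{\mathbf h}}=(\cdots((a^{h_j})^{h_{j-1}})\cdots)^{h_i}$ for $a\in A$. $X_{rs}=E\otimes\overline H^s\otimes\overline A^r\otimes E$ ($r,s\ge0$), an $E$-bimodule by multiplication on the outer factors. Elements are written $a_0\otimes\mathbf h_{0s}\otimes\mathbf a\otimes h_{s+1}$ with $\mathbf a=a_1\otimes\cdots\otimes a_{r+1}$, where the left factor $E$ contains $a_0\#h_0$ and the right factor $E$ contains $a_{r+1}\#h_{s+1}$. $Y_s=E\otimes\overline H^s\otimes H$, with elements $a_0\otimes\mathbf h$, $\mathbf h=h_0\otimes\cdots\otimes h_{s+1}$ ($a_0\#h_0$ in the factor $E$); left action canonical, right action $(a_0\otimes\mathbf h)(a\#h)=a_0a^{\overline{\mathbf h^{(1)}}}f(h_{s+1}^{(2)},h^{(1)})^{\overline{\mathbf h_{0s}^{(2)}}}\otimes(\mathbf h_{0s}^{(3)}\otimes h_{s+1}^{(3)}h^{(2)})$. Define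 bimodule maps $\mu_s:X_{0s}\to Y_s$, $d^0_{rs}:X_{rs}\to X_{r-1,s}$ ($r\ge1$), $\partial_s:Y_s\to Y_{s-1}$ ($s\ge1$) by $\mu_s(a_0\otimes\mathbf h_{0s}\otimes a_1\otimes h_{s+1})=a_0a_1^{\overline{\mathbf h_{0s}^{(1)}}}\otimes\mathbf h_{0s}^{(2)}\otimes h_{s+1}$; $d^0_{rs}(a_0\otimes\mathbf h_{0s}\otimes\mathbf a\otimes h_{s+1})=a_0a_1^{\overline{\mathbf h_{0s}^{(1)}}}\otimes\mathbf h_{0s}^{(2)}\otimes\mathbf a_{2,r+1}\otimes h_{s+1}+\sum_{i=1}^r(-1)^ia_0\otimes\mathbf h_{0s}\otimes\mathbf a_{1,i-1}\otimes a_ia_{i+1}\otimes\mathbf a_{i+2,r+1}\otimes h_{s+1}$; $\partial_s(a\otimes\mathbf h)=\sum_{i=0}^s(-1)^{i+1}af(h_i^{(1)},h_{i+1}^{(1)})^{\overline{\mathbf h_{0,i-1}^{(1)}}}\otimes\mathbf h_{0,i-1}^{(2)}\otimes h_i^{(2)}h_{i+1}^{(2)}\otimes\mathbf h_{i+2,s+1}$. Define left $E$-module maps $\sigma^0_{0s}:Y_s\to X_{0s}$ and $\sigma^0_{r+1,s}:X_{rs}\to X_{r+1,s}$ ($r\ge 0$) by $\sigma^0_{r+1,s}(a_0\otimes\mathbf h_{0s}\otimes\mathbf a\otimes h_{s+1})=(-1)^{r+1}a_0\otimes\mathbf h_{0s}\otimes\mathbf a\otimes1\#h_{s+1}$ for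 $r\ge-1$ (for $r=-1$ there is no $\mathbf a$). The $E$-bimodule maps $d^l_{rs}:X_{rs}\to X_{r+l-1,s-l}$ ($r\ge0$, $1\le l\le s$) are defined recursively by their values on $\mathbf x\in k\otimes\overline H^s\otimes\overline A^r\otimes k$ (i.e. outer factors $1_E$): $d^1_{0s}(\mathbf x)=-\sigma^0_{0,s-1}\partial_s\mu_s(\mathbf x)$; $d^l_{0s}(\mathbf x)=-\sum_{j=1}^{l-1}\sigma^0_{l-1,s-l}d^{l-j}_{j-1,s-j}d^j_{0s}(\mathbf x)$ for $1<l\le s$; $d^l_{rs}(\mathbf x)=-\sum_{j=0}^{l-1}\sigma^0_{r+l-1,s-l}d^{l-j}_{r+j-1,s-j}d^j_{rs}(\mathbf x)$ for $r>0$. ''Relative projective resolution'' is meant relative to the inclusion $E\to E^e=E\otimes E^{\mathrm{op}}$: a complex of $E$-bimodules that is contractible as a complex of left $E$-modules and whose terms $X_n$ are relatively projective $E$-bimodules. *)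

(* Defs.v *)
From HB Require Import structures.
From mathcomp Require Import all_boot all_algebra.
From mathcomp Require Import boolp classical_sets zify.

Set Implicit Arguments.
Unset Strict Implicit.
Unset Printing Implicit Defensive.

Import GRing.Theory.
Local Open Scope ring_scope.
Local Open Scope quotient_scope.

Section Tensor.
Variables (k : comNzRingType) (M N : lmodType k).

(* The list [:: (m1, n1); ...; (mp, np)] stands for the formal sum of the
   m_i (x) n_i; [teq] is the congruence generated by bilinearity. *)
Inductive teq : seq (M * N) -> seq (M * N) -> Prop :=
| teq_refl s : teq s s
| teq_sym s t : teq s t -> teq t s
| teq_trans s t u : teq s t -> teq t u -> teq s u
| teq_cat s s' t t' : teq s s' -> teq t t' -> teq (s ++ t) (s' ++ t')
| teq_comm s t : teq (s ++ t) (t ++ s)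
| teq_addl m m' n : teq [:: (m + m', n)] [:: (m, n); (m', n)]
| teq_addr m n n' : teq [:: (m, n + n')] [:: (m, n); (m, n')]
| teq_scale c m n : teq [:: (c *: m, n)] [:: (m, c *: n)]
| teq_zero n : teq [:: (0, n)] [::].

Definition teqb (s t : seq (M * N)) : bool := `[< teq s t >].

Lemma teqb_refl : reflexive teqb.
Proof. by move=> s; apply/asboolP/teq_refl. Qed.

Lemma teqb_sym : symmetric teqb.
Proof. by move=> s t; apply/asboolP/asboolP; apply: teq_sym. Qed.

Lemma teqb_trans : transitive teqb.
Proof.
by move=> t s u /asboolP st /asboolP tu; apply/asboolP; apply: teq_trans st tu.
Qed.

Canonical teq_equiv := EquivRel teqb teqb_refl teqb_sym teqb_trans.

Definition tens : Type := {eq_quot teq_equiv}.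
HB.instance Definition _ := Choice.on tens.
HB.instance Definition _ := Quotient.on tens.

Definition tpure (m : M) (n : N) : tens := \pi_tens [:: (m, n)].

(* A chosen expansion of t as a finite sum of elementary tensors; this is
   what Sweedler notation abbreviates. *)
Definition expand (t : tens) : seq (M * N) := repr t.

Lemma tens_eqP (s t : seq (M * N)) : teq s t <-> \pi_tens s = \pi_tens t.
Proof.
split; first by move=> st; apply/eqmodP; apply/asboolP.
by move/eqmodP/asboolP.
Qed.

Lemma teq_expand s : teq (expand (\pi_tens s)) s.
Proof. by apply/tens_eqP; rewrite reprK. Qed.

Definition tadd (x y : tens) : tens := \pi_tens (expand x ++ expand y).
Definition tzero : tens := \pi_tens [::].
Definition tscale (c : k) (x : tens) : tens :=
  \pi_tens [seq (c *: p.1, p.2) | p <- expand x].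
Definition topp (x : tens) : tens := tscale (-1) x.

Lemma taddE s t : tadd (\pi_tens s) (\pi_tens t) = \pi_tens (s ++ t).
Proof. by apply/tens_eqP; apply: teq_cat; apply: teq_expand. Qed.

Lemma teq_map_scale c s t : teq s t ->
  teq [seq (c *: p.1, p.2) | p <- s] [seq (c *: p.1, p.2) | p <- t].
Proof.
elim=> {s t} /= [s|s t _|t s u _ IH1 _ IH2|s s' t t' _ IH1 _ IH2|s t|m m' n|m n n'|d m n|n].
- exact: teq_refl.
- exact: teq_sym.
- exact: teq_trans IH1 IH2.
- by rewrite !map_cat; apply: teq_cat.
- by rewrite !map_cat; apply: teq_comm.
- by rewrite scalerDr; apply: teq_addl.
- exact: teq_addr.
- by rewrite scalerA mulrC -scalerA; apply: teq_scale.
- by rewrite scaler0; apply: teq_zero.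
Qed.

Lemma tscaleE c s :
  tscale c (\pi_tens s) = \pi_tens [seq (c *: p.1, p.2) | p <- s].
Proof. by apply/tens_eqP/teq_map_scale/teq_expand. Qed.

Lemma taddA : associative tadd.
Proof.
move=> x y z; rewrite -[x]reprK -[y]reprK -[z]reprK.
rewrite (taddE (repr y) (repr z)) (taddE (repr x) (_ ++ _)).
by rewrite (taddE (repr x) (repr y)) (taddE (_ ++ _)) catA.
Qed.

Lemma taddC : commutative tadd.
Proof.
by move=> x y; rewrite -[x]reprK -[y]reprK !taddE; apply/tens_eqP/teq_comm.
Qed.

Lemma tadd0 : left_id tzero tadd.
Proof. by move=> x; rewrite -[x]reprK taddE. Qed.

Lemma tpureDl m m' n : tpure (m + m') n = tadd (tpure m n) (tpure m' n).
Proof. by rewrite taddE; apply/tens_eqP/teq_addl. Qed.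

Lemma tscaleDl c d x : tscale (c + d) x = tadd (tscale c x) (tscale d x).
Proof.
rewrite -[x]reprK !tscaleE taddE; apply/tens_eqP.
elim: (repr x) => [|[m n] s IH] /=; first exact: teq_refl.
rewrite scalerDl -cat1s; apply: (@teq_trans _ ([:: (c *: m, n); (d *: m, n)] ++
  ([seq (c *: p.1, p.2) | p <- s] ++ [seq (d *: p.1, p.2) | p <- s]))).
  by apply: teq_cat => //; apply: teq_addl.
rewrite /= -cat1s -[in X in teq _ X]cat1s; apply: teq_cat; first exact: teq_refl.
rewrite -cat1s catA -[in X in teq _ X](cat1s (d *: m, n)) [X in teq _ X]catA.
by apply: teq_cat; [apply: teq_comm | apply: teq_refl].
Qed.

Lemma tscale0 x : tscale 0 x = tzero.
Proof.
rewrite -[x]reprK tscaleE; apply/tens_eqP.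
elim: (repr x) => [|[m n] s IH] /=; first exact: teq_refl.
rewrite scale0r -cat1s -[X in teq _ X]cats0.
by apply: teq_cat => //; apply: teq_zero.
Qed.

Lemma tscale1 x : tscale 1 x = x.
Proof.
rewrite -[x]reprK tscaleE; congr \pi_tens.
by rewrite -[RHS]map_id; apply: eq_map => -[m n] /=; rewrite scale1r.
Qed.

Lemma taddN : left_inverse tzero topp tadd.
Proof.
by move=> x; rewrite -{2}[x]tscale1 /topp -tscaleDl addNr tscale0.
Qed.

HB.instance Definition _ := GRing.isZmodule.Build tens taddA taddC tadd0 taddN.

Lemma tscaleA c d x : tscale c (tscale d x) = tscale (c * d) x.
Proof.
rewrite -[x]reprK (tscaleE d) (tscaleE c) (tscaleE (c * d)) -map_comp.
congr \pi_tens.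
by apply: eq_map => -[m n] /=; rewrite scalerA.
Qed.

Lemma tscaleDr : right_distributive tscale +%R.
Proof.
move=> c x y; rewrite /GRing.add /= -[x]reprK -[y]reprK.
by rewrite (taddE (repr x)) !(tscaleE c) taddE map_cat.
Qed.

HB.instance Definition _ := GRing.Zmodule_isLmodule.Build k tens
  tscaleA tscale1 tscaleDr (fun x c d => tscaleDl c d x).

Fact tpure_bilinear : bilinear_for *:%R *:%R tpure.
Proof.
split=> [n c m m'|m c n n'].
  rewrite -[RHS]/(tadd (tscale c (tpure m n)) (tpure m' n)).
  by rewrite (tscaleE c) taddE; apply/tens_eqP/teq_addl.
rewrite -[RHS]/(tadd (tscale c (tpure m n)) (tpure m n')).
rewrite (tscaleE c) taddE; apply/tens_eqP; apply: teq_trans (teq_addr _ _ _) _.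
rewrite -cat1s -[X in teq _ X]cat1s; apply: teq_cat; last exact: teq_refl.
exact/teq_sym/teq_scale.
Qed.
HB.instance Definition _ :=
  bilinear_isBilinear.Build k M N tens _ _ tpure tpure_bilinear.

Lemma pi_tensE s : \pi_tens s = \sum_(p <- s) tpure p.1 p.2.
Proof.
elim: s => [|[m n] s IH]; first by rewrite big_nil.
rewrite big_cons -IH.
by rewrite -[RHS]/(tadd (\pi_tens [:: (m, n)]) (\pi_tens s)) taddE.
Qed.

Lemma expandE (t : tens) : t = \sum_(p <- expand t) tpure p.1 p.2.
Proof. by rewrite -pi_tensE reprK. Qed.

End Tensor.

Notation "m \ox n" := (tpure m n)
  (at level 40, left associativity) : ring_scope.

Section TensorLift.
Variables (k : comNzRingType) (M N V : lmodType k) (b : {bilinear M -> N -> V}).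

Definition tlift (t : tens M N) : V := \sum_(p <- expand t) b p.1 p.2.

Lemma teq_sum s t : teq s t ->
  \sum_(p <- s) b p.1 p.2 = \sum_(p <- t) b p.1 p.2.
Proof.
elim=> {s t} //= [s t u _ -> _ -> //|s s' t t' _ IH1 _ IH2|s t|m m' n|m n n'|d m n|n].
- by rewrite !big_cat IH1 IH2.
- by rewrite !big_cat /= addrC.
- by rewrite !big_cons big_nil !addr0 linearDl.
- by rewrite !big_cons big_nil !addr0 linearDr.
- by rewrite !big_seq1 linearZl_LR linearZr_LR.
- by rewrite big_seq1 big_nil linear0l.
Qed.

Lemma tlift_pi s : tlift (\pi_(tens M N) s) = \sum_(p <- s) b p.1 p.2.
Proof. exact/teq_sum/teq_expand. Qed.

Fact tlift_linear : linear tlift.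
Proof.
move=> c x y; rewrite -[x]reprK -[y]reprK.
rewrite -[_ + _ in LHS]/(tadd (tscale c (\pi_(tens M N) (repr x))) (\pi_(tens M N) (repr y))).
rewrite tscaleE taddE !tlift_pi big_cat.
congr (_ + _); rewrite big_map scaler_sumr.
by apply: eq_bigr => p _; rewrite linearZl_LR.
Qed.
HB.instance Definition _ := GRing.isLinear.Build k (tens M N) V _ tlift tlift_linear.

Lemma tliftE m n : tlift (m \ox n) = b m n.
Proof. by rewrite tlift_pi big_seq1. Qed.

End TensorLift.

Lemma tens_ext (k : comNzRingType) (M N V : lmodType k)
    (f g : {linear tens M N -> V}) :
  (forall m n, f (m \ox n) = g (m \ox n)) -> f =1 g.
Proof.
by move=> fg t; rewrite [t]expandE !linear_sum; apply: eq_bigr => p _; apply: fg.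
Qed.

Section TensorMap.
Variables (k : comNzRingType) (M M' N N' : lmodType k).
Variables (f : {linear M -> M'}) (g : {linear N -> N'}).

Definition tmap_pure (m : M) (n : N) : tens M' N' := f m \ox g n.
Fact tmap_pure_bilinear : bilinear_for *:%R *:%R tmap_pure.
Proof.
by split=> [n|m] c x y; rewrite /tmap_pure linearP ?linearPl ?linearPr.
Qed.
HB.instance Definition _ :=
  bilinear_isBilinear.Build k M N (tens M' N') _ _ tmap_pure tmap_pure_bilinear.

Definition tmap : {linear tens M N -> tens M' N'} := tlift tmap_pure.

Lemma tmapE m n : tmap (m \ox n) = f m \ox g n.
Proof. exact: tliftE. Qed.
End TensorMap.

(* The k-linear map U -> V whose value at p t is F t. It is used only when the
   elements p t span U, so that it is unique. It exists as soon as F is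
   compatible with the relations among the p t, as it is in all uses below;
   the value \0 otherwise is a convention. *)
Definition linext (k : comNzRingType) (T : Type) (U V : lmodType k)
    (p : T -> U) (F : T -> V) : {linear U -> V} :=
  xget (\0 : {classic {linear U -> V}}) [set g | forall t, g (p t) = F t].

Lemma linextE (k : comNzRingType) (T : Type) (U V : lmodType k) (p : T -> U)
    (F : T -> V) (g : {linear U -> V}) :
  (forall t, g (p t) = F t) -> forall t, linext p F (p t) = F t.
Proof.
move=> gF; rewrite /linext; case: xgetP => [h _ hF|/(_ g) //].
exact: hF.
Qed.

Section SumLinear.
Variable k : comNzRingType.

Lemma sum_linear (M V : lmodType k) (I : Type) (s : seq I) (F : I -> M -> V) :
  (forall i, linear (F i)) -> linear (fun m => \sum_(i <- s) F i m).
Proof.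
move=> Flin c x y; rewrite scaler_sumr -big_split.
by apply: eq_bigr => i _; apply: Flin.
Qed.

Lemma expand_linear (M N V : lmodType k) (F : M -> N -> V) :
  bilinear_for *:%R *:%R F ->
  linear (fun t : tens M N => \sum_(p <- expand t) F p.1 p.2).
Proof.
move=> Fbil; pose b : {bilinear M -> N -> V} :=
  HB.pack F (bilinear_isBilinear.Build k M N V _ _ F Fbil).
by move=> c x y; apply: (linearP (tlift b)).
Qed.

Lemma expand_tpure (M N V : lmodType k) (F : M -> N -> V) m n :
  bilinear_for *:%R *:%R F ->
  \sum_(p <- expand (m \ox n)) F p.1 p.2 = F m n.
Proof.
move=> Fbil; pose b : {bilinear M -> N -> V} :=
  HB.pack F (bilinear_isBilinear.Build k M N V _ _ F Fbil).
exact: (tliftE b).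
Qed.

End SumLinear.

Section Bar.
Variables (k : comNzRingType) (B : algType k).

Definition bar_rel (x y : B) : bool := `[< exists c : k, x - y = c%:A >].

Lemma bar_rel_refl : reflexive bar_rel.
Proof. by move=> x; apply/asboolP; exists 0; rewrite subrr scale0r. Qed.

Lemma bar_rel_sym : symmetric bar_rel.
Proof.
by move=> x y; apply/asboolP/asboolP => -[c e]; exists (- c);
  rewrite -opprB e scaleNr.
Qed.

Lemma bar_rel_trans : transitive bar_rel.
Proof.
move=> y x z /asboolP[c e] /asboolP[d e']; apply/asboolP; exists (c + d).
by rewrite scalerDl -e -e' addrA subrK.
Qed.

Canonical bar_equiv := EquivRel bar_rel bar_rel_refl bar_rel_sym bar_rel_trans.

(* Also when k -> B is not injective, B / k is the quotient by its image. *)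
Definition bar : Type := {eq_quot bar_equiv}.
HB.instance Definition _ := Choice.on bar.
HB.instance Definition _ := Quotient.on bar.

Definition tobar (x : B) : bar := \pi_bar x.

Lemma bar_eqP (x y : B) : tobar x = tobar y <-> exists c : k, x - y = c%:A.
Proof.
split; first by move/eqmodP/asboolP.
by move=> h; apply/eqmodP/asboolP.
Qed.

Definition bar_add (x y : bar) : bar := tobar (repr x + repr y).
Definition bar_scale (c : k) (x : bar) : bar := tobar (c *: repr x).
Definition bar_opp (x : bar) : bar := bar_scale (-1) x.

Lemma repr_bar x : exists c : k, repr (tobar x) - x = c%:A.
Proof. by apply/bar_eqP; rewrite /tobar reprK. Qed.

Lemma bar_addE x y : bar_add (tobar x) (tobar y) = tobar (x + y).
Proof.
apply/bar_eqP; have [c e] := repr_bar x; have [d e'] := repr_bar y.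
by exists (c + d); rewrite scalerDl -e -e' opprD addrACA.
Qed.

Lemma bar_scaleE c x : bar_scale c (tobar x) = tobar (c *: x).
Proof.
apply/bar_eqP; have [d e] := repr_bar x; exists (c * d).
by rewrite -scalerA -e scalerBr.
Qed.

Lemma tobarK x : tobar (repr x) = x. Proof. exact: reprK. Qed.

Lemma bar_addA : associative bar_add.
Proof.
by move=> x y z; rewrite -[x]tobarK -[y]tobarK -[z]tobarK !bar_addE addrA.
Qed.
Lemma bar_addC : commutative bar_add.
Proof. by move=> x y; rewrite /bar_add addrC. Qed.
Lemma bar_add0 : left_id (tobar 0) bar_add.
Proof. by move=> x; rewrite -[x]tobarK bar_addE add0r. Qed.
Lemma bar_addN : left_inverse (tobar 0) bar_opp bar_add.
Proof.
by move=> x; rewrite -[x]tobarK /bar_opp bar_scaleE bar_addE scaleN1r addNr.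
Qed.
HB.instance Definition _ :=
  GRing.isZmodule.Build bar bar_addA bar_addC bar_add0 bar_addN.

Lemma bar_scaleA c d x : bar_scale c (bar_scale d x) = bar_scale (c * d) x.
Proof. by rewrite -[x]tobarK !bar_scaleE scalerA. Qed.
Lemma bar_scale1 : left_id 1 bar_scale.
Proof. by move=> x; rewrite -[x]tobarK bar_scaleE scale1r. Qed.
Lemma bar_scaleDr : right_distributive bar_scale +%R.
Proof.
move=> c x y; rewrite -[x]tobarK -[y]tobarK /GRing.add /=.
by rewrite !(bar_addE, bar_scaleE) scalerDr.
Qed.
Lemma bar_scaleDl x : {morph bar_scale^~ x : c d / c + d}.
Proof.
move=> c d /=; rewrite -[x]tobarK /GRing.add /=.
by rewrite !bar_scaleE bar_addE scalerDl.
Qed.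
HB.instance Definition _ := GRing.Zmodule_isLmodule.Build k bar
  bar_scaleA bar_scale1 bar_scaleDr bar_scaleDl.

Fact tobar_linear : linear tobar.
Proof.
by move=> c x y; rewrite /GRing.add /= {2}/GRing.scale /= bar_scaleE bar_addE.
Qed.
HB.instance Definition _ := GRing.isLinear.Build k B bar _ tobar tobar_linear.

End Bar.

HB.mixin Record isHopfAlgebra (k : comNzRingType) H of GRing.Algebra k H := {
  comul : {linear H -> tens H H};
  counit : {scalar H};
  antipode : {linear H -> H};
  comulA : forall h : H,
    \sum_(x <- expand (comul h)) x.1 \ox comul x.2 =
    \sum_(x <- expand (comul h)) \sum_(y <- expand (comul x.1))
      y.1 \ox (y.2 \ox x.2);
  counitl : forall h : H, \sum_(x <- expand (comul h)) counit x.1 *: x.2 = h;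
  counitr : forall h : H, \sum_(x <- expand (comul h)) counit x.2 *: x.1 = h;
  comulM : forall h l : H,
    comul (h * l) = \sum_(x <- expand (comul h)) \sum_(y <- expand (comul l))
      (x.1 * y.1) \ox (x.2 * y.2);
  comul1 : comul 1 = 1 \ox 1;
  counitM : forall h l : H, counit (h * l) = counit h * counit l;
  counit1 : counit 1 = 1;
  antipodel : forall h : H,
    \sum_(x <- expand (comul h)) antipode x.1 * x.2 = (counit h)%:A;
  antipoder : forall h : H,
    \sum_(x <- expand (comul h)) x.1 * antipode x.2 = (counit h)%:A
}.

#[short(type="hopfAlgType")]
HB.structure Definition HopfAlgebra (k : comNzRingType) :=
  {H of GRing.Algebra k H & isHopfAlgebra k H}.

Section Sweedler.
Variables (k : comNzRingType) (H : hopfAlgType k).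

(* h^(1) (x) h^(2) = \sum_(x <- sw2 h) x.1 (x) x.2, and similarly
   h^(1) (x) h^(2) (x) h^(3) = \sum_(x <- sw3 h) x.1.1 (x) x.1.2 (x) x.2. *)
Definition sw2 (h : H) : seq (H * H) := expand (comul h).

Definition sw3 (h : H) : seq (H * H * H) :=
  [seq (y.1, y.2, x.2) | x <- sw2 h, y <- sw2 x.1].

(* The componentwise coproduct of h_i (x) ... (x) h_j, given as a list. *)
Fixpoint swseq (hs : seq H) : seq (seq H * seq H) :=
  if hs is h :: hs' then
    [seq (x.1 :: y.1, x.2 :: y.2) | x <- sw2 h, y <- swseq hs']
  else [:: ([::], [::])].

Lemma sw2_linear (V : lmodType k) (F : H -> H -> V) :
  bilinear_for *:%R *:%R F -> linear (fun h => \sum_(x <- sw2 h) F x.1 x.2).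
Proof.
by move=> Fbil c h l; rewrite /sw2 linearP; apply: (expand_linear Fbil).
Qed.

End Sweedler.

Record weak_action (k : comNzRingType) (H : hopfAlgType k) (A : algType k) :=
  WeakAction {
    wact :> {bilinear H -> A -> A};
    wactM : forall h a b, wact h (a * b) = \sum_(x <- sw2 h) wact x.1 a * wact x.2 b;
    wact_1 : forall h, wact h 1 = (counit h)%:A;
    wact1 : forall a, wact 1 a = a
  }.

Section CrossedProduct.
Variables (k : comNzRingType) (H : hopfAlgType k) (A : algType k).
Variables (act : weak_action H A) (f : {linear tens H H -> A}).

(* (a # h) (b # l) = a b^{h^(1)} f(h^(2), l^(1)) # h^(3) l^(2), where a # h is
   a \ox h *)
Definition cpmul : {linear tens (tens A H) (tens A H) -> tens A H} :=
  linext (fun t : A * H * A * H =>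
            let: (a, h, b, l) := t in (a \ox h) \ox (b \ox l))
         (fun t : A * H * A * H =>
            let: (a, h, b, l) := t in
            \sum_(x <- sw3 h) \sum_(y <- sw2 l)
              (a * act x.1.1 b * f (x.1.2 \ox y.1)) \ox (x.2 * y.2)).

Lemma cpmulE a h b l :
  cpmul ((a \ox h) \ox (b \ox l)) =
  \sum_(x <- sw3 h) \sum_(y <- sw2 l)
    (a * act x.1.1 b * f (x.1.2 \ox y.1)) \ox (x.2 * y.2).
Proof.
pose G a h b l : tens A H := \sum_(x <- sw3 h) \sum_(y <- sw2 l)
  (a * act x.1.1 b * f (x.1.2 \ox y.1)) \ox (x.2 * y.2).
have Ga h' b' l' : linear (fun a => G a h' b' l').
  do 2!apply: sum_linear => ?; move=> c x y.
  by rewrite !mulrDl -!scalerAl linearPl.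
have Gb a' h' l' : linear (fun b => G a' h' b l').
  do 2!apply: sum_linear => ?; move=> c x y.
  by rewrite linearPr mulrDr mulrDl -scalerAr -scalerAl linearPl.
have Gl a' h' b' : linear (fun l => G a' h' b' l).
  apply: sum_linear => x; apply: (@sw2_linear _ _ _ (fun y z =>
    (a' * act x.1.1 b' * f (x.1.2 \ox y)) \ox (x.2 * z))).
  split=> y c u v /=.
    by rewrite linearPr linearP mulrDr -scalerAr linearPl.
  by rewrite mulrDr -scalerAr linearPr.
have Gh a' b' l' : linear (fun h => G a' h b' l').
  pose K x1 x2 x3 : tens A H := \sum_(y <- sw2 l')
    (a' * act x1 b' * f (x2 \ox y.1)) \ox (x3 * y.2).
  have K1 x2 x3 : linear (fun x1 => K x1 x2 x3).
    apply: sum_linear => y c u v.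
    by rewrite linearPl mulrDr mulrDl -scalerAr -scalerAl linearPl.
  have K2 x1 x3 : linear (fun x2 => K x1 x2 x3).
    apply: sum_linear => y c u v.
    by rewrite linearPl linearP mulrDr -scalerAr linearPl.
  have K3 x1 x2 : linear (fun x3 => K x1 x2 x3).
    by apply: sum_linear => y c u v; rewrite mulrDl -scalerAl linearPr.
  have -> : (fun h => G a' h b' l') =
      (fun h => \sum_(x <- sw2 h) \sum_(z <- sw2 x.1) K z.1 z.2 x.2).
    by apply/funext => h'; rewrite /G /sw3 big_allpairs_dep.
  apply: (@sw2_linear _ _ _ (fun u v => \sum_(z <- sw2 u) K z.1 z.2 v)).
  split=> y; first by apply: (@sw2_linear _ _ _ (fun z w => K z w y)); split=> z; [apply: (K1 z y) | apply: (K2 z y)].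
  by apply: sum_linear => z; apply: K3.
pose L u v : tens A H :=
  \sum_(p <- expand u) \sum_(q <- expand v) G p.1 p.2 q.1 q.2.
have G1 p1 p2 : bilinear_for *:%R *:%R (G p1 p2).
  by split=> z; [apply: (Gb p1 p2 z) | apply: (Gl p1 p2 z)].
have G2 v : bilinear_for *:%R *:%R
    (fun a h => \sum_(q <- expand v) G a h q.1 q.2).
  by split=> z; apply: sum_linear => q; [apply: Ga | apply: Gh].
have Lbil : bilinear_for *:%R *:%R L.
  split=> u; first exact: (expand_linear (G2 u)).
  by apply: sum_linear => p; apply: (expand_linear (G1 p.1 p.2)).
pose b0 : {bilinear tens A H -> tens A H -> tens A H} :=
  HB.pack L (bilinear_isBilinear.Build k (tens A H) (tens A H) (tens A H) _ _ L Lbil).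
rewrite -[RHS]/(G a h b l).
apply: etrans (linextE (g := tlift b0 : {linear _ -> _}) _ (a, h, b, l)) _ => //.
move=> -[[[a' h'] b'] l'] /=.
by rewrite tliftE /= /L (expand_tpure _ _ (G2 _)) (expand_tpure _ _ (G1 _ _)).
Qed.

Definition is_crossed_product : Prop :=
  [/\ forall x y z, cpmul (x \ox cpmul (y \ox z)) = cpmul (cpmul (x \ox y) \ox z),
      forall x, cpmul ((1 \ox 1) \ox x) = x
    & forall x, cpmul (x \ox (1 \ox 1)) = x].

Definition crossed (cpP : is_crossed_product) : Type := tens A H.

Section Algebra.
Variable cpP : is_crossed_product.
Local Notation E := (crossed cpP).

HB.instance Definition _ := GRing.Lmodule.on E.

Definition emul (x y : E) : E := cpmul (x \ox y).
Definition eone : E := 1 \ox 1.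

Fact emulA : associative emul. Proof. by case: cpP. Qed.
Fact emul1x : left_id eone emul. Proof. by case: cpP. Qed.
Fact emulx1 : right_id eone emul. Proof. by case: cpP. Qed.
Fact emulDl : left_distributive emul +%R.
Proof. by move=> x y z; rewrite /emul linearDl linearD. Qed.
Fact emulDr : right_distributive emul +%R.
Proof. by move=> x y z; rewrite /emul linearDr linearD. Qed.

Definition counit_proj_pure (a : A) (h : H) : A := counit h *: a.
Fact counit_proj_pure_bilinear : bilinear_for *:%R *:%R counit_proj_pure.
Proof.
split=> [h|a] c x y; rewrite /counit_proj_pure.
  by rewrite /= scalerDr !scalerA mulrC.
by rewrite /= linearP scalerDl -scalerA.
Qed.
HB.instance Definition _ := bilinear_isBilinear.Build k A H A _ _
  counit_proj_pure counit_proj_pure_bilinear.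

Fact eone_neq0 : eone != 0.
Proof.
apply/eqP => /(congr1 (tlift counit_proj_pure)).
rewrite tliftE /= linear0 /counit_proj_pure counit1 scale1r.
exact/eqP/oner_neq0.
Qed.

HB.instance Definition _ := GRing.Zmodule_isNzRing.Build E
  emulA emul1x emulx1 emulDl emulDr eone_neq0.

Fact escaleAl (c : k) (x y : E) : c *: (x * y) = (c *: x) * y.
Proof. by rewrite /GRing.mul /= /emul linearZl_LR linearZ. Qed.
HB.instance Definition _ := GRing.Lmodule_isLalgebra.Build k E escaleAl.

Fact escaleAr (c : k) (x y : E) : c *: (x * y) = x * (c *: y).
Proof. by rewrite /GRing.mul /= /emul linearZr_LR linearZ. Qed.
HB.instance Definition _ := GRing.Lalgebra_isAlgebra.Build k E escaleAr.

End Algebra.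
End CrossedProduct.

Section Bimodules.
Variables (k : comNzRingType) (E : algType k).

Record rmodule := RModule {
  rmod_sort :> lmodType k;
  ract : rmod_sort -> E -> rmod_sort;
  ract_bilinear : bilinear_for *:%R *:%R ract;
  ract1 : forall x, ract x 1 = x;
  ractA : forall x e e', ract (ract x e) e' = ract x (e * e')
}.
HB.instance Definition _ (M : rmodule) :=
  bilinear_isBilinear.Build k M E M _ _ (@ract M) (ract_bilinear M).

(* E-bimodules on which k acts symmetrically, i.e. left modules over
   E (x) E^op. *)
Record bimodule := Bimodule {
  bimod_rmod :> rmodule;
  lact : E -> bimod_rmod -> bimod_rmod;
  lact_bilinear : bilinear_for *:%R *:%R lact;
  lact1 : forall x, lact 1 x = x;
  lactA : forall e e' x, lact e (lact e' x) = lact (e * e') x;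
  lractA : forall e x e', ract (lact e x) e' = lact e (ract x e')
}.
HB.instance Definition _ (M : bimodule) :=
  bilinear_isBilinear.Build k E M M _ _ (@lact M) (lact_bilinear M).

Definition is_lhom (M N : bimodule) (g : M -> N) : Prop :=
  linear g /\ forall e x, g (lact e x) = lact e (g x).

Definition is_bihom (M N : bimodule) (g : M -> N) : Prop :=
  is_lhom g /\ forall x e, g (ract x e) = ract (g x) e.

(* Relative to E -> E (x) E^op: P lifts along the bimodule maps that split as
   maps of left E-modules. *)
Definition rel_projective (P : bimodule) : Prop :=
  forall (M N : bimodule) (g : M -> N) (h : P -> N),
    is_bihom g -> (exists2 t : N -> M, is_lhom t & cancel t g) ->
    is_bihom h -> exists2 h' : P -> M, is_bihom h' & forall x, g (h' x) = h x.

Definition rel_projective_resolution (M : bimodule) (X : nat -> bimodule)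
    (d : forall n, X n.+1 -> X n) (eps : X 0%N -> M) : Prop :=
  [/\ is_bihom eps /\ forall n, is_bihom (@d n),
      (forall x, eps (d 0%N x) = 0) /\ forall n x, d n (d n.+1 x) = 0,
      exists (s' : M -> X 0%N) (s : forall n, X n -> X n.+1),
        [/\ is_lhom s' /\ forall n, is_lhom (@s n),
            forall x, eps (s' x) = x,
            forall x, s' (eps x) + d 0%N (s 0%N x) = x
          & forall n x, s n (d n x) + d n.+1 (s n.+1 x) = x]
    & forall n, rel_projective (X n)].

Definition reg_mul (x y : E) : E := x * y.
Fact reg_mul_bilinear : bilinear_for *:%R *:%R reg_mul.
Proof.
split=> [y|x] c u v; rewrite /reg_mul.
  by rewrite /= mulrDl scalerAl.
by rewrite /= mulrDr scalerAr.
Qed.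
HB.instance Definition _ := bilinear_isBilinear.Build k E E E _ _
  reg_mul reg_mul_bilinear.
HB.instance Definition _ (x : E) :=
  GRing.isLinear.Build k E E _ (reg_mul x) (reg_mul_bilinear.2 x).

Definition reg_rmodule : rmodule :=
  @RModule E reg_mul reg_mul_bilinear (@mulr1 E) (fun x y z => esym (mulrA x y z)).
Definition reg_bimodule : bimodule :=
  @Bimodule reg_rmodule reg_mul reg_mul_bilinear (@mul1r E) (@mulrA E)
    (fun x y z => esym (mulrA x y z)).

Section TensRmodule.
Variables (V : lmodType k) (M : rmodule).

Definition tens_ract (t : tens V M) (e : E) : tens V M :=
  tmap idfun (applyr (@ract M) e) t.
Fact tens_ract_bilinear : bilinear_for *:%R *:%R tens_ract.
Proof.
split=> [e|t] c u v; rewrite /tens_ract; first by rewrite linearP.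
rewrite [t]expandE !linear_sum /= scaler_sumr -big_split; apply: eq_bigr => p _.
by rewrite !tmapE /= !linearPr.
Qed.
HB.instance Definition _ := bilinear_isBilinear.Build k (tens V M) E (tens V M)
  _ _ tens_ract tens_ract_bilinear.

Fact tens_ractE v x e : tens_ract (v \ox x) e = v \ox ract x e.
Proof. exact: tmapE. Qed.

Fact tens_ract1 t : tens_ract t 1 = t.
Proof.
rewrite [t]expandE /tens_ract linear_sum; apply: eq_bigr => p _.
by rewrite tmapE /= ract1.
Qed.
Fact tens_ractA t e e' : tens_ract (tens_ract t e) e' = tens_ract t (e * e').
Proof.
pose g := applyr (@ract M).
apply: (@tens_ext _ _ _ _ (tmap idfun (g e') \o tmap idfun (g e))
  (tmap idfun (g (e * e')))) => v x /=.
by rewrite !tmapE /= ractA.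
Qed.

Definition tens_rmodule : rmodule :=
  @RModule (tens V M) tens_ract tens_ract_bilinear tens_ract1 tens_ractA.
End TensRmodule.

Section InducedBimodule.
Variable M : rmodule.

Definition ind_lact (e : E) (t : tens_rmodule E M) : tens_rmodule E M :=
  tmap (reg_mul e) idfun t.
Fact ind_lact_bilinear : bilinear_for *:%R *:%R ind_lact.
Proof.
split=> [t|e] c u v; rewrite /ind_lact; last by rewrite linearP.
rewrite [t]expandE !linear_sum /= scaler_sumr -big_split; apply: eq_bigr => p _.
by rewrite !tmapE /= !linearPl.
Qed.
HB.instance Definition _ := bilinear_isBilinear.Build k
  E (tens_rmodule E M) (tens_rmodule E M) _ _ ind_lact ind_lact_bilinear.

Fact ind_lact1 t : ind_lact 1 t = t.
Proof.
rewrite [t]expandE /ind_lact linear_sum; apply: eq_bigr => p _.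
by rewrite tmapE /= /reg_mul mul1r.
Qed.
Fact ind_lactA e e' t : ind_lact e (ind_lact e' t) = ind_lact (e * e') t.
Proof.
pose g e := tmap (N' := M) (reg_mul e) idfun.
apply: (@tens_ext _ _ _ _ (g e \o g e') (g (e * e'))) => v x /=.
by rewrite !tmapE /= /reg_mul mulrA.
Qed.
Fact ind_lractA e t e' : ract (ind_lact e t) e' = ind_lact e (ract t e').
Proof.
pose l := tmap (N' := M) (reg_mul e) idfun.
pose r := tmap (M' := E) idfun (applyr (@ract M) e').
by apply: (@tens_ext _ _ _ _ (r \o l) (l \o r)) => v x; rewrite /= !tmapE.
Qed.

Definition ind_bimodule : bimodule :=
  @Bimodule (tens_rmodule E M) ind_lact ind_lact_bilinear ind_lact1 ind_lactA ind_lractA.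
End InducedBimodule.

Section DirectSum.
Variables (I : finType) (M : I -> bimodule).

Definition dsum : Type := forall i, M i.
HB.instance Definition _ := Choice.on dsum.

Local Definition dadd (x y : dsum) : dsum := fun i => x i + y i.
Local Definition dzero : dsum := fun i => 0.
Local Definition dopp (x : dsum) : dsum := fun i => - x i.
Local Definition dscale (c : k) (x : dsum) : dsum := fun i => c *: x i.

Fact daddA : associative dadd.
Proof. by move=> x y z; apply: functional_extensionality_dep => i; apply: addrA. Qed.
Fact daddC : commutative dadd.
Proof. by move=> x y; apply: functional_extensionality_dep => i; apply: addrC. Qed.
Fact dadd0 : left_id dzero dadd.
Proof. by move=> x; apply: functional_extensionality_dep => i; apply: add0r. Qed.
Fact daddN : left_inverse dzero dopp dadd.
Proof. by move=> x; apply: functional_extensionality_dep => i; apply: addNr. Qed.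
HB.instance Definition _ := GRing.isZmodule.Build dsum daddA daddC dadd0 daddN.

Fact dscaleA c c' x : dscale c (dscale c' x) = dscale (c * c') x.
Proof. by apply: functional_extensionality_dep => i; apply: scalerA. Qed.
Fact dscale1 : left_id 1 dscale.
Proof. by move=> x; apply: functional_extensionality_dep => i; apply: scale1r. Qed.
Fact dscaleDr : right_distributive dscale +%R.
Proof. by move=> c x y; apply: functional_extensionality_dep => i; apply: scalerDr. Qed.
Fact dscaleDl x : {morph dscale^~ x : c d / c + d}.
Proof. by move=> c d; apply: functional_extensionality_dep => i; apply: scalerDl. Qed.
HB.instance Definition _ := GRing.Zmodule_isLmodule.Build k dsum
  dscaleA dscale1 dscaleDr dscaleDl.

Definition dsum_ract (x : dsum) (e : E) : dsum := fun i => ract (x i) e.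
Definition dsum_lact (e : E) (x : dsum) : dsum := fun i => lact e (x i).
Fact dsum_ract_bilinear : bilinear_for *:%R *:%R dsum_ract.
Proof.
split=> [e|x] c u v; apply: functional_extensionality_dep => i;
  by [apply: (linearPl (@ract (M i))) | apply: (linearPr (@ract (M i)))].
Qed.
Fact dsum_lact_bilinear : bilinear_for *:%R *:%R dsum_lact.
Proof.
split=> [e|x] c u v; apply: functional_extensionality_dep => i;
  by [apply: (linearPl (@lact (M i))) | apply: (linearPr (@lact (M i)))].
Qed.
HB.instance Definition _ := bilinear_isBilinear.Build k dsum E dsum
  _ _ dsum_ract dsum_ract_bilinear.
HB.instance Definition _ := bilinear_isBilinear.Build k E dsum dsum
  _ _ dsum_lact dsum_lact_bilinear.

Fact dsum_ract1 x : dsum_ract x 1 = x.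
Proof. by apply: functional_extensionality_dep => i; apply: ract1. Qed.
Fact dsum_ractA x e e' : dsum_ract (dsum_ract x e) e' = dsum_ract x (e * e').
Proof. by apply: functional_extensionality_dep => i; apply: ractA. Qed.
Fact dsum_lact1 x : dsum_lact 1 x = x.
Proof. by apply: functional_extensionality_dep => i; apply: lact1. Qed.
Fact dsum_lactA e e' x : dsum_lact e (dsum_lact e' x) = dsum_lact (e * e') x.
Proof. by apply: functional_extensionality_dep => i; apply: lactA. Qed.
Fact dsum_lractA e x e' :
  dsum_ract (dsum_lact e x) e' = dsum_lact e (dsum_ract x e').
Proof. by apply: functional_extensionality_dep => i; apply: lractA. Qed.

Definition dsum_bimodule : bimodule :=
  @Bimodule (@RModule dsum dsum_ract dsum_ract_bilinear dsum_ract1 dsum_ractA)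
    dsum_lact dsum_lact_bilinear dsum_lact1 dsum_lactA dsum_lractA.
End DirectSum.

End Bimodules.

Section Resolution.
Variables (k : comNzRingType) (H : hopfAlgType k) (A : algType k).
Variables (act : weak_action H A) (f : {linear tens H H -> A}).
Variable cpP : is_crossed_product act f.
Local Notation E := (crossed cpP).

(* a^{\bar h} = (...((a^{h_j})^{h_{j-1}})...)^{h_i} for h = h_i (x) ... (x) h_j *)
Definition acts (hs : seq H) (a : A) : A := foldr (fun h => act h) a hs.

(* v_1 (x) ... (x) v_n (x) x in V (x) ... (x) V (x) M *)
Fixpoint tpower (V : lmodType k) (M : rmodule E) (n : nat) : rmodule E :=
  if n is n'.+1 then tens_rmodule V (tpower V M n') else M.

Fixpoint tpower_pure (V : lmodType k) (M : rmodule E) (n : nat)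
    (v : seq V) (x : M) : tpower V M n :=
  if n is n'.+1 then head 0 v \ox tpower_pure n' (behead v) x else x.

(* The tail \bar H^s (x) \bar A^r (x) E of X_{rs}. *)
Definition Xtail (r s : nat) : rmodule E :=
  tpower (bar H) (tpower (bar A) (reg_rmodule E) r) s.

Definition X (r s : nat) : bimodule E := ind_bimodule (Xtail r s).

Definition Xtail_pure (r s : nat) (hs : seq H) (a : seq A) (e : E) : Xtail r s :=
  tpower_pure s [seq tobar h | h <- hs]
    (tpower_pure r [seq tobar b | b <- a] (e : reg_rmodule E)).

(* a_0 (x) h_{0s} (x) a (x) h_{s+1}, where hs = [h_0; ...; h_s] and
   a = [a_1; ...; a_{r+1}] *)
Definition Xpure (r s : nat) (a0 : A) (hs : seq H) (a : seq A) (h' : H) : X r s :=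
  (a0 \ox head 0 hs : E) \ox Xtail_pure r s (behead hs) a (nth 0 a r \ox h' : E).

Definition Y (s : nat) : lmodType k :=
  tens E (iter s (tens (bar H)) H).

Fixpoint Ytail_pure (s : nat) (hs : seq H) : iter s (tens (bar H)) H :=
  if s is s'.+1 then tobar (head 0 hs) \ox Ytail_pure s' (behead hs)
  else head 0 hs.

(* a_0 (x) h, where hs = [h_0; ...; h_{s+1}] *)
Definition Ypure (s : nat) (a0 : A) (hs : seq H) : Y s :=
  (a0 \ox head 0 hs : E) \ox Ytail_pure s (behead hs).

(* Elementary tensors (a_0, h_{0s}, a_{1,r+1}, h_{s+1}) of X_{rs} and
   (a_0, h_{0,s+1}) of Y_s, with entries of \bar H and \bar A represented in H
   and A. *)
Definition Xdata (r s : nat) : Type := A * s.+1.-tuple H * r.+1.-tuple A * H.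
Definition Ydata (s : nat) : Type := A * s.+2.-tuple H.

Definition Xof (r s : nat) (t : Xdata r s) : X r s :=
  let: (a0, hs, a, h') := t in Xpure r s a0 hs a h'.
Definition Yof (s : nat) (t : Ydata s) : Y s :=
  let: (a0, hs) := t in Ypure s a0 hs.

Definition mu_ (s : nat) : {linear X 0 s -> Y s} :=
  linext (@Xof 0 s) (fun t : Xdata 0 s =>
    let: (a0, hs, a, h') := t in
    \sum_(x <- swseq hs) Ypure s (a0 * acts x.1 a`_0) (rcons x.2 h')).

(* d^0_{rs}; meaningful for r >= 1 only. *)
Definition d0 (r s : nat) : {linear X r s -> X r.-1 s} :=
  linext (@Xof r s) (fun t : Xdata r s =>
    let: (a0, hs, a, h') := t in
    \sum_(x <- swseq hs) Xpure r.-1 s (a0 * acts x.1 a`_0) x.2 (behead a) h' +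
    \sum_(1 <= i < r.+1) (-1) ^+ i *:
      Xpure r.-1 s a0 hs
        (take i.-1 a ++ (a`_i.-1 * a`_i) :: drop i.+1 a) h').

(* \partial_s; meaningful for s >= 1 only. *)
Definition partial_ (s : nat) : {linear Y s -> Y s.-1} :=
  linext (@Yof s) (fun t : Ydata s =>
    let: (a, hs) := t in
    \sum_(0 <= i < s.+1) (-1) ^+ i.+1 *:
      \sum_(x <- swseq (take i hs))
      \sum_(y <- sw2 hs`_i) \sum_(z <- sw2 hs`_i.+1)
        Ypure s.-1 (a * acts x.1 (f (y.1 \ox z.1)))
          (x.2 ++ (y.2 * z.2) :: drop i.+2 hs)).

(* \sigma^0_{0s} *)
Definition sigmaY (s : nat) : {linear Y s -> X 0 s} :=
  linext (@Yof s) (fun t : Ydata s =>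
    let: (a0, hs) := t in Xpure 0 s a0 (take s.+1 hs) [:: 1] hs`_s.+1).

(* \sigma^0_{r+1,s} *)
Definition sigma (r s : nat) : {linear X r s -> X r.+1 s} :=
  linext (@Xof r s) (fun t : Xdata r s =>
    let: (a0, hs, a, h') := t in
    (-1) ^+ r.+1 *: Xpure r.+1 s a0 hs (rcons a 1) h').

(* The bimodule map X_{rs} -> M that agrees with F on the elements
   1 (x) h (x) a (x) 1. *)
Definition bimod_ext (r s : nat) (M : bimodule E) (F : X r s -> M) :
    {linear X r s -> M} :=
  linext (fun t : E * s.-tuple H * r.-tuple A * E =>
            let: (e, hs, a, e') := t in (e \ox Xtail_pure r s hs a e' : X r s))
         (fun t : E * s.-tuple H * r.-tuple A * E =>
            let: (e, hs, a, e') := t in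
            lact e (ract (F ((1 : E) \ox Xtail_pure r s hs a 1)) e')).

(* The identity map from X_{rs} to X_{r's'} when (r', s') = (r, s), and 0
   otherwise. *)
Definition recast (r s r' s' : nat) (x : X r s) : X r' s' :=
  if (r, s) =P (r', s') is ReflectT e
  then eq_rect (r, s) (fun p => X p.1 p.2 : Type) x (r', s') e else 0.

Lemma recast_id (r s : nat) (x : X r s) : recast r s x = x.
Proof.
rewrite /recast; case: eqP => // e.
by rewrite (eq_irrelevance e erefl).
Qed.

(* d^l_{rs}; meaningful for l <= s and 0 < r + l. In each recursive call
   r + 2 l decreases, so that n = r + 2 l + 1 is enough fuel. *)
Fixpoint dfuel (n l r s : nat) {struct n} : X r s -> X (r + l).-1 (s - l) :=
  if n isn't n'.+1 then fun=> 0 else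
  if l == 0%N then
    if r == 0%N then fun=> 0 else fun x => recast _ _ (d0 r s x)
  else if (r == 0%N) && (l == 1%N) then
    bimod_ext (fun x => - recast _ _ (sigmaY s.-1 (partial_ s (mu_ s (recast 0 s x)))))
  else
    bimod_ext (fun x =>
      - \sum_(0 <= j < l | (0 < r + j)%N)
          recast _ _ (sigma (r + l).-2 (s - l) (recast _ _
            (dfuel n' (l - j) (dfuel n' j x))))).

Definition dl (l r s : nat) : X r s -> X (r + l).-1 (s - l) :=
  dfuel (r + l.*2).+1 l (r := r) (s := s).

Lemma dfuel_enough n m l r s (x : X r s) :
  (r + l.*2 < n)%N -> (r + l.*2 < m)%N -> dfuel n l x = dfuel m l x.
Proof.
elim: n m l r s x => [|n IH] [|m] l r s x //= ltn ltm.
case: eqP => // /eqP l0; case: ifP => // _.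
have ext (F G : X r s -> X (r + l).-1 (s - l)) :
  F =1 G -> bimod_ext F x = bimod_ext G x by move=> /funext ->.
apply: ext => y; congr (- _).
rewrite big_nat_cond [RHS]big_nat_cond; apply: eq_bigr => j /andP[/andP[_ jl] rj].
have meas p : (r + l.*2 < p.+1)%N -> ((r + j).-1 + (l - j).*2 < p)%N by lia.
have lj p : (r + l.*2 < p.+1)%N -> (r + j.*2 < p)%N by lia.
rewrite (IH m); [|exact: meas|exact: meas].
by rewrite (IH m j); [|exact: lj|exact: lj].
Qed.

(* The recursion that defines the d^l_{rs}, without fuel. *)
Lemma dl_d0 r s (x : X r.+1 s) :
  dl 0 x = recast (r.+1 + 0).-1 (s - 0) (d0 r.+1 s x).
Proof. by []. Qed.

Lemma dl_01 s (x : X 0 s) : dl 1 x =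
  bimod_ext (fun y : X 0 s =>
    - recast (0 + 1).-1 (s - 1) (sigmaY s.-1 (partial_ s (mu_ s y)))) x.
Proof.
have ext (F G : X 0 s -> X (0 + 1).-1 (s - 1)) :
  F =1 G -> bimod_ext F x = bimod_ext G x by move=> /funext ->.
by apply: ext => y /=; rewrite recast_id.
Qed.

Lemma dl_rec l r s (x : X r s) : (0 < l)%N -> (1 < r + l)%N -> dl l x =
  bimod_ext (fun y : X r s =>
    - \sum_(0 <= j < l | (0 < r + j)%N)
        recast (r + l).-1 (s - l) (sigma (r + l).-2 (s - l)
          (recast (r + l).-2 (s - l) (dl (l - j) (dl j y))))) x.
Proof.
move=> l0 rl; rewrite {1}/dl /=.
case: eqP => [|_]; first by lia.
case: ifP => [|_]; first by lia.
have ext (F G : X r s -> X (r + l).-1 (s - l)) :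
  F =1 G -> bimod_ext F x = bimod_ext G x by move=> /funext ->.
apply: ext => y; congr (- _).
rewrite big_nat_cond [RHS]big_nat_cond; apply: eq_bigr => j /andP[/andP[_ jl] rj].
do 3!congr (_ _); rewrite /dl (@dfuel_enough _ (r + j.*2).+1 j); [|lia|lia].
by apply: dfuel_enough; lia.
Qed.

(* X_n, with X_{rs}, r + s = n, indexed by s. *)
Definition Xn (n : nat) : bimodule E :=
  dsum_bimodule (fun s : 'I_n.+1 => X (n - s) s).

Definition inXn (n r s : nat) (x : X r s) : Xn n :=
  fun j : 'I_n.+1 => recast (n - j) j x.

Definition dn (n : nat) (x : Xn n.+1) : Xn n :=
  \sum_(s < n.+2) \sum_(0 <= l < s.+1 | (0 < (n.+1 - s) + l)%N)
    @inXn n _ _ (dl l (x s)).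

Definition mulE (x : Xn 0) : reg_bimodule E := tlift (@reg_mul k E) (x ord0).

End Resolution.

(* Main.v *)
(* Each row X_{*s} is E (x) H^s-bar tensored with the normalised bar resolution
   of A with coefficients in E; its homology is Y_s, and sigma^0 contracts it.
   Y_* is, up to sign, the normalised bar complex of E relative to A, which has
   a left E-linear contraction appending 1.  Each d^l is given on generators x
   (outer factors 1) by d^l x = - sigma^0 T x with
   T x = sum_{j < l} d^{l-j} d^j x.  The identities of degree < l on x, and that
   of degree l on d^0 x (one r lower), give d^0 (T x) = 0, and mu (T x) = 0 when
   it makes sense; hence T x = d^0 sigma^0 T x = - d^0 d^l x, i.e. d d = 0.

   For exactness, correct sigma^0 by the contraction of Y_* to get a left
   E-linear tau.  Then tau d + d tau = 1 - N with N lowering the filtration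
   by s, hence nilpotent and commuting with d, and tau (1 + N + N^2 + ...) is a
   contraction.  Each X_{rs} is relatively projective because its tail
   H^s-bar (x) A^r-bar (x) E is an induced right E-module. *)
From HB Require Import structures.
Require Import Defs.
From mathcomp Require Import all_boot all_algebra.
From mathcomp Require Import boolp zify.

Set Implicit Arguments.
Unset Strict Implicit.
Unset Printing Implicit Defensive.

Import GRing.Theory.
Local Open Scope ring_scope.

(** * Linear maps out of tensor products, reduced factors and towers *)

Section Lifts.
Variable k : comNzRingType.

(** The conditions relating [f] to the action and to itself are never expanded; they enter through
    associativity of [E]. The differentials are built from left multiplication by 1 # h in [E],
    followed by splitting off the [A] component, and only then compared with the Sweedler formulas.
    That d^0 d^0 and the square of the differential of [Y] vanish follows by induction from the
    contracting homotopies, because right multiples of elements ending in 1 span; no faces are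
    cancelled. The obstacle is the right action. Each sigma^0 is only left linear, so the recursion
    for d^l is usable only where the right outer factor is 1, and the relation between d^1 and the
    differential of [Y] must be carried from there to all of X_{0s}. Instead of a right action on
    [Y], two facts do this: the kernel of mu is the image of d^0, hence stable under right
    multiplication, and the bar differential of the X_{0s} with coefficients in [E] is a bimodule
    map lying over the differential of [Y]. In the contraction, appending 1 lands in left multiples
    of generators, where d^1 is known exactly. *)

Definition tensl (M N V : lmodType k) (F : M -> N -> V)
    (Fbil : bilinear_for *:%R *:%R F) : {linear tens M N -> V} :=
  tlift (HB.pack F (bilinear_isBilinear.Build k M N V _ _ F Fbil)).

Lemma tenslE (M N V : lmodType k) (F : M -> N -> V)
    (Fbil : bilinear_for *:%R *:%R F) m n :
  tensl Fbil (m \ox n) = F m n.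
Proof. exact: tliftE. Qed.

(** Two representatives of a class differ by a multiple of 1, which [F] kills. Maps out of reduced
    factors are built this way: a formula on [B] descends once it vanishes at 1. *)
Lemma bilinear_repr_bar (B : algType k) (N V : lmodType k) (F : B -> N -> V)
    (Fbil : bilinear_for *:%R *:%R F) (F1 : forall n, F 1 n = 0) x n :
  F (repr (tobar x)) n = F x n.
Proof.
have [c e] := repr_bar x; have [Fl _] := Fbil.
rewrite -(subrK x (repr (tobar x))) e -[c%:A]/(c *: 1).
by rewrite (Fl n c 1 x) /= F1 scaler0 add0r.
Qed.

Lemma bilinear_bar (B : algType k) (N V : lmodType k) (F : B -> N -> V)
    (Fbil : bilinear_for *:%R *:%R F) (F1 : forall n, F 1 n = 0) :
  bilinear_for *:%R *:%R (fun (x : bar B) n => F (repr x) n).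
Proof.
have [Fl Fr] := Fbil.
split=> [n c x y|x]; last exact: Fr.
rewrite -[x]tobarK -[y]tobarK -linearP /= !bilinear_repr_bar //.
exact: Fl.
Qed.

Definition barl (B : algType k) (N V : lmodType k) (F : B -> N -> V)
    (Fbil : bilinear_for *:%R *:%R F) (F1 : forall n, F 1 n = 0) :
  {linear tens (bar B) N -> V} := tensl (bilinear_bar Fbil F1).

Lemma barlE (B : algType k) (N V : lmodType k) (F : B -> N -> V)
    (Fbil : bilinear_for *:%R *:%R F) (F1 : forall n, F 1 n = 0) x n :
  barl Fbil F1 (tobar x \ox n) = F x n.
Proof. by rewrite /barl tenslE bilinear_repr_bar. Qed.

Lemma tobar1 (B : algType k) : tobar (1 : B) = 0.
Proof.
rewrite -(linear0 (@tobar k B)); apply/bar_eqP; exists 1.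
by rewrite subr0 scale1r.
Qed.

Lemma tobar_surj (B : algType k) (x : bar B) : exists b, x = tobar b.
Proof. by exists (repr x); rewrite tobarK. Qed.

Lemma tens_ext_bar (B : algType k) (N V : lmodType k)
    (f g : {linear tens (bar B) N -> V}) :
  (forall b n, f (tobar b \ox n) = g (tobar b \ox n)) -> f =1 g.
Proof. by move=> fg; apply: tens_ext => x n; have [b ->] := tobar_surj x. Qed.

Fact tpure_linear (M N : lmodType k) (m : M) : linear (tpure (N := N) m).
Proof. by move=> c x y; rewrite linearPr. Qed.

Definition tpurel (M N : lmodType k) (m : M) : {linear N -> tens M N} :=
  HB.pack (tpure (N := N) m) (GRing.isLinear.Build k N (tens M N) _ _
    (@tpure_linear M N m)).

Lemma lcompE (U V W : lmodType k) (f : {linear V -> W}) (g : {linear U -> V}) x :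
  (f \o g : {linear U -> W}) x = f (g x).
Proof. by []. Qed.

Lemma tmap_comp (M M' M'' N N' N'' : lmodType k) (f : {linear M -> M'})
    (f' : {linear M' -> M''}) (g : {linear N -> N'}) (g' : {linear N' -> N''}) t :
  tmap f' g' (tmap f g t) = tmap (f' \o f) (g' \o g) t.
Proof.
pose g1 : {linear tens M N -> tens M'' N''} := tmap f' g' \o tmap f g.
suff E : g1 =1 tmap (f' \o f) (g' \o g) by exact: (E t).
by apply: tens_ext => m n; rewrite lcompE !tmapE.
Qed.

Fact assocl_bilinear (M N P : lmodType k) (m : M) :
  bilinear_for *:%R *:%R (fun (n : N) (p : P) => m \ox n \ox p).
Proof. by split=> [p|n] c x y; rewrite ?linearPr ?linearPl. Qed.

Fact tassocl_bilinear (M N P : lmodType k) :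
  bilinear_for *:%R *:%R (fun m : M => tensl (@assocl_bilinear M N P m)).
Proof.
split=> [t|m] c x y; last by rewrite linearP.
rewrite [t]expandE !linear_sum /= scaler_sumr -big_split; apply: eq_bigr => p _.
by rewrite !tenslE !linearPl.
Qed.

(* Here and below linear maps are taken from opaque existence lemmas, so that
   conversion never unfolds them down to representatives of tensors. *)
Lemma tassocl_sig (M N P : lmodType k) :
  {g : {linear tens M (tens N P) -> tens (tens M N) P} |
   forall m n p, g (m \ox (n \ox p)) = m \ox n \ox p}.
Proof.
by exists (tensl (@tassocl_bilinear M N P)) => m n p; rewrite !tenslE.
Qed.
Definition tassocl (M N P : lmodType k) := sval (tassocl_sig M N P).

Lemma tassoclE (M N P : lmodType k) (m : M) (n : N) (p : P) :
  tassocl M N P (m \ox (n \ox p)) = m \ox n \ox p.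
Proof. exact: (svalP (tassocl_sig M N P)). Qed.

Fact assocr_bilinear (M N P : lmodType k) (p : P) :
  bilinear_for *:%R *:%R (fun (m : M) (n : N) => m \ox (n \ox p)).
Proof. by split=> [n|m] c x y; rewrite ?linearPl ?linearPr. Qed.

Fact tassocr_bilinear (M N P : lmodType k) :
  bilinear_for *:%R *:%R (fun t (p : P) => tensl (@assocr_bilinear M N P p) t).
Proof.
split=> [p|t] c x y; first by rewrite linearP.
rewrite [t]expandE !linear_sum /= scaler_sumr -big_split; apply: eq_bigr => q _.
by rewrite !tenslE !linearPr.
Qed.

Lemma tassocr_sig (M N P : lmodType k) :
  {g : {linear tens (tens M N) P -> tens M (tens N P)} |
   forall m n p, g (m \ox n \ox p) = m \ox (n \ox p)}.
Proof.
by exists (tensl (@tassocr_bilinear M N P)) => m n p; rewrite !tenslE.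
Qed.
Definition tassocr (M N P : lmodType k) := sval (tassocr_sig M N P).

Lemma tassocrE (M N P : lmodType k) (m : M) (n : N) (p : P) :
  tassocr M N P (m \ox n \ox p) = m \ox (n \ox p).
Proof. exact: (svalP (tassocr_sig M N P)). Qed.

Section LeftMul.
Variable R : algType k.

(** An arbitrary module is allowed as second factor, so that one left action serves [X] and also
    [Y], which is a bare [lmodType] here; [lactE] relates it to [lact]. *)
Lemma lmulT_sig (W : lmodType k) (e : R) :
  {g : {linear tens R W -> tens R W} | forall x w, g (x \ox w) = (e * x) \ox w}.
Proof. by exists (tmap (reg_mul e) idfun) => x w; rewrite tmapE. Qed.
Definition lmulT (W : lmodType k) (e : R) := sval (lmulT_sig W e).

Lemma lmulTE (W : lmodType k) (e x : R) (w : W) :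
  lmulT W e (x \ox w) = (e * x) \ox w.
Proof. exact: (svalP (lmulT_sig W e)). Qed.

Fact lmulT_bilinear (U W : lmodType k) (b : {linear U -> tens R W}) :
  bilinear_for *:%R *:%R (fun e u => lmulT W e (b u)).
Proof.
split=> [u|e] c x y; last by rewrite !linearP.
rewrite [b u]expandE !linear_sum /= scaler_sumr -big_split.
by apply: eq_bigr => p _; rewrite !lmulTE mulrDl -scalerAl linearPl.
Qed.

Lemma lmulTA (W : lmodType k) e e' (t : tens R W) :
  lmulT W e (lmulT W e' t) = lmulT W (e * e') t.
Proof.
pose g1 : {linear tens R W -> tens R W} := lmulT W e \o lmulT W e'.
suff E : g1 =1 lmulT W (e * e') by exact: (E t).
by apply: tens_ext => x w; rewrite lcompE !lmulTE mulrA.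
Qed.

Lemma lmulT1 (W : lmodType k) (t : tens R W) : lmulT W 1 t = t.
Proof.
suff E : lmulT W 1 =1 (idfun : {linear tens R W -> tens R W}) by exact: (E t).
by apply: tens_ext => x w; rewrite lmulTE mul1r.
Qed.

(** [R] tensored with [U] is the free left [R]-module on [U]. Writing d^0, mu and the bar
    differentials in this form makes their left linearity automatic. *)
Lemma lext_sig (U W : lmodType k) (b : {linear U -> tens R W}) :
  {g : {linear tens R U -> tens R W} |
   forall e u, g (e \ox u) = lmulT W e (b u)}.
Proof. by exists (tensl (lmulT_bilinear b)) => e u; rewrite tenslE. Qed.
Definition lext (U W : lmodType k) (b : {linear U -> tens R W}) :=
  sval (lext_sig b).

Lemma lextE (U W : lmodType k) (b : {linear U -> tens R W}) e u :
  lext b (e \ox u) = lmulT W e (b u).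
Proof. exact: (svalP (lext_sig b)). Qed.

Lemma lext_lmulT (U W : lmodType k) (b : {linear U -> tens R W}) e t :
  lext b (lmulT U e t) = lmulT W e (lext b t).
Proof.
pose g1 : {linear tens R U -> tens R W} := lext b \o lmulT U e.
pose g2 : {linear tens R U -> tens R W} := lmulT W e \o lext b.
suff E : g1 =1 g2 by exact: (E t).
by apply: tens_ext => x u; rewrite !lcompE lmulTE !lextE lmulTA.
Qed.

Lemma lmulT_tmap (U W : lmodType k) (u : {linear U -> W}) e t :
  tmap idfun u (lmulT U e t) = lmulT W e (tmap idfun u t).
Proof.
pose g1 : {linear tens R U -> tens R W} := tmap idfun u \o lmulT U e.
pose g2 : {linear tens R U -> tens R W} := lmulT W e \o tmap idfun u.
suff E : g1 =1 g2 by exact: (E t).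
by apply: tens_ext => x w; rewrite !lcompE lmulTE !tmapE lmulTE.
Qed.

End LeftMul.

(* A tower presents V (x) ... (x) V (x) T 0.  The explicit isomorphisms let tail
   complexes defined by different recursions share one theory. *)
Record tower (V : lmodType k) := Tower {
  tow :> nat -> lmodType k;
  tcons : forall n, {linear tens V (tow n) -> tow n.+1};
  tucons : forall n, {linear tow n.+1 -> tens V (tow n)};
  tconsK : forall n, cancel (tcons n) (tucons n);
  tuconsK : forall n, cancel (tucons n) (tcons n)
}.

Lemma tow_ext (B : algType k) (T : tower (bar B)) n (W : lmodType k)
    (f g : {linear T n.+1 -> W}) :
  (forall b t, f (tcons T n (tobar b \ox t)) = g (tcons T n (tobar b \ox t))) ->
  f =1 g.
Proof.
move=> fg t; rewrite -[t]tuconsK.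
exact: (@tens_ext_bar _ _ _ (f \o tcons T n) (g \o tcons T n) fg).
Qed.

Section TowerMap.
Variables (V : lmodType k) (T T' : tower V) (u : {linear T 0%N -> T' 0%N}).

Fixpoint towmap n : {linear T n -> T' n} :=
  if n is n'.+1 then tcons T' n' \o (tmap idfun (towmap n') \o tucons T n') else u.

Lemma towmapS n v t :
  towmap n.+1 (tcons T n (v \ox t)) = tcons T' n (v \ox towmap n t).
Proof. by rewrite /= tconsK tmapE. Qed.
End TowerMap.

Fixpoint towpure (V : lmodType k) (T : tower V) n (v : seq V) (x : T 0%N) : T n :=
  if n is n'.+1 then tcons T n' (head 0 v \ox towpure n' (behead v) x) else x.

(** The spanning assumption concerns [T 0] alone and is phrased as an extension principle, because
    the last factor is spanned by different families in different uses and may itself be a tower. *)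
Lemma towpure_ext (B : algType k) (T : tower (bar B)) (I : Type)
    (p : I -> T 0%N) n (W : lmodType k) (f g : {linear T n -> W}) :
  (forall (f0 g0 : {linear T 0%N -> W}),
    (forall i, f0 (p i) = g0 (p i)) -> f0 =1 g0) ->
  (forall (bs : n.-tuple B) i, f (towpure n (map (@tobar k B) bs) (p i)) =
    g (towpure n (map (@tobar k B) bs) (p i))) -> f =1 g.
Proof.
move=> ext0; elim: n f g => [|n IH] f g fg.
  by apply: ext0 => i; apply: (fg [tuple]).
apply: tow_ext => b.
pose c : {linear T n -> T n.+1} := tcons T n \o tpurel (T n) (tobar b).
apply: (IH (f \o c) (g \o c)) => bs i.
by have := fg [tuple of b :: bs] i.
Qed.

Definition iterT (V W : lmodType k) : tower V :=
  @Tower V (fun n => iter n (tens V) W) (fun n => idfun) (fun n => idfun)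
    (fun n x => erefl) (fun n x => erefl).

End Lifts.

(** * Normalised bar complexes of A *)

Section NormalisedBar.
Variables (k : comNzRingType) (A : algType k).

Section TowerFacts.
Variables (V : lmodType k).

Lemma towpure_cat (T : tower V) n v w x : size v = n ->
  towpure (T := T) n (v ++ w) x = towpure (T := T) n v x.
Proof.
elim: n v => [|n IH] [|a v] //= [szv].
by rewrite IH.
Qed.

Lemma towmap_pure (T T' : tower V) (u : {linear T 0%N -> T' 0%N}) n v x :
  towmap u n (towpure (T := T) n v x) = towpure (T := T') n v (u x).
Proof. by elim: n v => [|n IH] v //; rewrite [towpure _ _ _]/= towmapS IH. Qed.

End TowerFacts.

Section BarA.
(** Unitality is what lets a (x) z - 1 (x) l (a (x) z) descend to the class of a modulo [k]. Along a
    tower, [l] becomes the alternating sum of all faces of a (x) z, with first factor reduced modulo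
    [k]. *)
Definition unital_mapA (Z : lmodType k) :=
  {l : {linear tens A Z -> Z} | forall z, l (1 \ox z) = z}.

Variables (Z : lmodType k) (l : unital_mapA Z).

Fact barA_step_bilinear : bilinear_for *:%R *:%R (fun a z =>
  a \ox z - 1 \ox sval l (a \ox z)).
Proof.
split=> [z|a] c x y.
  by rewrite !linearPl !linearP !linearPr /= scalerBr opprD addrACA.
by rewrite !linearPr !linearP !linearPr /= scalerBr opprD addrACA.
Qed.

Fact barA_step1 z :
  (1 : A) \ox z - (1 : A) \ox sval l ((1 : A) \ox z) = 0.
Proof. by rewrite (svalP l) subrr. Qed.

Lemma barA_step_sig : {g : {linear tens (bar A) Z -> tens A Z} |
  forall a z, g (tobar a \ox z) = a \ox z - 1 \ox sval l (a \ox z)}.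
Proof. by exists (barl barA_step_bilinear barA_step1) => a z; rewrite barlE. Qed.
Definition barA_step := sval barA_step_sig.

Lemma barA_stepE a z : barA_step (tobar a \ox z) =
  a \ox z - 1 \ox sval l (a \ox z).
Proof. exact: (svalP barA_step_sig). Qed.

End BarA.

Section BarATower.
Variables (T : tower (bar A)).

(** The map [l] in degree n gives the differential out of degree n+1; multiplying the first factor
    of its value by a, then reducing it modulo [k], gives [l] in degree n+1. Unitality survives
    because the correction term starts with 1, which is zero in the reduced factor. *)
Lemma unitalA_step n (l : unital_mapA (T n)) :
  {l' : unital_mapA (T n.+1) | forall y, sval l' y =
    tcons T n (tmap (@tobar k A) idfun
      (lext (barA_step l) (tmap idfun (tucons T n) y)))}.
Proof.
pose l' : {linear tens A (T n.+1) -> T n.+1} :=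
  tcons T n \o (tmap (@tobar k A) idfun \o
      (lext (barA_step l) \o tmap idfun (tucons T n))).
have l'1 z : l' (1 \ox z) = z.
  pose g1 : {linear T n.+1 -> T n.+1} := l' \o tpurel (T n.+1) (1 : A).
  suff e : g1 =1 (idfun : {linear T n.+1 -> T n.+1}) by exact: (e z).
  apply: tow_ext => a {}z.
  rewrite -[LHS]/(l' (1 \ox tcons T n (tobar a \ox z))) !lcompE tmapE tconsK.
  rewrite lextE lmulT1 barA_stepE !linearB !tmapE /= tobar1 linear0l.
  by rewrite linear0 subr0.
by exists (exist _ l' l'1) => y.
Qed.

Variable l0 : unital_mapA (T 0%N).

Fixpoint unitalA_tower n : unital_mapA (T n) :=
  if n is n'.+1 then sval (unitalA_step (unitalA_tower n')) else l0.

Lemma barA_diff_sig n : {g : {linear T n.+1 -> tens A (T n)} |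
  forall y, g y = barA_step (unitalA_tower n) (tucons T n y)}.
Proof. by exists (barA_step (unitalA_tower n) \o tucons T n) => y. Qed.
Definition barA_diff n := sval (barA_diff_sig n).

Local Notation l := unitalA_tower.

Lemma barA_diffE n a z : barA_diff n (tcons T n (tobar a \ox z)) =
  a \ox z - 1 \ox sval (l n) (a \ox z).
Proof. by rewrite (svalP (barA_diff_sig n)) tconsK barA_stepE. Qed.

Lemma unitalA_towerS n a y : sval (l n.+1) (a \ox y) =
  tcons T n (tmap (@tobar k A) idfun (lmulT _ a (barA_diff n y))).
Proof.
rewrite (svalP (unitalA_step (l n))) tmapE lextE.
by rewrite (svalP (barA_diff_sig n)).
Qed.

End BarATower.

Section BarAMap.
Variables (T T' : tower (bar A)) (u : {linear T 0%N -> T' 0%N}).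
Variables (l0 : unital_mapA (T 0%N)) (l0' : unital_mapA (T' 0%N)).
Hypothesis ul : forall y, sval l0' (tmap idfun u y) = u (sval l0 y).

(** Half of a mutual induction: a property of [l] in degree n passes to the differential, and from
    it to [l] in degree n+1. The same division recurs below for the relative bar complex. *)
Lemma barA_diff_towmap_step n :
  (forall y, sval (unitalA_tower l0' n) (tmap idfun (towmap u n) y) =
     towmap u n (sval (unitalA_tower l0 n) y)) ->
  forall y, barA_diff l0' n (towmap u n.+1 y) =
     tmap idfun (towmap u n) (barA_diff l0 n y).
Proof.
move=> IH y.
pose g1 : {linear T n.+1 -> tens A (T' n)} := barA_diff l0' n \o towmap u n.+1.
pose g2 : {linear T n.+1 -> tens A (T' n)} :=
  tmap idfun (towmap u n) \o barA_diff l0 n.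
suff e : g1 =1 g2 by exact: (e y).
apply: tow_ext => a z; rewrite [LHS]lcompE [RHS]lcompE towmapS !barA_diffE.
by rewrite [RHS]linearB !tmapE -IH tmapE.
Qed.

Lemma unitalA_tower_towmap n y :
  sval (unitalA_tower l0' n) (tmap idfun (towmap u n) y) =
     towmap u n (sval (unitalA_tower l0 n) y).
Proof.
elim: n y => [|n IH] y; first exact: ul.
pose g1 : {linear tens A (T n.+1) -> T' n.+1} :=
  sval (unitalA_tower l0' n.+1) \o tmap idfun (towmap u n.+1).
pose g2 : {linear tens A (T n.+1) -> T' n.+1} :=
  towmap u n.+1 \o sval (unitalA_tower l0 n.+1).
suff e : g1 =1 g2 by exact: (e y).
apply: tens_ext => a t; rewrite [LHS]lcompE [RHS]lcompE tmapE !unitalA_towerS.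
rewrite barA_diff_towmap_step // -lmulT_tmap.
move: (lmulT _ a _) => {}y.
pose g3 : {linear tens A (T n) -> T' n.+1} :=
  tcons T' n \o (tmap (@tobar k A) idfun \o tmap idfun (towmap u n)).
pose g4 : {linear tens A (T n) -> T' n.+1} :=
  towmap u n.+1 \o (tcons T n \o tmap (@tobar k A) idfun).
suff e : g3 =1 g4 by exact: (e y).
apply: tens_ext => b z.
rewrite -[LHS]/(tcons T' n (tmap (@tobar k A) idfun
  (tmap idfun (towmap u n) (b \ox z)))).
rewrite -[RHS]/(towmap u n.+1 (tcons T n (tmap (@tobar k A) idfun (b \ox z)))).
by rewrite !tmapE towmapS.
Qed.

Lemma barA_diff_towmap n y : barA_diff l0' n (towmap u n.+1 y) =
     tmap idfun (towmap u n) (barA_diff l0 n y).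
Proof. exact/barA_diff_towmap_step/unitalA_tower_towmap. Qed.

End BarAMap.

End NormalisedBar.

(** Regrouping by m = i + j; it collects composites of several d^l by the total amount by which they
    lower s. *)
Lemma big_triangle (V : nmodType) (F : nat -> nat -> V) n :
  \sum_(0 <= j < n) \sum_(0 <= i < n - j) F i j =
  \sum_(0 <= m < n) \sum_(0 <= j < m.+1) F (m - j)%N j.
Proof.
elim: n => [|n IH]; first by rewrite !big_geq.
rewrite [RHS]big_nat_recr //= -IH [in LHS]big_nat_recr //= subSn // subnn big_nat1.
rewrite [in RHS]big_nat_recr //= subnn addrA -big_split /=; congr (_ + _).
by apply: eq_big_nat => j /andP[_ jn]; rewrite subSn ?big_nat_recr // ltnW.
Qed.

(** * Multiplication in the crossed product *)

Section Sweedler.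
Variables (k : comNzRingType) (H : hopfAlgType k).

Lemma sum_counitl (V : lmodType k) (G : H -> V) h : linear G ->
  \sum_(x <- sw2 h) counit x.1 *: G x.2 = G h.
Proof.
move=> Glin; pose g : {linear H -> V} :=
  HB.pack G (GRing.isLinear.Build k H V _ G Glin).
rewrite -[in RHS](counitl h) -/(sw2 h) -[RHS]/(g _) linear_sum.
by apply: eq_bigr => x _; rewrite linearZ.
Qed.

Lemma sum_counitr (V : lmodType k) (G : H -> V) h : linear G ->
  \sum_(x <- sw2 h) counit x.2 *: G x.1 = G h.
Proof.
move=> Glin; pose g : {linear H -> V} :=
  HB.pack G (GRing.isLinear.Build k H V _ G Glin).
rewrite -[in RHS](counitr h) -/(sw2 h) -[RHS]/(g _) linear_sum.
by apply: eq_bigr => x _; rewrite linearZ.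
Qed.

Lemma sum_sw2_1 (V : lmodType k) (F : H -> H -> V) : bilinear_for *:%R *:%R F ->
  \sum_(x <- sw2 1) F x.1 x.2 = F 1 1.
Proof. by move=> Fbil; rewrite /sw2 comul1 expand_tpure. Qed.

Lemma sum_sw3 (V : lmodType k) (F : H -> H -> H -> V) h :
  \sum_(x <- sw3 h) F x.1.1 x.1.2 x.2 =
  \sum_(x <- sw2 h) \sum_(y <- sw2 x.1) F y.1 y.2 x.2.
Proof. by rewrite /sw3 big_allpairs_dep. Qed.

End Sweedler.

Section Crossed.
Variables (k : comNzRingType) (H : hopfAlgType k) (A : algType k).
Variables (act : weak_action H A) (f : {linear tens H H -> A}).
Variable cpP : is_crossed_product act f.
Local Notation E := (crossed cpP).

Lemma crossed_mulE (a : A) (h : H) (b : A) (l : H) :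
  (a \ox h : E) * (b \ox l : E) =
  \sum_(x <- sw3 h) \sum_(y <- sw2 l)
    (a * act x.1.1 b * f (x.1.2 \ox y.1)) \ox (x.2 * y.2).
Proof. exact: cpmulE. Qed.

Lemma crossed_mul1 (h l : H) : (1 \ox h : E) * (1 \ox l : E) =
  \sum_(x <- sw2 h) \sum_(y <- sw2 l) f (x.1 \ox y.1) \ox (x.2 * y.2).
Proof.
pose F u v : tens A H := \sum_(y <- sw2 l) f (u \ox y.1) \ox (v * y.2).
rewrite crossed_mulE (sum_sw3 (fun u v w => \sum_(y <- sw2 l)
  (1 * act u 1 * f (v \ox y.1)) \ox (w * y.2))).
apply: eq_bigr => x _.
(* The extra Sweedler factor on the left acts on 1 and becomes a counit; the counit law, read
   backwards, creates it on the right. *)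
rewrite -[RHS](@sum_counitl _ _ _ (F ^~ x.2)); last first.
  by apply: sum_linear => y c u v; rewrite linearPl linearP linearPl.
apply: eq_bigr => z _; rewrite scaler_sumr; apply: eq_bigr => y _.
by rewrite wact_1 mul1r mulr_algl linearZl_LR.
Qed.

(** Normalisation of [f] comes from the unit law of [E]: applying the counit to the [H] component of
    (1 # h)(1 # 1) = 1 # h isolates it. *)
Lemma cocycle1r h : f (h \ox 1) = (counit h)%:A.
Proof.
have := mulr1 (1 \ox h : E); rewrite crossed_mul1.
have -> : \sum_(x <- sw2 h) \sum_(y <- sw2 1) f (x.1 \ox y.1) \ox (x.2 * y.2) =
    \sum_(x <- sw2 h) f (x.1 \ox 1) \ox x.2.
  apply: eq_bigr => x _.
  rewrite (@sum_sw2_1 _ _ _ (fun u v => f (x.1 \ox u) \ox (x.2 * v))) ?mulr1 //.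
  split=> y c u v /=; first by rewrite linearPr linearP linearPl.
  by rewrite mulrDr -scalerAr linearPr.
move/(congr1 (tlift (@counit_proj_pure k H A))).
rewrite tliftE linear_sum /= {2}/counit_proj_pure => <-.
rewrite (eq_bigr _ (fun x _ => tliftE _ _ _)) /=.
rewrite (@sum_counitr _ _ _ (fun u => f (u \ox 1))) //.
by move=> c u v; rewrite linearPl linearP.
Qed.

Lemma cocycle1l h : f (1 \ox h) = (counit h)%:A.
Proof.
have := mul1r (1 \ox h : E); rewrite -[1]/(1 \ox 1 : E) crossed_mul1.
rewrite (@sum_sw2_1 _ _ _ (fun u v => \sum_(y <- sw2 h)
  f (u \ox y.1) \ox (v * y.2))); last first.
  split=> y; apply: sum_linear => z c u v; first by rewrite linearPl linearP linearPl.
  by rewrite mulrDl -scalerAl linearPr.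
move/(congr1 (tlift (@counit_proj_pure k H A))).
rewrite tliftE linear_sum /= {2}/counit_proj_pure => <-.
rewrite (eq_bigr _ (fun x _ => tliftE _ _ _)) /=.
rewrite (eq_bigr _ (fun x _ => erefl)) /= /counit_proj_pure.
under eq_bigr => x _ do rewrite mul1r.
rewrite (@sum_counitr _ _ _ (fun u => f (1 \ox u))) //.
by move=> c u v; rewrite linearPr linearP.
Qed.

Fact alg_in_linear : linear (fun b : A => b \ox 1 : E).
Proof. by move=> c x y; rewrite linearPl. Qed.
Definition alg_in : {linear A -> E} :=
  HB.pack (fun b : A => b \ox 1 : E) (GRing.isLinear.Build k A E _ _ alg_in_linear).

Lemma mul_alg_in (a b : A) (l : H) : alg_in a * (b \ox l) = (a * b) \ox l :> E.
Proof.
rewrite /= crossed_mulE (sum_sw3 (fun u v w => \sum_(y <- sw2 l)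
  (a * act u b * f (v \ox y.1)) \ox (w * y.2))).
pose F u v w : tens A H :=
  \sum_(y <- sw2 l) (a * act u b * f (v \ox y.1)) \ox (w * y.2).
have Fbil w : bilinear_for *:%R *:%R (fun u v => F u v w).
  split=> z; apply: sum_linear => y c u v /=.
    by rewrite linearPl mulrDr mulrDl -scalerAr -scalerAl linearPl.
  by rewrite linearPl linearP mulrDr -scalerAr linearPl.
rewrite -/(F _ _ _) (@sum_sw2_1 _ _ _ (fun u v => \sum_(y <- sw2 u) F y.1 y.2 v)).
  rewrite (@sum_sw2_1 _ _ _ (fun u v => F u v 1)) // /F wact1.
  rewrite -[in RHS](counitl l) -/(sw2 l) linear_sumr.
  apply: eq_bigr => y _; rewrite cocycle1l mul1r.
  by rewrite mulr_algr linearZl_LR linearZr_LR.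
split=> z; first exact: (sw2_linear (Fbil z)).
apply: sum_linear => y; apply: sum_linear => x c u v.
by rewrite mulrDl -scalerAl linearPr.
Qed.

(** The commutation rule behind all exponents in the formulas: b crosses 1 # h to the left and
    becomes b^{h^(1)}. Normalisation removes the cocycle. *)
Lemma mul_alg_inr (a b : A) (h : H) : (a \ox h : E) * alg_in b =
  \sum_(x <- sw2 h) (a * act x.1 b) \ox x.2.
Proof.
rewrite /= crossed_mulE (sum_sw3 (fun u v w => \sum_(y <- sw2 1)
  (a * act u b * f (v \ox y.1)) \ox (w * y.2))).
apply: eq_bigr => x _.
transitivity (\sum_(z <- sw2 x.1) counit z.2 *: ((a * act z.1 b) \ox x.2)).
  apply: eq_bigr => z _.
  rewrite (@sum_sw2_1 _ _ _ (fun u v =>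
    (a * act z.1 b * f (z.2 \ox u)) \ox (x.2 * v))).
    by rewrite mulr1 cocycle1r mulr_algr linearZl_LR.
  split=> y c u v /=; first by rewrite linearPr linearP mulrDr -scalerAr linearPl.
  by rewrite mulrDr -scalerAr linearPr.
rewrite (@sum_counitr _ _ _ (fun u => (a * act u b) \ox x.2)) //.
by move=> c u v; rewrite linearPl mulrDr -scalerAr linearPl.
Qed.

Lemma alg_inM a b : alg_in a * alg_in b = alg_in (a * b).
Proof. exact: mul_alg_in. Qed.

Lemma alg_in1 : alg_in 1 = 1. Proof. by []. Qed.

Lemma crossed_decomp a h : (a \ox h : E) = alg_in a * (1 \ox h).
Proof. by rewrite mul_alg_in mulr1. Qed.

(** * Moving components in A to the left across factors from H *)

Definition hopf_in (h : H) : E := 1 \ox h.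

Fact hopf_in_linear : linear hopf_in.
Proof. by move=> c x y; rewrite /hopf_in linearPr. Qed.

Lemma tens_in_sig (W : lmodType k) : {g : {linear tens A W -> tens E W} |
  forall b w, g (b \ox w) = alg_in b \ox w}.
Proof. by exists (tmap alg_in idfun) => b w; rewrite tmapE. Qed.
Definition tens_in (W : lmodType k) := sval (tens_in_sig W).

Lemma tens_inE (W : lmodType k) b (w : W) : tens_in W (b \ox w) = alg_in b \ox w.
Proof. exact: (svalP (tens_in_sig W)). Qed.

Lemma splitE_sig (W : lmodType k) :
  {g : {linear tens E W -> tens A (tens (bar H) W)} |
   forall a h w, g ((a \ox h : E) \ox w) = a \ox (tobar h \ox w)}.
Proof.
exists (tassocr A (bar H) W \o
  tmap (tmap idfun (@tobar k H) : {linear E -> tens A (bar H)}) idfun) => a h w.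
by rewrite lcompE !tmapE tassocrE.
Qed.
Definition splitE (W : lmodType k) := sval (splitE_sig W).

Lemma splitEE (W : lmodType k) a h (w : W) :
  splitE W ((a \ox h : E) \ox w) = a \ox (tobar h \ox w).
Proof. exact: (svalP (splitE_sig W)). Qed.

Lemma crossed_ext (W V : lmodType k) (g g' : {linear tens E W -> V}) :
  (forall a h w, g ((a \ox h : E) \ox w) = g' ((a \ox h : E) \ox w)) -> g =1 g'.
Proof.
move=> gg'; apply: tens_ext => e w; rewrite [e]expandE !linear_sumlz.
by rewrite !linear_sum; apply: eq_bigr => p _; apply: gg'.
Qed.

Lemma tens_in_lmulT (W : lmodType k) a (t : tens A W) :
  tens_in W (lmulT W a t) = lmulT W (alg_in a) (tens_in W t).
Proof.
pose g1 : {linear tens A W -> tens E W} := tens_in W \o lmulT W a.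
pose g2 : {linear tens A W -> tens E W} := lmulT W (alg_in a) \o tens_in W.
suff e : g1 =1 g2 by exact: (e t).
apply: tens_ext => b w.
by rewrite !lcompE lmulTE !tens_inE lmulTE alg_inM.
Qed.

Lemma splitE_lmulT (W : lmodType k) a (t : tens E W) :
  splitE W (lmulT W (alg_in a) t) = lmulT _ a (splitE W t).
Proof.
pose g1 : {linear tens E W -> tens A (tens (bar H) W)} :=
  splitE W \o lmulT W (alg_in a).
pose g2 : {linear tens E W -> tens A (tens (bar H) W)} := lmulT _ a \o splitE W.
suff e : g1 =1 g2 by exact: (e t).
apply: crossed_ext => b h w.
by rewrite !lcompE lmulTE mul_alg_in !splitEE lmulTE.
Qed.

(** An element of [A] has 1 as its [H] component, and 1 is zero in the reduced factor. This removes
    the degenerate terms both in [movel] and in the relative bar complex. *)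
Lemma splitE_tens_in (W : lmodType k) (t : tens A W) : splitE W (tens_in W t) = 0.
Proof.
rewrite [t]expandE !linear_sum; apply: big1 => p _.
by rewrite tens_inE splitEE tobar1 linear0l linear0r.
Qed.

Lemma splitE_tmap (U W : lmodType k) (u : {linear U -> W}) t :
  splitE W (tmap idfun u t) = tmap idfun (tmap idfun u) (splitE U t).
Proof.
pose g1 : {linear tens E U -> tens A (tens (bar H) W)} := splitE W \o tmap idfun u.
pose g2 : {linear tens E U -> tens A (tens (bar H) W)} :=
  tmap idfun (tmap idfun u) \o splitE U.
suff e : g1 =1 g2 by exact: (e t).
by apply: crossed_ext => a h w; rewrite !lcompE tmapE !splitEE !tmapE.
Qed.

Lemma tens_in_tmap (U W : lmodType k) (u : {linear U -> W}) t :
  tens_in W (tmap idfun u t) = tmap idfun u (tens_in U t).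
Proof.
pose g1 : {linear tens A U -> tens E W} := tens_in W \o tmap idfun u.
pose g2 : {linear tens A U -> tens E W} := tmap idfun u \o tens_in U.
suff e : g1 =1 g2 by exact: (e t).
by apply: tens_ext => b w; rewrite !lcompE tmapE !tens_inE tmapE.
Qed.

Section MovelStep.
Variables (T1 T2 : lmodType k) (p : {linear T1 -> tens A T2}).

Fact movel_step_bilinear : bilinear_for *:%R *:%R (fun h t =>
  splitE T2 (lmulT T2 (hopf_in h) (tens_in T2 (p t)))).
Proof.
split=> [t|h] c x y; last by rewrite !linearP.
rewrite hopf_in_linear; have [Fl _] := lmulT_bilinear (tens_in T2 \o p).
by rewrite -[in LHS]/((tens_in T2 \o p) t) (Fl t) linearP.
Qed.

Fact movel_step1 t : splitE T2 (lmulT T2 (hopf_in 1) (tens_in T2 (p t))) = 0.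
Proof. by rewrite -[hopf_in 1]/(1 : E) lmulT1 splitE_tens_in. Qed.

Lemma movel_step_sig : {g : {linear tens (bar H) T1 -> tens A (tens (bar H) T2)} |
  forall h t, g (tobar h \ox t) =
    splitE T2 (lmulT T2 (hopf_in h) (tens_in T2 (p t)))}.
Proof. by exists (barl movel_step_bilinear movel_step1) => h t; rewrite barlE. Qed.
Definition movel_step := sval movel_step_sig.

Lemma movel_stepE h t : movel_step (tobar h \ox t) =
  splitE T2 (lmulT T2 (hopf_in h) (tens_in T2 (p t))).
Proof. exact: (svalP movel_step_sig). Qed.

Lemma lext_tens_in w : lext (tens_in T2 \o p) (tens_in T1 w) = tens_in T2 (lext p w).
Proof.
pose g1 : {linear tens A T1 -> tens E T2} := lext (tens_in T2 \o p) \o tens_in T1.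
pose g2 : {linear tens A T1 -> tens E T2} := tens_in T2 \o lext p.
suff e : g1 =1 g2 by exact: (e w).
by apply: tens_ext => b t; rewrite !lcompE tens_inE !lextE tens_in_lmulT.
Qed.

(** Moving past a factor is left multiplication in [E]. By associativity it makes no difference
    whether the tail is treated before or after the [H] component is split off. *)
Lemma lext_movel_step (y : tens E T1) :
  lext movel_step (splitE T1 y) = splitE T2 (lext (tens_in T2 \o p) y).
Proof.
pose g1 : {linear tens E T1 -> tens A (tens (bar H) T2)} :=
  lext movel_step \o splitE T1.
pose g2 : {linear tens E T1 -> tens A (tens (bar H) T2)} :=
  splitE T2 \o lext (tens_in T2 \o p).
suff e : g1 =1 g2 by exact: (e y).
apply: crossed_ext => a h t; rewrite !lcompE splitEE !lextE movel_stepE lcompE.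
by rewrite -splitE_lmulT lmulTA crossed_decomp.
Qed.
End MovelStep.

Section Movel.
Variables (T1 T2 : tower (bar H)) (p : {linear T1 0%N -> tens A (T2 0%N)}).

(* h_1 (x) ... (x) h_n (x) x is sent to (1 # h_1) ... (1 # h_n) p x, with the
   component of p x in A moved to the left. *)
Fixpoint movel n : {linear T1 n -> tens A (T2 n)} :=
  if n is n'.+1 then
    tmap idfun (tcons T2 n') \o (movel_step (movel n') \o tucons T1 n')
  else p.

Lemma movelSE n t : movel n.+1 t =
  tmap idfun (tcons T2 n) (movel_step (movel n) (tucons T1 n t)).
Proof. by []. Qed.

Lemma movelS n h t : movel n.+1 (tcons T1 n (tobar h \ox t)) =
  tmap idfun (tcons T2 n)
    (splitE _ (lmulT _ (hopf_in h) (tens_in _ (movel n t)))).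
Proof. by rewrite movelSE tconsK movel_stepE. Qed.

Lemma lext_movelS n (y : tens E (T1 n)) :
  lext (movel n.+1) (tmap idfun (tcons T1 n) (splitE _ y)) =
  tmap idfun (tcons T2 n) (splitE _ (lext (tens_in _ \o movel n) y)).
Proof.
rewrite -lext_movel_step; move: (splitE _ y) => {}y.
pose g1 : {linear tens A (tens (bar H) (T1 n)) -> tens A (T2 n.+1)} :=
  lext (movel n.+1) \o tmap idfun (tcons T1 n).
pose g2 : {linear tens A (tens (bar H) (T1 n)) -> tens A (T2 n.+1)} :=
  tmap idfun (tcons T2 n) \o lext (movel_step (movel n)).
suff e : g1 =1 g2 by exact: (e y).
by apply: tens_ext => b t; rewrite !lcompE tmapE !lextE lmulT_tmap movelSE tconsK.
Qed.
End Movel.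

(** By [lext_movelS], the composite in degree n+1 arises from the one in degree n by left
    multiplication and splitting, so vanishing propagates from the last factor. *)
Lemma movel_comp0 (T1 T2 T3 : tower (bar H)) (p : {linear T1 0%N -> tens A (T2 0%N)})
    (q : {linear T2 0%N -> tens A (T3 0%N)}) :
  (forall x, lext q (p x) = 0) ->
  forall n t, lext (movel q n) (movel p n t) = 0.
Proof.
move=> qp0; elim=> [|n IH] t; first exact: qp0.
pose g : {linear T1 n.+1 -> tens A (T3 n.+1)} := lext (movel q n.+1) \o movel p n.+1.
suff e : g =1 (\0 : {linear T1 n.+1 -> tens A (T3 n.+1)}) by exact: (e t).
apply: tow_ext => h {}t.
rewrite lcompE movelS lext_movelS lext_lmulT lext_tens_in IH.
by rewrite !linear0.
Qed.

Fixpoint movel_list (T : tower (bar H)) n (hs : seq H) :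
    {linear tens A (T 0%N) -> tens A (T n)} :=
  if n is n'.+1 then
    tmap idfun (tcons T n') \o (splitE _ \o (lmulT _ (hopf_in (head 0 hs)) \o
      (tens_in _ \o movel_list T n' (behead hs))))
  else idfun.

Lemma head_tobar (hs : seq H) : head 0 (map (@tobar k H) hs) = tobar (head 0 hs).
Proof. by case: hs => //=; rewrite linear0. Qed.

Lemma movel_pure (T1 T2 : tower (bar H)) (p : {linear T1 0%N -> tens A (T2 0%N)})
    n hs x :
  movel p n (towpure (T := T1) n (map (@tobar k H) hs) x) = movel_list T2 n hs (p x).
Proof.
elim: n hs => [|n IH] hs //.
by rewrite [towpure _ _ _]/= head_tobar behead_map movelS IH.
Qed.

Lemma lmulT_hopf_in (W : lmodType k) h b (w : W) :
  lmulT W (hopf_in h) (tens_in W (b \ox w)) =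
  \sum_(x <- sw2 h) (act x.1 b \ox x.2 : E) \ox w.
Proof.
rewrite tens_inE lmulTE mul_alg_inr linear_sumlz; apply: eq_bigr => x _.
by rewrite mul1r.
Qed.

Lemma movel_listS (T : tower (bar H)) n hs t : movel_list T n.+1 hs t =
  tmap idfun (tcons T n) (splitE _ (lmulT _ (hopf_in (head 0 hs))
      (tens_in _ (movel_list T n (behead hs) t)))).
Proof. by []. Qed.

(** One use of the commutation rule per factor, starting from the last, produces the nested
    exponents and the componentwise coproduct together. *)
Lemma movel_list_pure (T : tower (bar H)) n hs b w : size hs = n ->
  movel_list T n hs (b \ox w) =
  \sum_(x <- swseq hs) acts act x.1 b \ox towpure (T := T) n (map (@tobar k H) x.2) w.
Proof.
elim: n hs => [|n IH] [|h hs] // => [_|[szh]].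
  by rewrite [swseq _]/= big_seq1.
rewrite [LHS]movel_listS IH // !linear_sum [swseq _]/= big_allpairs_dep exchange_big.
apply: eq_bigr => y _; rewrite lmulT_hopf_in !linear_sum.
by apply: eq_bigr => x _; rewrite splitEE tmapE.
Qed.

Lemma movel_list1 (T : tower (bar H)) n hs w :
  movel_list T n hs (1 \ox w) = 1 \ox towpure (T := T) n (map (@tobar k H) hs) w.
Proof.
elim: n hs => [|n IH] hs //.
rewrite movel_listS IH tens_inE lmulTE alg_in1 mulr1 splitEE tmapE.
by rewrite [in RHS]/= head_tobar behead_map.
Qed.

(* With Z_s the degree-s tail, E (x) Z_s is the normalised relative bar
   complex.  A unital map l on Z_s stands for the differential with its first
   factor merged into A (x) Z_s, which is what the recursion on s needs. *)
Definition unital_map (Z : lmodType k) :=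
  {l : {linear tens E Z -> tens A Z} | forall z, l (1 \ox z) = 1 \ox z}.

(** * The normalised bar complex of E relative to A *)

Section BarStep.
Variables (Z : lmodType k) (l : unital_map Z).

Fact bar_step_bilinear : bilinear_for *:%R *:%R (fun h z =>
  hopf_in h \ox z - tens_in Z (sval l (hopf_in h \ox z))).
Proof.
split=> [z|h] c x y.
  by rewrite hopf_in_linear linearPl !linearP /= scalerDr addrACA.
by rewrite linearPr !linearP /= scalerDr addrACA.
Qed.

Fact bar_step1 z : hopf_in 1 \ox z - tens_in Z (sval l (hopf_in 1 \ox z)) = 0.
Proof. by rewrite (svalP l) tens_inE subrr. Qed.

Lemma bar_step_sig : {g : {linear tens (bar H) Z -> tens E Z} |
  forall h z, g (tobar h \ox z) =
    hopf_in h \ox z - tens_in Z (sval l (hopf_in h \ox z))}.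
Proof. by exists (barl bar_step_bilinear bar_step1) => h z; rewrite barlE. Qed.
Definition bar_step := sval bar_step_sig.

Lemma bar_stepE h z : bar_step (tobar h \ox z) =
  hopf_in h \ox z - tens_in Z (sval l (hopf_in h \ox z)).
Proof. exact: (svalP bar_step_sig). Qed.

End BarStep.

Section BarTower.
Variables (T : tower (bar H)).

(** The recursion used over [A], except that the value keeps a component in [A], since products in
    [E] have one, and it is the [H] component that is reduced modulo [k]. *)
Lemma unital_step n (l : unital_map (T n)) :
  {l' : unital_map (T n.+1) | forall y, sval l' y =
    tmap idfun (tcons T n) (splitE _
      (lext (bar_step l) (tmap idfun (tucons T n) y)))}.
Proof.
pose l' : {linear tens E (T n.+1) -> tens A (T n.+1)} :=
  tmap idfun (tcons T n) \o (splitE _ \o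
      (lext (bar_step l) \o tmap idfun (tucons T n))).
have l'1 z : l' (1 \ox z) = 1 \ox z.
  pose g1 : {linear T n.+1 -> tens A (T n.+1)} := l' \o tpurel (T n.+1) (1 : E).
  suff e : g1 =1 tpurel (T n.+1) (1 : A) by exact: (e z).
  apply: tow_ext => h {}z.
  rewrite -[LHS]/(l' (1 \ox tcons T n (tobar h \ox z))) !lcompE tmapE tconsK.
  rewrite lextE lmulT1 bar_stepE linearB splitE_tens_in subr0 splitEE.
  exact: tmapE.
by exists (exist _ l' l'1) => y.
Qed.

Variable l0 : unital_map (T 0%N).

Fixpoint unital_tower n : unital_map (T n) :=
  if n is n'.+1 then sval (unital_step (unital_tower n')) else l0.

Lemma bar_diff_sig n : {g : {linear tens E (T n.+1) -> tens E (T n)} |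
  forall y, g y = lext (bar_step (unital_tower n)) (tmap idfun (tucons T n) y)}.
Proof.
by exists (lext (bar_step (unital_tower n)) \o tmap idfun (tucons T n)) => y.
Qed.
Definition bar_diff n := sval (bar_diff_sig n).

Lemma bar_diff_lext n y :
  bar_diff n y = lext (bar_step (unital_tower n)) (tmap idfun (tucons T n) y).
Proof. exact: (svalP (bar_diff_sig n)). Qed.

Local Notation l := unital_tower.

Lemma unital_towerS n y : sval (l n.+1) y =
  tmap idfun (tcons T n) (splitE _ (bar_diff n y)).
Proof. by rewrite (svalP (unital_step (l n))) -bar_diff_lext. Qed.

Lemma bar_diffE n g h z : bar_diff n (g \ox tcons T n (tobar h \ox z)) =
  lmulT _ g (hopf_in h \ox z - tens_in _ (sval (l n) (hopf_in h \ox z))).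
Proof. by rewrite bar_diff_lext tmapE tconsK lextE bar_stepE. Qed.

Lemma bar_diff_lmulT n g y : bar_diff n (lmulT _ g y) = lmulT _ g (bar_diff n y).
Proof. by rewrite !bar_diff_lext lmulT_tmap lext_lmulT. Qed.

Hypothesis l0A : forall a y,
  sval l0 (lmulT _ (alg_in a) y) = lmulT _ a (sval l0 y).

Lemma unital_tower_lmulT n a y :
  sval (l n) (lmulT _ (alg_in a) y) = lmulT _ a (sval (l n) y).
Proof.
case: n y => [|n] y; first exact: l0A.
by rewrite !unital_towerS bar_diff_lmulT splitE_lmulT lmulT_tmap.
Qed.

(** A form of [bar_diffE] without coordinates: when the [H] component of x is made the first bar
    factor, the first face restores x. Left [A]-linearity of [l], inherited from [l0A], passes from
    1 # h to a # h. *)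
Lemma bar_diff_split n (x : tens E (T n)) :
  bar_diff n (tens_in _ (tmap idfun (tcons T n) (splitE _ x))) =
  x - tens_in _ (sval (l n) x).
Proof.
pose g1 : {linear tens E (T n) -> tens E (T n)} :=
  bar_diff n \o (tens_in _ \o (tmap idfun (tcons T n) \o splitE _)).
pose g2 : {linear tens E (T n) -> tens E (T n)} := tens_in _ \o sval (l n).
suff e : g1 =1 (fun x => x - g2 x) by exact: (e x).
pose g3 : {linear tens E (T n) -> tens E (T n)} := g1 \+ g2.
suff e : g3 =1 (idfun : {linear tens E (T n) -> tens E (T n)}).
  by move=> y; apply/esym/eqP; rewrite subr_eq; apply/eqP/esym/(e y).
apply: crossed_ext => a h z; rewrite -[LHS]/(g1 _ + g2 _) !lcompE splitEE tmapE.
rewrite tens_inE bar_diffE crossed_decomp -lmulTE unital_tower_lmulT.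
by rewrite tens_in_lmulT linearB subrK.
Qed.

End BarTower.

Lemma splitE_towmap (T T' : tower (bar H)) (u : {linear T 0%N -> T' 0%N}) n y :
  tmap idfun (tcons T' n) (splitE _ (tmap idfun (towmap u n) y)) =
  tmap idfun (towmap u n.+1) (tmap idfun (tcons T n) (splitE _ y)).
Proof.
rewrite splitE_tmap !tmap_comp.
pose g1 : {linear tens (bar H) (T n) -> T' n.+1} :=
  tcons T' n \o tmap idfun (towmap u n).
pose g2 : {linear tens (bar H) (T n) -> T' n.+1} := towmap u n.+1 \o tcons T n.
have e : g1 =1 g2.
  by apply: tens_ext => v t; rewrite [LHS]lcompE [RHS]lcompE tmapE towmapS.
have {}e : tmap (idfun \o idfun) g1 =1 tmap (idfun \o idfun : {linear A -> A}) g2.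
  by apply: tens_ext => a t; rewrite !tmapE e.
exact: e.
Qed.

Section BarMap.
Variables (T T' : tower (bar H)) (u : {linear T 0%N -> T' 0%N}).
Variables (l0 : unital_map (T 0%N)) (l0' : unital_map (T' 0%N)).
Hypothesis ul : forall y, sval l0' (tmap idfun u y) = tmap idfun u (sval l0 y).

Lemma bar_diff_towmap_step n :
  (forall y, sval (unital_tower l0' n) (tmap idfun (towmap u n) y) =
     tmap idfun (towmap u n) (sval (unital_tower l0 n) y)) ->
  forall y, bar_diff l0' n (tmap idfun (towmap u n.+1) y) =
     tmap idfun (towmap u n) (bar_diff l0 n y).
Proof.
move=> IH y.
pose g1 : {linear tens E (T n.+1) -> tens E (T' n)} :=
  bar_diff l0' n \o tmap idfun (towmap u n.+1).
pose g2 : {linear tens E (T n.+1) -> tens E (T' n)} :=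
  tmap idfun (towmap u n) \o bar_diff l0 n.
suff e : g1 =1 g2 by exact: (e y).
apply: tens_ext => g t.
pose h1 : {linear T n.+1 -> tens E (T' n)} := g1 \o tpurel (T n.+1) g.
pose h2 : {linear T n.+1 -> tens E (T' n)} := g2 \o tpurel (T n.+1) g.
suff e : h1 =1 h2 by exact: (e t).
apply: tow_ext => h z.
rewrite -[LHS]/(g1 (g \ox _)) -[RHS]/(g2 (g \ox _)) !lcompE tmapE towmapS.
rewrite !bar_diffE lmulT_tmap; congr (lmulT _ _ _).
by rewrite [RHS]linearB -tens_in_tmap -IH !tmapE.
Qed.

Lemma unital_tower_towmap n y :
  sval (unital_tower l0' n) (tmap idfun (towmap u n) y) =
     tmap idfun (towmap u n) (sval (unital_tower l0 n) y).
Proof.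
elim: n y => [|n IH] y; first exact: ul.
by rewrite !unital_towerS bar_diff_towmap_step // splitE_towmap.
Qed.

(** With right multiplication by an element of [E] as [u], this yields right linearity of the
    differential. *)
Lemma bar_diff_towmap n y : bar_diff l0' n (tmap idfun (towmap u n.+1) y) =
     tmap idfun (towmap u n) (bar_diff l0 n y).
Proof. exact/bar_diff_towmap_step/unital_tower_towmap. Qed.

End BarMap.

Lemma movel_towmap (T1 T2 T1' T2' : tower (bar H))
    (u1 : {linear T1 0%N -> T1' 0%N}) (u2 : {linear T2 0%N -> T2' 0%N})
    (p : {linear T1 0%N -> tens A (T2 0%N)})
    (p' : {linear T1' 0%N -> tens A (T2' 0%N)}) :
  (forall x, p' (u1 x) = tmap idfun u2 (p x)) ->
  forall n t, movel p' n (towmap u1 n t) =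
    tmap idfun (towmap u2 n) (movel p n t).
Proof.
move=> pu; elim=> [|n IH] t; first exact: pu.
pose g1 : {linear T1 n.+1 -> tens A (T2' n.+1)} :=
  movel p' n.+1 \o towmap u1 n.+1.
pose g2 : {linear T1 n.+1 -> tens A (T2' n.+1)} :=
  tmap idfun (towmap u2 n.+1) \o movel p n.+1.
suff e : g1 =1 g2 by exact: (e t).
apply: tow_ext => h z; rewrite [LHS]lcompE [RHS]lcompE towmapS !movelS IH.
by rewrite tens_in_tmap -lmulT_tmap splitE_towmap.
Qed.

Section BarMove.
Variables (T T' : tower (bar H)) (p : {linear T 0%N -> tens A (T' 0%N)}).
Variables (l0 : unital_map (T 0%N)) (l0' : unital_map (T' 0%N)).
Hypothesis l0'A : forall a y,
  sval l0' (lmulT _ (alg_in a) y) = lmulT _ a (sval l0' y).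
Hypothesis pl : forall g x, sval l0' (lmulT _ g (tens_in _ (p x))) =
  lext p (sval l0 (g \ox x)).

Definition movel_ext n := lext (tens_in _ \o movel p n).

Lemma bar_diff_movel_step n :
  (forall y, sval (unital_tower l0' n) (movel_ext n y) =
     lext (movel p n) (sval (unital_tower l0 n) y)) ->
  forall y, bar_diff l0' n (movel_ext n.+1 y) = movel_ext n (bar_diff l0 n y).
Proof.
move=> IH y.
pose g1 : {linear tens E (T n.+1) -> tens E (T' n)} :=
  bar_diff l0' n \o movel_ext n.+1.
pose g2 : {linear tens E (T n.+1) -> tens E (T' n)} := movel_ext n \o bar_diff l0 n.
suff e : g1 =1 g2 by exact: (e y).
apply: tens_ext => g t.
pose h1 : {linear T n.+1 -> tens E (T' n)} := g1 \o tpurel (T n.+1) g.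
pose h2 : {linear T n.+1 -> tens E (T' n)} := g2 \o tpurel (T n.+1) g.
suff e : h1 =1 h2 by exact: (e t).
apply: tow_ext => h z.
rewrite -[LHS]/(g1 (g \ox _)) -[RHS]/(g2 (g \ox _)) !lcompE lextE lcompE.
rewrite movelS bar_diffE lext_lmulT bar_diff_lmulT bar_diff_split //.
congr (lmulT _ _ _); rewrite [RHS]linearB lext_tens_in -IH.
by rewrite /movel_ext !lextE !lcompE.
Qed.

Lemma unital_tower_movel n y : sval (unital_tower l0' n) (movel_ext n y) =
  lext (movel p n) (sval (unital_tower l0 n) y).
Proof.
elim: n y => [|n IH] y.
  pose g1 : {linear tens E (T 0%N) -> tens A (T' 0%N)} := sval l0' \o movel_ext 0.
  pose g2 : {linear tens E (T 0%N) -> tens A (T' 0%N)} := lext p \o sval l0.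
  suff e : g1 =1 g2 by exact: (e y).
  by apply: tens_ext => g x; rewrite !lcompE lextE lcompE pl.
by rewrite !unital_towerS bar_diff_movel_step // -lext_movelS.
Qed.

(** In the last factor this is the hypothesis [pl]; elsewhere the faces are left multiplications in
    [E], and the component moves past them by associativity. With [p] the identity of [E] it makes
    mu a chain map. *)
Lemma bar_diff_movel n y :
  bar_diff l0' n (movel_ext n.+1 y) = movel_ext n (bar_diff l0 n y).
Proof. exact/bar_diff_movel_step/unital_tower_movel. Qed.

End BarMove.

(** Reindexing by one turns an operation that adds a factor at the right end into a [towmap] between
    towers. *)
Definition shiftT (V : lmodType k) (T : tower V) : tower V :=
  @Tower k V (fun n => T n.+1) (fun n => tcons T n.+1) (fun n => tucons T n.+1)
    (fun n => @tconsK k V T n.+1) (fun n => @tuconsK k V T n.+1).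

Section BarContract.
Variables (T : tower (bar H)) (l0 : unital_map (T 0%N)).
Variable u : {linear T 0%N -> T 1%N}.

Definition tail_contract n : {linear T n -> T n.+1} :=
  towmap (T' := shiftT T) u n.

Hypothesis u_unital : forall y, sval (unital_tower l0 1) (tmap idfun u y) =
  tmap idfun u (sval l0 y) - tmap idfun (tcons T 0) (splitE _ y).

Lemma bar_diff_contract_step n :
  (forall y, sval (unital_tower l0 n.+1) (tmap idfun (tail_contract n) y) =
    tmap idfun (tail_contract n) (sval (unital_tower l0 n) y) +
    (-1) ^+ n.+1 *: tmap idfun (tcons T n) (splitE _ y)) ->
  forall y, bar_diff l0 n.+1 (tmap idfun (tail_contract n.+1) y) =
    tmap idfun (tail_contract n) (bar_diff l0 n y) + (-1) ^+ n *: y.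
Proof.
move=> IH y.
pose g1 : {linear tens E (T n.+1) -> tens E (T n.+1)} :=
  bar_diff l0 n.+1 \o tmap idfun (tail_contract n.+1).
pose g3 : {linear tens E (T n.+1) -> tens E (T n.+1)} :=
  tmap idfun (tail_contract n) \o bar_diff l0 n.
pose g2 : {linear tens E (T n.+1) -> tens E (T n.+1)} :=
  g3 \+ ( *:%R ((-1) ^+ n) : {linear _ -> _}).
suff e : g1 =1 g2 by exact: (e y).
apply: tens_ext => g t.
pose h1 : {linear T n.+1 -> tens E (T n.+1)} := g1 \o tpurel (T n.+1) g.
pose h2 : {linear T n.+1 -> tens E (T n.+1)} := g2 \o tpurel (T n.+1) g.
suff e : h1 =1 h2 by exact: (e t).
apply: tow_ext => h z.
rewrite -[LHS]/(g1 (g \ox _)) -[RHS]/(g3 (g \ox _) + (-1) ^+ n *: (g \ox _)).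
rewrite !lcompE tmapE (towmapS (T' := shiftT T)) !bar_diffE lmulT_tmap.
(* The target is rewritten as the image of a split element, to match the last term of the induction
   hypothesis. *)
have -> : g \ox tcons T n (tobar h \ox z) =
    lmulT _ g (tens_in _ (tmap idfun (tcons T n) (splitE _ (hopf_in h \ox z)))).
  by rewrite splitEE tmapE tens_inE lmulTE alg_in1 mulr1.
rewrite -linearZZ -linearD; congr (lmulT _ _ _).
have e : hopf_in h \ox tail_contract n z =
  tmap idfun (tail_contract n) (hopf_in h \ox z) by rewrite tmapE.
rewrite [towmap _ _ _]/(tail_contract n z) e IH linearD linearZZ exprS.
rewrite [in RHS]linearB -tens_in_tmap opprD addrA.
by rewrite mulN1r scaleNr opprK.
Qed.

Lemma unital_tower_contract n y :
  sval (unital_tower l0 n.+1) (tmap idfun (tail_contract n) y) =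
    tmap idfun (tail_contract n) (sval (unital_tower l0 n) y) +
    (-1) ^+ n.+1 *: tmap idfun (tcons T n) (splitE _ y).
Proof.
elim: n y => [|n IH] y; first by rewrite u_unital expr1 scaleN1r.
rewrite !unital_towerS bar_diff_contract_step // !linearD !linearZZ.
rewrite (splitE_towmap (T' := shiftT T) u) !exprS mulN1r mulN1r opprK.
by [].
Qed.

(** For [u] appending 1, every face but the last commutes with the contraction, and the last one
    returns y. The sign is that of the last face. *)
Lemma bar_diff_contract n y :
  bar_diff l0 n.+1 (tmap idfun (tail_contract n.+1) y) =
    tmap idfun (tail_contract n) (bar_diff l0 n y) + (-1) ^+ n *: y.
Proof. exact/bar_diff_contract_step/unital_tower_contract. Qed.

End BarContract.

(** * The maps of the resolution on tensor powers *)

Definition tpowT (V : lmodType k) (M : rmodule E) : tower V :=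
  @Tower k V (fun n => tpower V M n) (fun n => idfun) (fun n => idfun)
    (fun n x => erefl) (fun n x => erefl).

Lemma tpower_pureE (V : lmodType k) (M : rmodule E) n v (x : M) :
  tpower_pure n v x = towpure (T := tpowT V M) n v x.
Proof. by elim: n v => [|n IH] v //=; rewrite IH. Qed.

Definition ractl (M : rmodule E) (e : E) : {linear M -> M} := applyr (@ract _ _ M) e.

Lemma ract_tpower (V : lmodType k) (M : rmodule E) n (t : tpower V M n) e :
  ract t e = towmap (T := tpowT V M) (T' := tpowT V M) (ractl M e) n t.
Proof.
elim: n t => [|n IH] t //.
pose g1 : {linear tpower V M n.+1 -> tpower V M n.+1} := ractl _ e.
pose g2 : {linear tpower V M n.+1 -> tpower V M n.+1} :=
  towmap (T := tpowT V M) (T' := tpowT V M) (ractl M e) n.+1.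
suff E1 : g1 =1 g2 by exact: (E1 t).
apply: tens_ext => v x.
transitivity (v \ox ract x e : tpower V M n.+1); first exact: tens_ractE.
rewrite IH; exact: (esym (towmapS (T := tpowT V M) (T' := tpowT V M) _ v x)).
Qed.

Local Notation TA := (tpowT (bar A) (reg_rmodule E)).
Local Notation AE r := (tpower (bar A) (reg_rmodule E) r).
Local Notation TX r := (tpowT (bar H) (AE r)).
Local Notation TY := (iterT (bar H) H).

Lemma unitalA0_sig : {l : {linear tens A (TA 0%N) -> TA 0%N} |
  forall a (e : E), l (a \ox e) = (alg_in a * e : E)}.
Proof.
exists (tensl (@reg_mul_bilinear k E) \o tmap alg_in idfun) => a e.
by rewrite lcompE tmapE tenslE.
Qed.

Lemma unitalA0_unital (e : TA 0%N) : sval unitalA0_sig (1 \ox e) = e.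
Proof. by rewrite (svalP unitalA0_sig) alg_in1 mul1r. Qed.
Definition unitalA0 : unital_mapA A (TA 0%N) := exist _ _ unitalA0_unital.

Definition d0tail r : {linear TA r.+1 -> tens A (TA r)} := barA_diff unitalA0 r.

Definition d0_lin r s : {linear X cpP r.+1 s -> X cpP r s} :=
  lext (tens_in _ \o movel (T1 := TX r.+1) (T2 := TX r) (d0tail r) s).

(** [E] is by definition the tensor product of [A] and [H], so the identity is the map that detaches
    the [A] component of the last factor. *)
Definition mu_lin s : {linear X cpP 0 s -> Y cpP s} :=
  lext (tens_in _ \o movel (T1 := TX 0) (T2 := TY) (idfun : {linear E -> tens A H}) s).

(** The last factor is all of [E], so g e stays there and the component moved left is 1. For [Y] the
    last factor is only [H], and the [A] component of g (1 # h) moves out. *)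
Lemma unitalX_sig : {l : {linear tens E (TX 0 0%N) -> tens A (TX 0 0%N)} |
  forall (g e : E), l (g \ox e) = 1 \ox (g * e : E)}.
Proof.
exists (tpurel (TX 0 0%N) (1 : A) \o tensl (@reg_mul_bilinear k E)) => g e.
by rewrite lcompE tenslE.
Qed.
Lemma unitalX_unital (e : TX 0 0%N) : sval unitalX_sig (1 \ox e) = 1 \ox e.
Proof. by rewrite (svalP unitalX_sig) mul1r. Qed.
Definition unitalX0 : unital_map (TX 0 0%N) := exist _ _ unitalX_unital.

Lemma mulY_sig : {l : {linear tens E H -> tens A H} |
  forall (g : E) h, l (g \ox h) = g * hopf_in h}.
Proof.
exists (tensl (@reg_mul_bilinear k E) \o
  tmap idfun (tpurel H (1 : A) : {linear H -> E})) => g h.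
by rewrite lcompE tmapE tenslE.
Qed.
Lemma mulY_unital (h : TY 0%N) : sval mulY_sig (1 \ox h) = 1 \ox h.
Proof. by rewrite (svalP mulY_sig) mul1r. Qed.
Definition unitalY0 : unital_map (TY 0%N) := exist _ _ mulY_unital.

(** The usual sign of a bar differential: face i carries (-1)^i, against (-1)^(i+1) in
    [partial_]. *)
Definition partialN_lin s : {linear Y cpP s.+1 -> Y cpP s} := bar_diff unitalY0 s.

(** A bimodule map over the differential of [Y]. Comparing d^1_{0s} with it replaces a right action
    on [Y]. *)
Definition d1_lin s : {linear X cpP 0 s.+1 -> X cpP 0 s} := bar_diff unitalX0 s.

Lemma sigmaA_sig : {g : {linear TA 0%N -> TA 1%N} |
  forall a h, g (a \ox h : E) = tobar a \ox (hopf_in h : E)}.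
Proof.
exists (tmap (@tobar k A) (tpurel H (1 : A) : {linear H -> E})
  : {linear E -> _}) => a h.
exact: tmapE.
Qed.

Definition sigma_tail r : {linear TA r -> TA r.+1} :=
  towmap (T := TA) (T' := shiftT TA) (sval sigmaA_sig) r.

Definition sigma_lin r s : {linear X cpP r s -> X cpP r.+1 s} :=
  tmap idfun (towmap (T := TX r) (T' := TX r.+1) (sigma_tail r) s).

Definition sigmaY_lin s : {linear Y cpP s -> X cpP 0 s} :=
  tmap idfun (towmap (T := TY) (T' := TX 0)
    (tpurel H (1 : A) : {linear H -> E}) s).

Definition bar_unit : {linear H -> tens (bar H) H} :=
  applyr (@tpure k (bar H) H) 1 \o @tobar k H.

Definition contractY s : {linear Y cpP s -> Y cpP s.+1} :=
  tmap idfun (tail_contract (T := TY) bar_unit s).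

Local Notation lY := unitalY0.
Local Notation lX := unitalX0.

(** * Spanning families and agreement with the defining formulas *)

Lemma crossed_ext0 (V : lmodType k) (g g' : {linear E -> V}) :
  (forall p : A * H, g (p.1 \ox p.2 : E) = g' (p.1 \ox p.2 : E)) -> g =1 g'.
Proof.
by move=> gg'; apply: (@tens_ext _ A H V g g') => a h; apply: (gg' (a, h)).
Qed.

Lemma Xgen_ext r s (V : lmodType k) (g g' : {linear X cpP r s -> V}) :
  (forall e (hs : s.-tuple H) (a : r.-tuple A) (e' : E),
     g ((e : E) \ox Xtail_pure r s hs a e') =
     g' ((e : E) \ox Xtail_pure r s hs a e')) -> g =1 g'.
Proof.
move=> gg'; apply: tens_ext => e.
pose h : {linear TX r s -> V} := g \o tpurel (TX r s) e.
pose h' : {linear TX r s -> V} := g' \o tpurel (TX r s) e.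
apply: (@towpure_ext k H (TX r) (r.-tuple A * E)
  (fun p => towpure (T := TA) r (map (@tobar k A) p.1) p.2) s V h h') => [f0 g0 fg|].
  by apply: (@towpure_ext k A TA E id) => // bs e'; apply: (fg (bs, e')).
move=> hs [a e']; have := gg' e hs a e'.
by rewrite /Xtail_pure !tpower_pureE.
Qed.

Lemma Xof_rcons r s (a0 : A) (h0 : H) (hs : s.-tuple H) (a : r.-tuple A) a' h' :
  Xof cpP (a0, [tuple of h0 :: hs], [tuple of rcons a a'], h') =
  (a0 \ox h0 : E) \ox towpure (T := TX r) s (map (@tobar k H) hs)
    (towpure (T := TA) r (map (@tobar k A) a) (a' \ox h' : E)).
Proof.
rewrite /= /Xpure /Xtail_pure !tpower_pureE nth_rcons size_tuple ltnn eqxx.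
by rewrite map_rcons -cats1 towpure_cat // size_map size_tuple.
Qed.

Lemma Xof_ext r s (V : lmodType k) (g g' : {linear X cpP r s -> V}) :
  (forall t, g (Xof cpP t) = g' (Xof cpP t)) -> g =1 g'.
Proof.
move=> gg'; apply: crossed_ext => a0 h0.
pose h : {linear TX r s -> V} := g \o tpurel (TX r s) (a0 \ox h0 : E).
pose h' : {linear TX r s -> V} := g' \o tpurel (TX r s) (a0 \ox h0 : E).
apply: (@towpure_ext k H (TX r) (r.-tuple A * (A * H))
  (fun p => towpure (T := TA) r (map (@tobar k A) p.1) (p.2.1 \ox p.2.2 : E))
  s V h h') => [f0 g0 fg|].
  apply: (@towpure_ext k A TA (A * H) (fun p => p.1 \ox p.2)) => [|bs e'].
    exact: crossed_ext0.
  exact: (fg (bs, e')).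
move=> hs [a [a' l]] /=; rewrite -[LHS]/(g _) -[RHS]/(g' _).
by have := gg' (a0, [tuple of h0 :: hs], [tuple of rcons a a'], l); rewrite Xof_rcons.
Qed.

Lemma tuple_rcons (T : Type) n (t : n.+1.-tuple T) :
  exists (t' : n.-tuple T) x, t = [tuple of rcons t' x].
Proof.
case: (tupleP t) => x s; exists [tuple of belast x s], (last x s).
by apply: val_inj; rewrite /= lastI.
Qed.

Lemma XofP r s (P : Xdata H A r s -> Prop) :
  (forall a0 h0 (hs : s.-tuple H) (a : r.-tuple A) a' h',
    P (a0, [tuple of h0 :: hs], [tuple of rcons a a'], h')) -> forall t, P t.
Proof.
move=> PX [[[a0 hs] a] h']; have [a1 [a' ->]] := tuple_rcons a.
by case: (tupleP hs) => h0 hs'; apply: PX.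
Qed.

(** [linext] falls back to zero when no linear map has the prescribed values, so each map defined by
    it has to be matched with an explicitly constructed one. *)
Lemma linext_unique (T : Type) (U V : lmodType k) (p : T -> U) (F : T -> V)
    (g : {linear U -> V}) :
  (forall g1 g2 : {linear U -> V}, (forall t, g1 (p t) = g2 (p t)) -> g1 =1 g2) ->
  (forall t, g (p t) = F t) -> linext p F =1 g.
Proof. by move=> ext gF; apply: ext => t; rewrite (linextE gF) gF. Qed.

Lemma Ytail_pureE s (v : s.-tuple H) h :
  Ytail_pure s (rcons v h) = towpure (T := TY) s (map (@tobar k H) v) h.
Proof.
case: v => v sz /=; elim: s v {sz}(eqP sz) => [|s IH] [|x v] //= [sz].
by rewrite IH.
Qed.

Lemma Yof_rcons s (a0 : A) h0 (hs : s.-tuple H) h' :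
  Yof cpP (a0, [tuple of h0 :: rcons hs h']) =
  (a0 \ox h0 : E) \ox towpure (T := TY) s (map (@tobar k H) hs) h'.
Proof. by rewrite /= /Ypure Ytail_pureE. Qed.

Lemma YofP s (P : Ydata H A s -> Prop) :
  (forall a0 h0 (hs : s.-tuple H) h', P (a0, [tuple of h0 :: rcons hs h'])) ->
  forall t, P t.
Proof.
move=> PY [a0 hs]; case: (tupleP hs) => h0 hs'.
by have [a1 [a' ->]] := tuple_rcons hs'; apply: PY.
Qed.

Lemma Yof_ext s (V : lmodType k) (g g' : {linear Y cpP s -> V}) :
  (forall t, g (Yof cpP t) = g' (Yof cpP t)) -> g =1 g'.
Proof.
move=> gg'; apply: crossed_ext => a0 h0.
pose h : {linear TY s -> V} := g \o tpurel (TY s) (a0 \ox h0 : E).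
pose h' : {linear TY s -> V} := g' \o tpurel (TY s) (a0 \ox h0 : E).
apply: (@towpure_ext k H TY H id s V h h') => // hs h1.
rewrite -[LHS]/(g _) -[RHS]/(g' _).
by have := gg' (a0, [tuple of h0 :: rcons hs h1]); rewrite Yof_rcons.
Qed.

Lemma swseq_size (hs : seq H) x : x \in swseq hs ->
  size x.1 = size hs /\ size x.2 = size hs.
Proof.
elim: hs x => [|h hs IH] x /=; first by rewrite inE => /eqP ->.
by case/allpairsPdep=> y [z [_ /IH[z1 z2] ->]] /=; rewrite z1 z2.
Qed.

Lemma lmulT_tens_in (W : lmodType k) a h b (w : W) :
  lmulT W (a \ox h : E) (tens_in W (b \ox w)) =
  \sum_(x <- sw2 h) ((a * act x.1 b) \ox x.2 : E) \ox w.
Proof. by rewrite tens_inE lmulTE mul_alg_inr linear_sumlz. Qed.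

Lemma lmulT_movel_list (T : tower (bar H)) s (hs : s.-tuple H) a0 h0 b w :
  lmulT (T s) (a0 \ox h0 : E) (tens_in (T s) (movel_list T s hs (b \ox w))) =
  \sum_(x <- swseq (h0 :: hs)) ((a0 * acts act x.1 b) \ox head 0 x.2 : E) \ox
     towpure (T := T) s (map (@tobar k H) (behead x.2)) w.
Proof.
rewrite movel_list_pure ?size_tuple // !linear_sum [swseq (_ :: _)]/=.
rewrite big_allpairs_dep exchange_big; apply: eq_bigr => x _.
by rewrite lmulT_tens_in.
Qed.

Lemma mu_lin_Xof s (t : Xdata H A 0 s) : mu_lin s (Xof cpP t) =
  let: (a0, hs, a, h') := t in
    \sum_(x <- swseq hs) Ypure cpP s (a0 * acts act x.1 a`_0) (rcons x.2 h').
Proof.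
move: t; apply: XofP => a0 h0 hs a a1 h'.
rewrite Xof_rcons /mu_lin lextE lcompE movel_pure.
apply: etrans (lmulT_movel_list (T := TY) hs a0 h0 a1 h') _.
rewrite [tval _]/= !(tuple0 a) [nth _ _ _]/=; apply: eq_big_seq => x /swseq_size[_].
case: x => [x1 [|y x2]] //= [sz]; rewrite /Ypure /=.
have sz2 : size x2 == s by rewrite sz size_tuple.
by rewrite (@Ytail_pureE s (Tuple sz2)).
Qed.

Lemma mu_linE s : mu_ cpP s =1 mu_lin s.
Proof. by apply: linext_unique; [apply: Xof_ext | apply: mu_lin_Xof]. Qed.

Definition Atail r (l : seq A) h' : TA r :=
  towpure (T := TA) r (map (@tobar k A) l) (nth 0 l r \ox h' : E).

Lemma AtailS r a l h' : Atail r.+1 (a :: l) h' = tcons TA r (tobar a \ox Atail r l h').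
Proof. by []. Qed.

Lemma Xpure_tow r s a0 hs l h' : Xpure cpP r s a0 hs l h' =
  (a0 \ox head 0 hs : E) \ox towpure (T := TX r) s (map (@tobar k H) (behead hs))
    (Atail r l h').
Proof. by rewrite /Xpure /Xtail_pure !tpower_pureE. Qed.

Definition merge_at i (l : seq A) := take i l ++ (l`_i * l`_i.+1) :: drop i.+2 l.

Lemma unitalA_pure r b l h' : size l = r.+1 ->
  sval (unitalA_tower unitalA0 r) (b \ox Atail r l h') =
  \sum_(0 <= i < r.+1) (-1) ^+ i *: Atail r (merge_at i (b :: l)) h'.
Proof.
elim: r b l => [|r IH] b [|a l] // [szl].
  case: l szl => // _; rewrite big_nat1 expr0 scale1r.
  by rewrite (svalP unitalA0_sig) mul_alg_in.
rewrite AtailS unitalA_towerS barA_diffE IH // [RHS]big_ltn // expr0 scale1r.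
rewrite [lmulT _ _ _]linearB !lmulTE mulr1 [tmap _ _ _]linearB !tmapE.
rewrite [tcons _ _ _]linearB big_add1; congr (_ + _).
  by rewrite /merge_at /= drop0.
rewrite /= linear_sumr linear_sum; apply: eq_bigr => i _ /=.
by rewrite linearZr_LR exprS mulN1r scaleNr.
Qed.

Lemma d0_lin_Xof r s (t : Xdata H A r.+1 s) : d0_lin r s (Xof cpP t) =
  let: (a0, hs, a, h') := t in
    \sum_(x <- swseq hs) Xpure cpP r s (a0 * acts act x.1 a`_0) x.2 (behead a) h' +
    \sum_(1 <= i < r.+2) (-1) ^+ i *: Xpure cpP r s a0 hs (merge_at i.-1 a) h'.
Proof.
move: t; apply: XofP => a0 h0 hs a; case: (tupleP a) => a1 {}a a' h'.
rewrite [Xof _ _]/= Xpure_tow AtailS /d0_lin lextE lcompE movel_pure /d0tail.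
rewrite barA_diffE unitalA_pure ?size_rcons ?size_tuple //.
rewrite 3![_ (_ - _)]linearB; congr (_ + _).
  apply: etrans (lmulT_movel_list (T := TX r) hs a0 h0 a1 _) _.
  by apply: eq_bigr => x _; rewrite Xpure_tow.
pose phi : {linear TA r -> X cpP r s} := lmulT (TX r s) (a0 \ox h0 : E) \o
  (tens_in _ \o (movel_list (TX r) s hs \o tpurel (TA r) (1 : A))).
have phiE l : phi (Atail r l h') = Xpure cpP r s a0 (h0 :: hs) l h'.
  rewrite -[LHS]/(lmulT (TX r s) (a0 \ox h0 : E) (tens_in _
    (movel_list (TX r) s hs (1 \ox Atail r l h')))).
  by rewrite movel_list1 tens_inE lmulTE alg_in1 mulr1 Xpure_tow.
rewrite -[X in - X = _]/(phi _) linear_sum -sumrN [RHS]big_add1.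
by apply: eq_bigr => i _; rewrite [phi _]linearZZ phiE exprS mulN1r scaleNr.
Qed.

Lemma d0_linE r s : d0 cpP r.+1 s =1 d0_lin r s.
Proof.
apply: linext_unique => [|t]; first exact: Xof_ext.
rewrite d0_lin_Xof; case: t => [[[a0 hs] a] h']; congr (_ + _).
by apply: eq_big_nat => i /andP[i0 _]; rewrite /merge_at prednK.
Qed.

Lemma sigma_lin_Xof r s (t : Xdata H A r s) : sigma_lin r s (Xof cpP t) =
  let: (a0, hs, a, h') := t in Xpure cpP r.+1 s a0 hs (rcons a 1) h'.
Proof.
move: t; apply: XofP => a0 h0 hs a a' h'.
rewrite Xof_rcons Xpure_tow /sigma_lin tmapE.
rewrite (@towmap_pure _ _ (TX r) (TX r.+1) (sigma_tail r)).
rewrite (@towmap_pure _ _ TA (shiftT TA) (sval sigmaA_sig)).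
rewrite (svalP sigmaA_sig) /Atail.
have -> : nth 0 (rcons [tuple of rcons a a'] 1) r.+1 = 1.
  by rewrite /= nth_rcons size_rcons size_tuple ltnn eqxx.
suff e : towpure (T := shiftT TA) r (map (@tobar k A) a)
    (tobar a' \ox (hopf_in h' : E)) = towpure (T := TA) r.+1
    (map (@tobar k A) (rcons (rcons a a') 1)) (hopf_in h' : E) by rewrite e.
elim: r a => [|r IH] a; first by rewrite tuple0.
by case: (tupleP a) => b {}a; rewrite /= IH.
Qed.

Lemma sigma_linE r s x : sigma cpP r s x = (-1) ^+ r.+1 *: sigma_lin r s x.
Proof.
pose g : {linear X cpP r s -> X cpP r.+1 s} := (-1) ^+ r.+1 \*: sigma_lin r s.
suff e : sigma cpP r s =1 g by exact: (e x).
apply: linext_unique => [|t]; first exact: Xof_ext.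
rewrite -[LHS]/((-1) ^+ r.+1 *: _) sigma_lin_Xof.
by case: t => [[[a0 hs] a] h'].
Qed.

Lemma sigmaY_lin_Yof s (t : Ydata H A s) : sigmaY_lin s (Yof cpP t) =
  let: (a0, hs) := t in Xpure cpP 0 s a0 (take s.+1 hs) [:: 1] hs`_s.+1.
Proof.
move: t; apply: YofP => a0 h0 hs h'.
rewrite Yof_rcons /sigmaY_lin tmapE.
rewrite (@towmap_pure _ _ TY (TX 0) (tpurel H (1 : A) : {linear H -> E})).
rewrite Xpure_tow /= nth_rcons size_tuple ltnn eqxx.
by rewrite -cats1 take_cat size_tuple ltnn subnn take0 cats0.
Qed.

Lemma sigmaY_linE s : sigmaY cpP s =1 sigmaY_lin s.
Proof. by apply: linext_unique; [apply: Yof_ext | apply: sigmaY_lin_Yof]. Qed.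

(* The i-th face of the bar complex, read off in any module through phi. *)
Definition face (V : lmodType k) (phi : A -> seq H -> V) i (L : seq H) : V :=
  \sum_(x <- swseq (take i L)) \sum_(y <- sw2 L`_i) \sum_(z <- sw2 L`_i.+1)
    phi (acts act x.1 (f (y.1 \ox z.1))) (x.2 ++ (y.2 * z.2) :: drop i.+2 L).

Lemma face0 (V : lmodType k) (phi : A -> seq H -> V) h l L :
  face phi 0 [:: h, l & L] =
  \sum_(y <- sw2 h) \sum_(z <- sw2 l) phi (f (y.1 \ox z.1)) ((y.2 * z.2) :: L).
Proof. by rewrite /face big_seq1 /= drop0. Qed.

(** [phi] is arbitrary so that the leading factor, which acts on the cocycle value and keeps one
    Sweedler component, can be absorbed into it; this closes the recursion on i. *)
Lemma faceS (V : lmodType k) (phi : A -> seq H -> V) i h L :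
  face phi i.+1 (h :: L) =
  face (fun b v => \sum_(x <- sw2 h) phi (act x.1 b) (x.2 :: v)) i L.
Proof.
rewrite /face [swseq _]/= big_allpairs_dep exchange_big; apply: eq_bigr => x _.
rewrite exchange_big; apply: eq_bigr => y _.
by rewrite exchange_big.
Qed.

Lemma linear_face (U V : lmodType k) (g : {linear U -> V}) phi i L :
  g (face phi i L) = face (fun b v => g (phi b v)) i L.
Proof. by do 3!(rewrite linear_sum; apply: eq_bigr => ? _). Qed.

Lemma eq_face (V : lmodType k) (phi phi' : A -> seq H -> V) i L :
  (forall b v, phi b v = phi' b v) -> face phi i L = face phi' i L.
Proof. by move=> e; do 3!apply: eq_bigr => ? _. Qed.

Lemma hopf_inM h l : hopf_in h * hopf_in l =
  \sum_(y <- sw2 h) \sum_(z <- sw2 l) (f (y.1 \ox z.1) \ox (y.2 * z.2) : E).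
Proof. exact: crossed_mul1. Qed.

Lemma bar_diff_pure_step s :
  (forall h l, size l = s.+1 ->
    sval (unital_tower lY s) (hopf_in h \ox Ytail_pure s l) =
    \sum_(0 <= i < s.+1) (-1) ^+ i *:
      face (fun b v => b \ox Ytail_pure s v) i (h :: l)) ->
  forall h l, size l = s.+2 ->
    bar_diff lY s (hopf_in h \ox Ytail_pure s.+1 l) =
    \sum_(0 <= i < s.+2) (-1) ^+ i *: face (Ypure cpP s) i (h :: l).
Proof.
move=> IH h [|h1 l] // [szl].
rewrite -[Ytail_pure _ _]/(tcons TY s (tobar h1 \ox Ytail_pure s l)) bar_diffE.
rewrite IH // [LHS]linearB [RHS]big_ltn // expr0 scale1r; congr (_ + _).
  rewrite lmulTE hopf_inM face0 linear_sumlz; apply: eq_bigr => y _.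
  by rewrite linear_sumlz.
pose phi : {linear tens A (TY s) -> Y cpP s} :=
  lmulT (TY s) (hopf_in h) \o tens_in (TY s).
rewrite -[X in - X = _]/(phi _) linear_sum -sumrN [RHS]big_add1.
apply: eq_bigr => i _; rewrite [phi _]linearZZ exprS mulN1r scaleNr.
congr (- (_ *: _)); rewrite linear_face faceS; apply: eq_face => b v.
exact: lmulT_hopf_in.
Qed.

Lemma unital_tower_pure s h l : size l = s.+1 ->
    sval (unital_tower lY s) (hopf_in h \ox Ytail_pure s l) =
    \sum_(0 <= i < s.+1) (-1) ^+ i *:
      face (fun b v => b \ox Ytail_pure s v) i (h :: l).
Proof.
elim: s h l => [|s IH] h [|h1 l] // [szl].
  case: l szl => // _; rewrite big_nat1 expr0 scale1r face0.
  by rewrite (svalP mulY_sig) hopf_inM.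
rewrite unital_towerS bar_diff_pure_step //; last by rewrite /= szl.
pose phi : {linear tens E (TY s) -> tens A (TY s.+1)} :=
  tmap idfun (tcons TY s) \o splitE (TY s).
rewrite -[LHS]/(phi _) linear_sum; apply: eq_bigr => i _.
rewrite [phi _]linearZZ; congr (_ *: _); rewrite linear_face; apply: eq_face => b v.
by rewrite -[LHS]/(tmap _ _ (splitE _ _)) splitEE tmapE.
Qed.

Lemma partial_linE s x : partial_ cpP s.+1 x = - partialN_lin s x.
Proof.
pose g : {linear Y cpP s.+1 -> Y cpP s} := -%R \o partialN_lin s.
suff e : partial_ cpP s.+1 =1 g by exact: (e x).
apply: linext_unique => [|[a hs]]; first exact: Yof_ext.
rewrite -[LHS]/(- _) -[RHS]/(\sum_(0 <= i < s.+2) (-1) ^+ i.+1 *: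
  face (fun b v => Ypure cpP s (a * b) v) i hs).
case: (tupleP hs) => h {}hs.
(* The computation on towers starts from 1 # h; left linearity pulls the coefficient a out. *)
rewrite -[Yof _ _]/((a \ox h : E) \ox Ytail_pure s.+1 hs) crossed_decomp -lmulTE.
transitivity (- lmulT (TY s) (alg_in a)
    (bar_diff lY s (hopf_in h \ox Ytail_pure s.+1 hs))).
  by congr (- _); apply: (bar_diff_lmulT (T := TY)).
rewrite bar_diff_pure_step; first last.
- by rewrite size_tuple.
- exact: unital_tower_pure.
rewrite linear_sum -sumrN; apply: eq_bigr => i _.
rewrite [lmulT _ _ _]linearZZ exprS mulN1r scaleNr linear_face.
congr (- (_ *: _)); apply: eq_face => b v.
by rewrite lmulTE mul_alg_in.
Qed.

(** * Identities between d0, mu, sigma and partial *)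

Lemma lactE (M : rmodule E) e (x : tens E M) :
  lact e (x : ind_bimodule M) = lmulT M e x.
Proof.
suff E1 : tmap (reg_mul e) idfun =1 lmulT M e by exact: (E1 x).
by apply: tens_ext => g t; rewrite tmapE lmulTE.
Qed.

Lemma lext_ractl (M N : rmodule E) (b : {linear M -> tens E N}) e x :
  (forall t, b (ract t e) = tmap idfun (ractl N e) (b t)) ->
  lext b (tmap idfun (ractl M e) x) = tmap idfun (ractl N e) (lext b x).
Proof.
move=> be; pose g1 : {linear tens E M -> tens E N} := lext b \o tmap idfun (ractl M e).
pose g2 : {linear tens E M -> tens E N} := tmap idfun (ractl N e) \o lext b.
suff E1 : g1 =1 g2 by exact: (E1 x).
apply: tens_ext => g t; rewrite [LHS]lcompE [RHS]lcompE tmapE !lextE lmulT_tmap.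
by rewrite -be.
Qed.

Lemma eq_tmapr (M N N' : lmodType k) (g g' : {linear N -> N'}) (t : tens M N) :
  g =1 g' -> tmap idfun g t = tmap idfun g' t.
Proof.
move=> gg'; suff E1 : tmap (idfun : {linear M -> M}) g =1 tmap idfun g' by exact: E1.
by apply: tens_ext => m n; rewrite !tmapE gg'.
Qed.

Lemma ractX r s (x : X cpP r s) e : ract x e = tmap idfun (ractl (Xtail cpP r s) e) x.
Proof. by []. Qed.

Lemma d0tail_ract r (t : AE r.+1) e :
  d0tail r (ractl (AE r.+1) e t) = tmap idfun (ractl (AE r) e) (d0tail r t).
Proof.
rewrite [ractl _ _ _]ract_tpower.
have ul y : sval unitalA0 (tmap idfun (ractl (reg_rmodule E) e) y) =
    ractl (reg_rmodule E) e (sval unitalA0 y).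
  pose g1 : {linear tens A E -> E} :=
    sval unitalA0 \o tmap idfun (ractl (reg_rmodule E) e).
  pose g2 : {linear tens A E -> E} := ractl (reg_rmodule E) e \o sval unitalA0.
  suff E1 : g1 =1 g2 by exact: (E1 y).
  apply: tens_ext => a e'; rewrite [LHS]lcompE [RHS]lcompE tmapE.
  rewrite !(svalP unitalA0_sig).
  by rewrite -[RHS]/(alg_in a * e' * e) -[LHS]/(alg_in a * (e' * e)) mulrA.
rewrite (@barA_diff_towmap _ _ TA TA _ unitalA0 unitalA0 ul); apply: eq_tmapr => z.
by rewrite -[RHS]/(ract z e) ract_tpower.
Qed.

Lemma d0_ract r s x e : d0 cpP r.+1 s (ract x e) = ract (d0 cpP r.+1 s x) e.
Proof.
rewrite !d0_linE !ractX; apply: lext_ractl => t; rewrite !lcompE ract_tpower.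
rewrite (@movel_towmap (TX r.+1) (TX r) (TX r.+1) (TX r)
  (ractl (AE r.+1) e) (ractl (AE r) e) (d0tail r) (d0tail r)
  (fun t => d0tail_ract t e)) tens_in_tmap.
by apply: eq_tmapr => z; rewrite -[RHS]/(ract z e) ract_tpower.
Qed.

Lemma d0_lact r s x e : d0 cpP r.+1 s (lact e x) = lact e (d0 cpP r.+1 s x).
Proof. by rewrite !d0_linE !lactE lext_lmulT. Qed.

Lemma mu_lact s x e : mu_ cpP s (lact e x) = lmulT _ e (mu_ cpP s x).
Proof. by rewrite !mu_linE lactE lext_lmulT. Qed.

Lemma sigma_lact r s x e : sigma cpP r s (lact e x) = lact e (sigma cpP r s x).
Proof.
rewrite !sigma_linE !lactE [in RHS]linearZZ; congr (_ *: _).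
exact: lmulT_tmap.
Qed.

Lemma sigmaY_lact s y e : sigmaY cpP s (lmulT _ e y) = lact e (sigmaY cpP s y).
Proof. by rewrite !sigmaY_linE lactE lmulT_tmap. Qed.

Lemma partial_lact s y e :
  partial_ cpP s.+1 (lmulT _ e y) = lmulT _ e (partial_ cpP s.+1 y).
Proof.
by rewrite !partial_linE linearN; congr (- _); apply: (bar_diff_lmulT (T := TY)).
Qed.

Lemma d1_lin_lact s x e : d1_lin s (lact e x) = lact e (d1_lin s x).
Proof. by rewrite !lactE; apply: (bar_diff_lmulT (T := TX 0)). Qed.

Lemma d1_lin_ract s x e : d1_lin s (ract x e) = ract (d1_lin s x) e.
Proof.
have ul y : sval lX (tmap idfun (ractl (reg_rmodule E) e) y) =
    tmap idfun (ractl (reg_rmodule E) e) (sval lX y).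
  pose g1 : {linear tens E E -> tens A E} :=
    sval lX \o tmap idfun (ractl (reg_rmodule E) e).
  pose g2 : {linear tens E E -> tens A E} :=
    tmap idfun (ractl (reg_rmodule E) e) \o sval lX.
  suff E1 : g1 =1 g2 by exact: (E1 y).
  apply: tens_ext => g e'; rewrite [LHS]lcompE [RHS]lcompE tmapE.
  rewrite !(svalP unitalX_sig) tmapE.
  by rewrite -[RHS]/(1 \ox (g * e' * e)) -[LHS]/(1 \ox (g * (e' * e))) mulrA.
rewrite !ractX.
transitivity (d1_lin s (tmap idfun (towmap (T := TX 0) (T' := TX 0)
    (ractl (reg_rmodule E) e) s.+1) x)).
  by congr (d1_lin s _); apply: eq_tmapr => z; rewrite -[LHS]/(ract z e) ract_tpower.
rewrite /d1_lin (@bar_diff_towmap (TX 0) (TX 0) _ lX lX ul).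
by apply: eq_tmapr => z; rewrite -[RHS]/(ract z e) ract_tpower.
Qed.

Lemma mu_sigmaY s y : mu_ cpP s (sigmaY cpP s y) = y.
Proof.
rewrite mu_linE sigmaY_linE.
pose g : {linear Y cpP s -> Y cpP s} := mu_lin s \o sigmaY_lin s.
suff E1 : g =1 (idfun : {linear Y cpP s -> Y cpP s}) by exact: (E1 y).
apply: Yof_ext; apply: YofP => a0 h0 hs h'.
rewrite lcompE Yof_rcons /sigmaY_lin tmapE.
rewrite (@towmap_pure _ _ TY (TX 0) (tpurel H (1 : A) : {linear H -> E})).
rewrite /mu_lin lextE lcompE movel_pure.
transitivity (lmulT (TY s) (a0 \ox h0 : E)
  (tens_in (TY s) (movel_list TY s hs (1 \ox h' : tens A H)))); first by [].
by rewrite movel_list1 tens_inE lmulTE alg_in1 mulr1.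
Qed.

Lemma lmulT_alg_in a (e : E) : lmulT H a (e : tens A H) = alg_in a * e :> E.
Proof.
pose g1 : {linear E -> E} := lmulT H a.
pose g2 : {linear E -> E} := reg_mul (alg_in a).
suff E1 : g1 =1 g2 by exact: (E1 e).
by apply: crossed_ext0 => p; rewrite [LHS]lmulTE -mul_alg_in.
Qed.

(** In the last factor the composite is a e - 1 (a e) = 0 in [E]; [movel_comp0] carries this across
    the factors from [H]. *)
Lemma mu_d0 s x : mu_ cpP s (d0 cpP 1 s x) = 0.
Proof.
rewrite mu_linE d0_linE.
pose g : {linear X cpP 1 s -> Y cpP s} := mu_lin s \o d0_lin 0 s.
suff E1 : g =1 (\0 : {linear X cpP 1 s -> Y cpP s}) by exact: (E1 x).
apply: tens_ext => e t; rewrite lcompE /d0_lin lextE lcompE /mu_lin lext_lmulT.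
rewrite lext_tens_in (movel_comp0 (T1 := TX 1) (T2 := TX 0) (T3 := TY)).
  by rewrite !linear0.
move=> {}t; pose g1 : {linear TA 1%N -> tens A H} :=
  lext (idfun : {linear E -> tens A H}) \o d0tail 0.
suff E1 : g1 =1 (\0 : {linear TA 1%N -> tens A H}) by exact: (E1 t).
apply: tow_ext => a e'; rewrite lcompE /d0tail barA_diffE linearB !lextE.
rewrite (svalP unitalA0_sig) lmulT1 [lmulT _ _ _]lmulT_alg_in.
exact: subrr.
Qed.

Lemma merge_at_rcons i (l : seq A) x : (i.+1 < size l)%N ->
  merge_at i (rcons l x) = rcons (merge_at i l) x.
Proof.
move=> il; rewrite /merge_at -!cats1 -catA cat_cons.
rewrite take_cat drop_cat !nth_cat il !(ltnW il).
by case: (ltngtP i.+2 (size l)) il => // szl _; rewrite szl subnn drop_size.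
Qed.

Lemma merge_at_last (l : seq A) x : merge_at (size l) (rcons (rcons l x) 1) = rcons l x.
Proof.
rewrite /merge_at -!cats1 -catA take_size_cat // nth_cat ltnn subnn.
have -> : (l ++ [:: x; 1])`_(size l).+1 = 1.
  by rewrite nth_cat ltnNge leqnSn /= subSnn.
by rewrite mulr1 drop_oversize //= size_cat /= addn2.
Qed.

Lemma sigma_Xpure r s a0 hs a h' : size hs = s.+1 -> size a = r.+1 ->
  sigma cpP r s (Xpure cpP r s a0 hs a h') =
  (-1) ^+ r.+1 *: Xpure cpP r.+1 s a0 hs (rcons a 1) h'.
Proof.
move=> /eqP szh /eqP sza.
have := sigma_lin_Xof (a0, Tuple szh, Tuple sza, h').
by rewrite sigma_linE => /= ->.
Qed.

Lemma sigmaY_Ypure s a0 hs h' : size hs = s.+1 ->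
  sigmaY cpP s (Ypure cpP s a0 (rcons hs h')) = Xpure cpP 0 s a0 hs [:: 1] h'.
Proof.
move=> szh; have szr : size (rcons hs h') == s.+2 by rewrite size_rcons szh.
have := sigmaY_lin_Yof (a0, Tuple szr).
rewrite -sigmaY_linE => /= ->; rewrite -cats1 -szh take_size_cat //.
by rewrite nth_cat ltnn subnn.
Qed.

Lemma d0_Xpure r s a0 hs a h' : size hs = s.+1 -> size a = r.+2 ->
  d0 cpP r.+1 s (Xpure cpP r.+1 s a0 hs a h') =
  \sum_(x <- swseq hs) Xpure cpP r s (a0 * acts act x.1 a`_0) x.2 (behead a) h' +
    \sum_(1 <= i < r.+2) (-1) ^+ i *: Xpure cpP r s a0 hs (merge_at i.-1 a) h'.
Proof.
move=> /eqP szh /eqP sza; rewrite d0_linE.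
exact: (d0_lin_Xof (a0, Tuple szh, Tuple sza, h')).
Qed.

Lemma mu_Xpure s a0 hs a1 h' : size hs = s.+1 ->
  mu_ cpP s (Xpure cpP 0 s a0 hs [:: a1] h') =
    \sum_(x <- swseq hs) Ypure cpP s (a0 * acts act x.1 a1) (rcons x.2 h').
Proof.
move=> /eqP szh; rewrite mu_linE.
exact: (mu_lin_Xof (a0, Tuple szh, [tuple a1], h')).
Qed.

Lemma d0_sigma0 s x : d0 cpP 1 s (sigma cpP 0 s x) + sigmaY cpP s (mu_ cpP s x) = x.
Proof.
pose g1 : {linear X cpP 0 s -> X cpP 0 s} := d0 cpP 1 s \o sigma cpP 0 s.
pose g2 : {linear X cpP 0 s -> X cpP 0 s} := sigmaY cpP s \o mu_ cpP s.
pose g : {linear X cpP 0 s -> X cpP 0 s} := g1 \+ g2.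
suff e : g =1 (idfun : {linear X cpP 0 s -> X cpP 0 s}) by exact: (e x).
apply: Xof_ext => -[[[a0 hs] a] h'].
rewrite -[LHS]/(d0 cpP 1 s (sigma cpP 0 s _) + sigmaY cpP s (mu_ cpP s _)).
rewrite -[RHS]/(Xof cpP (a0, hs, a, h')) /Xof.
case: (tupleP a) => a1 a2; rewrite (tuple0 a2) [tval _]/= {a a2}.
rewrite sigma_Xpure ?size_tuple // mu_Xpure ?size_tuple //.
rewrite linearZZ d0_Xpure ?size_tuple // big_nat1 expr1 !scaleN1r.
rewrite linear_sum opprB -addrA /merge_at /= mulr1 -[RHS]addr0; congr (_ + _).
apply/eqP; rewrite addrC subr_eq0; apply/eqP; apply: eq_big_seq => y /swseq_size[_].
by rewrite size_tuple => sz; rewrite sigmaY_Ypure.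
Qed.

(** Appending 1 commutes with every face but the new last one, which multiplies by 1 and returns x.
    The signs in [sigma] make the common terms [S1 + S2] cancel. *)
Lemma d0_sigma r s x :
  d0 cpP r.+2 s (sigma cpP r.+1 s x) + sigma cpP r s (d0 cpP r.+1 s x) = x.
Proof.
pose g1 : {linear X cpP r.+1 s -> X cpP r.+1 s} := d0 cpP r.+2 s \o sigma cpP r.+1 s.
pose g2 : {linear X cpP r.+1 s -> X cpP r.+1 s} := sigma cpP r s \o d0 cpP r.+1 s.
pose g : {linear X cpP r.+1 s -> X cpP r.+1 s} := g1 \+ g2.
suff e : g =1 (idfun : {linear X cpP r.+1 s -> X cpP r.+1 s}) by exact: (e x).
apply: Xof_ext => -[[[a0 hs] a] h'].
rewrite -[LHS]/(d0 cpP r.+2 s (sigma cpP r.+1 s _) + sigma cpP r s (d0 cpP r.+1 s _)).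
rewrite -[RHS]/(Xof cpP (a0, hs, a, h')) /Xof.
set x0 := Xpure _ _ _ _ _ _ _; have sza : size a = r.+2 by rewrite size_tuple.
pose S1 := \sum_(x <- swseq hs)
  Xpure cpP r.+1 s (a0 * acts act x.1 a`_0) x.2 (rcons (behead a) 1) h'.
pose S2 := \sum_(1 <= i < r.+2) (-1) ^+ i *:
  Xpure cpP r.+1 s a0 hs (rcons (merge_at i.-1 a) 1) h'.
have -> : sigma cpP r s (d0 cpP r.+1 s x0) = (-1) ^+ r.+1 *: (S1 + S2).
  rewrite d0_Xpure ?size_tuple // linearD scalerDr !scaler_sumr !linear_sum.
  congr (_ + _).
    apply: eq_big_seq => y /swseq_size[_]; rewrite size_tuple => szy.
    by rewrite sigma_Xpure // size_behead sza.
  apply: eq_big_nat => i /andP[i0 ir]; rewrite linearZZ sigma_Xpure ?size_tuple //.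
    by rewrite scalerA mulrC -scalerA.
  by lia.
have -> : d0 cpP r.+2 s (sigma cpP r.+1 s x0) =
    (-1) ^+ r.+2 *: (S1 + S2 + (-1) ^+ r.+2 *: x0).
  rewrite sigma_Xpure ?size_tuple // linearZZ; congr (_ *: _).
  rewrite d0_Xpure ?size_rcons ?size_tuple // big_nat_recr //= addrA.
  congr (_ + _ + _ *: _).
  - by apply: eq_big_seq => y _; move: sza; case: (tval a).
  - apply: eq_big_nat => i /andP[i0 ir]; rewrite merge_at_rcons // sza.
    by case: i i0 ir.
  - have [b [c ac]] := tuple_rcons a; rewrite /x0 ac /=.
    by have := merge_at_last b c; rewrite size_tuple => ->.
rewrite exprS mulN1r !scaleNr scalerDr scalerN scalerA -expr2 sqrr_sign scale1r.
by rewrite opprD opprK addrAC addNr add0r.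
Qed.

(** By [d0_sigma0] such an x is d^0 of its image under [sigma], and d^0 commutes with the right
    action. *)
Lemma mu_ract0 s x e : mu_ cpP s x = 0 -> mu_ cpP s (ract x e) = 0.
Proof.
move=> mx; have := d0_sigma0 x; rewrite mx linear0 addr0 => <-.
by rewrite -d0_ract mu_d0.
Qed.

Lemma mulY_tens_in g (w : E) : sval lY (lmulT H g (tens_in H (w : tens A H))) = g * w :> E.
Proof.
pose g1 : {linear E -> E} := sval lY \o (lmulT H g \o tens_in H).
pose g2 : {linear E -> E} := reg_mul g.
suff e : g1 =1 g2 by exact: (e w).
apply: crossed_ext0 => p; rewrite ![LHS]lcompE.
transitivity (g * alg_in p.1 * hopf_in p.2); last first.
  by rewrite -mulrA -crossed_decomp.
rewrite -[LHS]/(sval lY (lmulT H g (tens_in H (p.1 \ox p.2)))) tens_inE lmulTE.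
exact: (svalP mulY_sig).
Qed.

Lemma mulY_lmulT g y : sval lY (lmulT H g y) = g * (sval lY y : E) :> E.
Proof.
pose g1 : {linear tens E H -> E} := sval lY \o lmulT H g.
pose g2 : {linear tens E H -> E} := reg_mul g \o (sval lY : {linear tens E H -> E}).
suff e : g1 =1 g2 by exact: (e y).
apply: tens_ext => e h; rewrite [LHS]lcompE [RHS]lcompE lmulTE.
by rewrite !(svalP mulY_sig) -mulrA.
Qed.

Lemma mu_d1_lin s x : mu_ cpP s (d1_lin s x) = partialN_lin s (mu_ cpP s.+1 x).
Proof.
rewrite !mu_linE.
have lYA a y : sval lY (lmulT _ (alg_in a) y) = lmulT _ a (sval lY y).
  by rewrite -[LHS]/(sval lY (lmulT H (alg_in a) y)) mulY_lmulT -lmulT_alg_in.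
have pl (g : E) (x1 : E) : sval lY (lmulT _ g (tens_in _ (x1 : tens A H))) =
    lext (idfun : {linear E -> tens A H}) (sval lX (g \ox x1)).
  rewrite -[LHS]/(sval lY (lmulT H g (tens_in H x1))) mulY_tens_in.
  by rewrite (svalP unitalX_sig) lextE lmulT1.
exact: (esym (@bar_diff_movel (TX 0) TY (idfun : {linear E -> tens A H})
  lX lY lYA pl s x)).
Qed.

Lemma ract_Xtail r s hs a (e1 e2 : E) :
  ract (Xtail_pure r s hs a e1) e2 = Xtail_pure r s hs a (e1 * e2).
Proof.
rewrite /Xtail_pure !tpower_pureE ract_tpower.
rewrite (@towmap_pure _ _ (TX r) (TX r)).
rewrite [ractl _ _ _](ract_tpower (M := reg_rmodule E) (n := r)).
by rewrite (@towmap_pure _ _ TA TA).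
Qed.

Lemma ract_ind (M : rmodule E) (x : E) (t : M) e :
  ract (x \ox t : ind_bimodule M) e = (x \ox ract t e : ind_bimodule M).
Proof. exact: tens_ractE. Qed.

Definition Xgen r s (hs : s.-tuple H) (a : r.-tuple A) : X cpP r s :=
  (1 : E) \ox Xtail_pure r s hs a 1.

Lemma Xgen_mul r s e (hs : s.-tuple H) (a : r.-tuple A) e' :
  lact e (ract (Xgen hs a) e') = ((e : E) \ox Xtail_pure r s hs a e' : X cpP r s).
Proof.
rewrite lactE [ract _ _]ract_ind lmulTE mulr1; congr (_ \ox _).
by rewrite ract_Xtail mul1r.
Qed.

Lemma towpure_rcons (V : lmodType k) (T : tower V) n v a x : size v = n ->
  towpure (T := shiftT T) n v (tcons T 0 (a \ox x)) =
  towpure (T := T) n.+1 (rcons v a) x.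
Proof.
elim: n v => [|n IH] [|b v] // [szv].
by rewrite [LHS]/= IH.
Qed.

(** Right multiples of elements ending in 1 exhaust X_{r+1,s}, so identities between right linear
    maps can be tested on the image of [sigma]. *)
Lemma sigma_span r s (V : lmodType k) (g g' : {linear X cpP r.+1 s -> V}) :
  (forall x e, g (ract (sigma cpP r s x) e) = g' (ract (sigma cpP r s x) e)) ->
  g =1 g'.
Proof.
move=> gg'; apply: Xgen_ext => e hs a e'; have [b [c ->]] := tuple_rcons a.
(* With c # 1 as last factor, [sigma] makes c the last reduced factor and leaves 1 on the right. The
   scalar below undoes the sign of [sigma]. *)
pose x0 : X cpP r s := e \ox Xtail_pure r s hs b (alg_in c).
have e1 : ract (sigma cpP r s ((-1) ^+ r.+1 *: x0)) e' =
    (e \ox Xtail_pure r.+1 s hs (rcons b c) e' : X cpP r.+1 s).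
  rewrite sigma_linE linearZZ scalerA -expr2 sqrr_sign scale1r.
  rewrite /sigma_lin tmapE /Xtail_pure !tpower_pureE.
  rewrite (@towmap_pure _ _ (TX r) (TX r.+1) (sigma_tail r)).
  rewrite (@towmap_pure _ _ TA (shiftT TA) (sval sigmaA_sig)) (svalP sigmaA_sig).
  rewrite [X in towpure s _ X](@towpure_rcons _ TA) ?size_map ?size_tuple //.
  rewrite ract_ind; congr (_ \ox _).
  have := @ract_Xtail r.+1 s hs (rcons b c) 1 e'.
  by rewrite mul1r /Xtail_pure !tpower_pureE map_rcons.
by rewrite [tval _]/= -e1.
Qed.

(** On the image of sigma, d d sigma = d - d sigma d. This is zero since d sigma is the identity on
    the image of d: d d = 0 one degree lower, and mu d = 0 at the bottom. *)
Lemma d0_d0 r s x : d0 cpP r.+1 s (d0 cpP r.+2 s x) = 0.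
Proof.
elim: r x => [|r IH] x.
  pose g : {linear X cpP 2 s -> X cpP 0 s} := d0 cpP 1 s \o d0 cpP 2 s.
  suff e : g =1 (\0 : {linear X cpP 2 s -> X cpP 0 s}) by exact: (e x).
  apply: sigma_span => {}x e; rewrite [LHS]lcompE !d0_ract.
  have e1 := d0_sigma x; have e2 := d0_sigma0 (d0 cpP 1 s x).
  rewrite mu_d0 linear0 addr0 in e2.
  have e3 : d0 cpP 2 s (sigma cpP 1 s x) = x - sigma cpP 0 s (d0 cpP 1 s x).
    by rewrite -[X in X - _]e1 addrK.
  by rewrite e3 linearB e2 subrr linear0l.
pose g : {linear X cpP r.+3 s -> X cpP r.+1 s} := d0 cpP r.+2 s \o d0 cpP r.+3 s.
suff e : g =1 (\0 : {linear X cpP r.+3 s -> X cpP r.+1 s}) by exact: (e x).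
apply: sigma_span => {}x e; rewrite [LHS]lcompE !d0_ract.
have e1 := d0_sigma x; have e2 := d0_sigma (d0 cpP r.+2 s x).
rewrite IH linear0 addr0 in e2.
have e3 : d0 cpP r.+3 s (sigma cpP r.+2 s x) = x - sigma cpP r.+1 s (d0 cpP r.+2 s x).
  by rewrite -[X in X - _]e1 addrK.
by rewrite e3 linearB e2 subrr linear0l.
Qed.

(** * The augmented complex Y and its contraction *)

Lemma mulY_partialN y : sval lY (partialN_lin 0 y) = 0.
Proof.
pose g : {linear Y cpP 1 -> tens A H} := sval lY \o partialN_lin 0.
suff e : g =1 (\0 : {linear Y cpP 1 -> tens A H}) by exact: (e y).
apply: tens_ext => g0 t.
pose g1 : {linear TY 1%N -> tens A H} := g \o tpurel (TY 1%N) g0.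
suff e : g1 =1 (\0 : {linear TY 1%N -> tens A H}) by exact: (e t).
apply: tow_ext => h l.
rewrite -[LHS]/(sval lY (bar_diff lY 0 (g0 \ox tcons TY 0 (tobar h \ox l)))).
rewrite bar_diffE -[LHS]/(sval lY (lmulT H g0 _)) mulY_lmulT linearB.
transitivity (g0 * (sval lY (hopf_in h \ox l) - sval lY (lmulT H 1 (tens_in H
   (sval lY (hopf_in h \ox l)))))); first by rewrite lmulT1.
by rewrite mulY_tens_in mul1r subrr mulr0.
Qed.

(** The sign absorbs the one in [bar_diff_contract], so that the homotopy identity for [partial_]
    holds without signs. *)
Definition contrY s (y : Y cpP s) : Y cpP s.+1 := (-1) ^+ s *: contractY s y.

Lemma contrY_linear s : linear (@contrY s).
Proof.
by move=> c x y; rewrite /contrY linearP scalerDr !scalerA mulrC.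
Qed.

Lemma contrY_lact s y e : contrY (lmulT (TY s) e y) = lmulT (TY s.+1) e (contrY y).
Proof.
rewrite /contrY [RHS]linearZZ; congr (_ *: _).
exact: (lmulT_tmap (W := TY s.+1)).
Qed.

Lemma splitE_unit (e : E) :
  splitE H (e \ox 1) = tmap idfun bar_unit (e : tens A H).
Proof.
pose g1 : {linear E -> tens A (tens (bar H) H)} :=
  splitE H \o applyr (@tpure k E H) 1.
pose g2 : {linear E -> tens A (tens (bar H) H)} := tmap idfun bar_unit.
suff e1 : g1 =1 g2 by exact: (e1 e).
apply: crossed_ext0 => p; rewrite [LHS]lcompE.
by rewrite -[LHS]/(splitE H (_ \ox 1)) splitEE /g2 [RHS]tmapE.
Qed.

Lemma partialN_unit y : bar_diff lY 0 (tmap idfun bar_unit y) =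
  (sval lY y : E) \ox 1 - y.
Proof.
pose g1 : {linear tens E H -> tens E H} := bar_diff lY 0 \o tmap idfun bar_unit.
pose g2 : {linear tens E H -> tens E H} :=
  applyr (@tpure k E H) 1 \o (sval lY : {linear tens E H -> E}).
suff e1 : (g1 \+ idfun : {linear tens E H -> tens E H}) =1 g2.
  by apply/eqP; rewrite eq_sym subr_eq; apply/eqP/esym/(e1 y).
apply: tens_ext => g h.
rewrite -[LHS]/(bar_diff lY 0 (tmap idfun bar_unit (g \ox h)) + g \ox h).
rewrite tmapE -[X in bar_diff _ _ X]/(g \ox tcons TY 0 (tobar h \ox 1)) bar_diffE.
rewrite -[RHS]/((sval lY (g \ox h) : E) \ox 1) !(svalP mulY_sig).
rewrite -[hopf_in 1]/(1 : E) mulr1 linearB lmulTE tens_inE lmulTE mulr1.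
by rewrite subrK.
Qed.

Lemma contrY_unital y : sval (unital_tower lY 1) (tmap idfun bar_unit y) =
  tmap idfun bar_unit (sval lY y) - tmap idfun (tcons TY 0) (splitE _ y).
Proof.
rewrite unital_towerS partialN_unit !linearB -splitE_unit; congr (_ - _).
move: (splitE _ _) => z.
suff e1 : tmap idfun (tcons TY 0) =1 (idfun : {linear tens A (TY 1%N) -> _}).
  exact: (e1 z).
by apply: tens_ext => a t; rewrite tmapE.
Qed.

Lemma partial_contrY0 y :
  partial_ cpP 1 (contrY y) = y - ((sval lY y : E) \ox 1 : Y cpP 0).
Proof.
rewrite /contrY expr0 scale1r partial_linE.
rewrite [X in - X](partialN_unit y); exact: opprB.
Qed.

Lemma partialN_contract s (y : Y cpP s.+1) :
  partialN_lin s.+1 (contractY s.+1 y) =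
  contractY s (partialN_lin s y) + (-1) ^+ s *: y.
Proof. exact: (@bar_diff_contract TY lY bar_unit contrY_unital s y). Qed.

Lemma partial_contrY s (y : Y cpP s.+1) :
  partial_ cpP s.+2 (contrY y) + contrY (partial_ cpP s.+1 y) = y.
Proof.
rewrite !partial_linE /contrY linearZZ.
rewrite partialN_contract.
rewrite [contractY _ (- _)]linearN exprS mulN1r scaleNr opprK scalerDr scalerN.
by rewrite scalerA -expr2 sqrr_sign scale1r addrAC subrr add0r.
Qed.

Lemma sigmaY_contract s e (b : s.-tuple H) c :
  sigmaY cpP s.+1 (contractY s ((e : E) \ox towpure (T := TY) s (map (@tobar k H) b) c)) =
  lact e (Xgen [tuple of rcons b c] [tuple]).
Proof.
rewrite sigmaY_linE /contractY /sigmaY_lin !tmapE.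
rewrite (@towmap_pure _ _ TY (shiftT TY) bar_unit).
rewrite [X in towmap _ s.+1 X](@towpure_rcons _ TY) ?size_map ?size_tuple //.
rewrite (@towmap_pure _ _ TY (TX 0) (tpurel H (1 : A) : {linear H -> E})).
rewrite lactE lmulTE mulr1; congr (_ \ox _).
by rewrite /Xtail_pure !tpower_pureE map_rcons.
Qed.

(** The analogue of [sigma_span], with a right multiplication borrowed from X_{0s}: lift by
    [sigmaY], multiply, return by mu. *)
Lemma contrY_span s (V : lmodType k) (g g' : {linear Y cpP s.+1 -> V}) :
  (forall y e, g (mu_ cpP s.+1 (ract (sigmaY cpP s.+1 (contractY s y)) e)) =
     g' (mu_ cpP s.+1 (ract (sigmaY cpP s.+1 (contractY s y)) e))) ->
  g =1 g'.
Proof.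
move=> gg' y; rewrite -[y](mu_sigmaY y); move: (sigmaY _ _ y) => {y} x.
pose h : {linear X cpP 0 s.+1 -> V} := g \o mu_ cpP s.+1.
pose h' : {linear X cpP 0 s.+1 -> V} := g' \o mu_ cpP s.+1.
suff e : h =1 h' by exact: (e x).
apply: Xgen_ext => e hs a e'; have [b [c ->]] := tuple_rcons hs.
pose y : Y cpP s := e \ox towpure (T := TY) s (map (@tobar k H) b) c.
rewrite -Xgen_mul -lractA (tuple0 a) -sigmaY_contract.
exact: gg'.
Qed.

Lemma partialN_partialN s y : partialN_lin s (partialN_lin s.+1 y) = 0.
Proof.
(* [d1_lin] commutes with the right action and lies over the differential of [Y]; stability of the
   kernel of mu then carries vanishing from z to its right multiples. *)
have step (z : Y cpP s.+2) e : partialN_lin s (partialN_lin s.+1 z) = 0 ->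
    partialN_lin s (partialN_lin s.+1
      (mu_ cpP s.+2 (ract (sigmaY cpP s.+2 z) e))) = 0.
  move=> z0; rewrite -!mu_d1_lin !d1_lin_ract; apply: mu_ract0.
  by rewrite !mu_d1_lin mu_sigmaY.
elim: s step y => [|s IH] step y.
  pose g : {linear Y cpP 2 -> Y cpP 0} := partialN_lin 0 \o partialN_lin 1.
  suff e : g =1 (\0 : {linear Y cpP 2 -> Y cpP 0}) by exact: (e y).
  apply: contrY_span => {}y e; apply: step.
  rewrite partialN_contract expr0 scale1r linearD
    [partialN_lin _ (contractY _ _)]partialN_unit mulY_partialN.
  by rewrite linear0l sub0r addNr.
pose g : {linear Y cpP s.+3 -> Y cpP s.+1} := partialN_lin s.+1 \o partialN_lin s.+2.
suff e : g =1 (\0 : {linear Y cpP s.+3 -> Y cpP s.+1}) by exact: (e y).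
apply: contrY_span => {}y e; apply: step.
rewrite partialN_contract linearD linearZZ partialN_contract IH; last first.
  move=> z e' z0; rewrite -!mu_d1_lin !d1_lin_ract; apply: mu_ract0.
  by rewrite !mu_d1_lin mu_sigmaY.
by rewrite linear0 add0r exprS mulN1r scaleNr subrr.
Qed.

Lemma partial_partial s y : partial_ cpP s.+1 (partial_ cpP s.+2 y) = 0.
Proof. by rewrite !partial_linE linearN partialN_partialN !oppr0. Qed.

(** * Extension of bimodule maps from generators *)

Section Hom.
Variables M N P : bimodule E.

Lemma is_lhom_ext (g g' : M -> N) : g =1 g' -> is_lhom g -> is_lhom g'.
Proof. by move=> /funext ->. Qed.

Lemma is_bihom_ext (g g' : M -> N) : g =1 g' -> is_bihom g -> is_bihom g'.
Proof. by move=> /funext ->. Qed.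

Lemma is_lhom0 : is_lhom (fun _ : M => 0 : N).
Proof. by split=> [c x y|e x]; rewrite ?scaler0 ?addr0 ?linear0r. Qed.

Lemma is_bihom0 : is_bihom (fun _ : M => 0 : N).
Proof. by split=> [|x e]; [exact: is_lhom0 | rewrite linear0l]. Qed.

Lemma is_lhomN (g : M -> N) : is_lhom g -> is_lhom (fun x => - g x).
Proof.
case=> gl ga; split=> [c x y|e x]; first by rewrite gl opprD scalerN.
by rewrite ga linearNr.
Qed.

Lemma is_bihomN (g : M -> N) : is_bihom g -> is_bihom (fun x => - g x).
Proof.
by case=> /is_lhomN gl gr; split=> // x e; rewrite gr linearNl.
Qed.

Lemma is_lhomD (g g' : M -> N) :
  is_lhom g -> is_lhom g' -> is_lhom (fun x => g x + g' x).
Proof.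
case=> gl ga [gl' ga']; split=> [c x y|e x]; last by rewrite ga ga' linearDr.
by rewrite gl gl' addrACA scalerDr.
Qed.

Lemma is_bihomD (g g' : M -> N) :
  is_bihom g -> is_bihom g' -> is_bihom (fun x => g x + g' x).
Proof.
case=> gl gr [gl' gr']; split=> [|x e]; first exact: is_lhomD.
by rewrite gr gr' linearDl.
Qed.

Lemma is_lhom_comp (g : N -> P) (g' : M -> N) :
  is_lhom g -> is_lhom g' -> is_lhom (fun x => g (g' x)).
Proof. by case=> gl ga [gl' ga']; split=> [c x y|e x]; rewrite ?gl' ?gl ?ga' ?ga. Qed.

Lemma is_bihom_comp (g : N -> P) (g' : M -> N) :
  is_bihom g -> is_bihom g' -> is_bihom (fun x => g (g' x)).
Proof.
case=> gl gr [gl' gr']; split=> [|x e]; first exact: is_lhom_comp.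
by rewrite gr' gr.
Qed.

Lemma is_lhom_sum (I : Type) (s : seq I) (Q : pred I) (g : I -> M -> N) :
  (forall i, Q i -> is_lhom (g i)) -> is_lhom (fun x => \sum_(i <- s | Q i) g i x).
Proof.
move=> gl; elim: s => [|i s IH].
  by apply: is_lhom_ext is_lhom0 => x; rewrite big_nil.
case Qi : (Q i).
  by apply: is_lhom_ext (is_lhomD (gl i Qi) IH) => x; rewrite big_cons Qi.
by apply: is_lhom_ext IH => x; rewrite big_cons Qi.
Qed.

Lemma is_bihom_sum (I : Type) (s : seq I) (Q : pred I) (g : I -> M -> N) :
  (forall i, Q i -> is_bihom (g i)) -> is_bihom (fun x => \sum_(i <- s | Q i) g i x).
Proof.
move=> gl; elim: s => [|i s IH].
  by apply: is_bihom_ext is_bihom0 => x; rewrite big_nil.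
case Qi : (Q i).
  by apply: is_bihom_ext (is_bihomD (gl i Qi) IH) => x; rewrite big_cons Qi.
by apply: is_bihom_ext IH => x; rewrite big_cons Qi.
Qed.

Section Additive.
Variable g : M -> N.
Hypothesis gl : is_lhom g.

Lemma lhomD x y : g (x + y) = g x + g y.
Proof. by have := gl.1 1 x y; rewrite !scale1r. Qed.
Lemma lhom0 : g 0 = 0.
Proof. by apply: (addrI (g 0)); rewrite -lhomD !addr0. Qed.
Lemma lhomN x : g (- x) = - g x.
Proof. by apply: (addIr (g x)); rewrite -lhomD !addNr lhom0. Qed.
Lemma lhomB x y : g (x - y) = g x - g y.
Proof. by rewrite lhomD lhomN. Qed.
Lemma lhomZ c x : g (c *: x) = c *: g x.
Proof. by have := gl.1 c x 0; rewrite !addr0 lhom0 addr0. Qed.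
Lemma lhom_sum (I : Type) (s : seq I) (Q : pred I) (F : I -> M) :
  g (\sum_(i <- s | Q i) F i) = \sum_(i <- s | Q i) g (F i).
Proof. by apply: (big_morph g lhomD lhom0). Qed.

End Additive.
End Hom.

Lemma is_bihom_id (M : bimodule E) : is_bihom (fun x : M => x).
Proof. by []. Qed.

Lemma recast_neq r s r' s' (x : X cpP r s) :
  (r, s) != (r', s') -> recast r' s' x = 0.
Proof. by rewrite /recast; case: eqP. Qed.

Lemma recast_bihom r s r' s' : is_bihom (recast (cpP := cpP) (r := r) (s := s) r' s').
Proof.
have [[<- <-]|ne] := eqVneq (r, s) (r', s').
  by apply: is_bihom_ext (is_bihom_id _) => x; rewrite recast_id.
by apply: is_bihom_ext (is_bihom0 _ _) => x; rewrite recast_neq.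
Qed.

Lemma linear_is_lhom (M N : bimodule E) (g : {linear M -> N}) :
  (forall e x, g (lact e x) = lact e (g x)) -> is_lhom g.
Proof. by split=> //; apply: linearP. Qed.

Lemma d0_bihom r s : is_bihom (d0 cpP r.+1 s).
Proof.
split=> [|x e]; last exact: d0_ract.
by apply: linear_is_lhom => e x; apply: d0_lact.
Qed.

Lemma sigma_lhom r s : is_lhom (sigma cpP r s).
Proof. by apply: linear_is_lhom => e x; apply: sigma_lact. Qed.

Lemma bihom_ext r s (M : bimodule E) (g g' : X cpP r s -> M) :
  is_bihom g -> is_bihom g' ->
  (forall (hs : s.-tuple H) (a : r.-tuple A), g (Xgen hs a) = g' (Xgen hs a)) ->
  g =1 g'.
Proof.
move=> [[gl ga] gr] [[gl' ga'] gr'] gg'.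
pose h : {linear X cpP r s -> M} := HB.pack g (GRing.isLinear.Build k _ _ _ g gl).
pose h' : {linear X cpP r s -> M} := HB.pack g' (GRing.isLinear.Build k _ _ _ g' gl').
suff e : h =1 h' by exact: e.
apply: Xgen_ext => e hs a e'; rewrite -Xgen_mul.
by rewrite -[LHS]/(g _) -[RHS]/(g' _) ga gr ga' gr' gg'.
Qed.

Section TowerSplit.
Variables (V : lmodType k) (T : tower V) (b : {linear T 0%N -> tens (T 0%N) E}).

Fixpoint towsplit n : {linear T n -> tens (T n) E} :=
  if n is n'.+1 then
    tmap (tcons T n') idfun \o (tassocl V (T n') E \o
      (tmap idfun (towsplit n') \o tucons T n'))
  else b.

Lemma towsplit_pure n v x y e : b x = y \ox e ->
  towsplit n (towpure (T := T) n v x) = towpure (T := T) n v y \ox e.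
Proof.
move=> bx; elim: n v => [|n IH] v //.
transitivity (tmap (tcons T n) idfun (tassocl V (T n) E (tmap idfun (towsplit n)
    (tucons T n (tcons T n (head 0 v \ox towpure (T := T) n (behead v) x)))))).
  by [].
by rewrite tconsK tmapE IH tassoclE tmapE.
Qed.
End TowerSplit.

(* Xtail r s is an induced right E-module: 1 (x) h (x) a (x) e is sent to
   (1 (x) h (x) a (x) 1) (x) e. *)
Definition Xtail_split r s : {linear Xtail cpP r s -> tens (Xtail cpP r s) E} :=
  towsplit (T := TX r) (towsplit (T := TA) (tpurel E (1 : E)) r) s.

Lemma Xtail_splitE r s hs a (e : E) :
  Xtail_split r s (Xtail_pure r s hs a e) = Xtail_pure r s hs a 1 \ox e.
Proof.
rewrite /Xtail_split /Xtail_pure !tpower_pureE.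
by apply: (@towsplit_pure _ (TX r)); apply: (@towsplit_pure _ TA).
Qed.

Fact lact_linear (M : bimodule E) e : linear (@lact _ _ M e).
Proof. by move=> c x y; rewrite linearPr. Qed.
Definition lactl (M : bimodule E) e : {linear M -> M} :=
  HB.pack (@lact _ _ M e) (GRing.isLinear.Build k M M _ _ (@lact_linear M e)).

Section BimodExt.
Variables (r s : nat) (M : bimodule E) (F : X cpP r s -> M).
Hypothesis Flin : linear F.

Fact bimod_ext_bilinear1 : bilinear_for *:%R *:%R
  (fun (t : Xtail cpP r s) (e : E) => ract (F ((1 : E) \ox t)) e).
Proof.
split=> [e|t] c x y; last by rewrite linearPr.
by rewrite linearPr Flin linearPl.
Qed.

Fact bimod_ext_bilinear2 : bilinear_for *:%R *:%R
  (fun (e : E) (t : Xtail cpP r s) =>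
     lact e (tensl bimod_ext_bilinear1 (Xtail_split r s t))).
Proof. by split=> [t|e] c x y; rewrite ?linearPl // !linearP linearPr. Qed.

(** Splitting the last factor off the tail realises the prescribed values by a linear map, so
    [bimod_ext] does not take its default value. All that [F] must satisfy is [k]-linearity. *)
Lemma bimod_extE e (hs : s.-tuple H) (a : r.-tuple A) e' :
  bimod_ext F ((e : E) \ox Xtail_pure r s hs a e') = lact e (ract (F (Xgen hs a)) e').
Proof.
apply: (linextE (g := tensl bimod_ext_bilinear2) _ (e, hs, a, e')).
by move=> [[[{}e {}hs] {}a] {}e']; rewrite tenslE Xtail_splitE tenslE.
Qed.

Lemma bimod_ext_gen (hs : s.-tuple H) (a : r.-tuple A) :
  bimod_ext F (Xgen hs a) = F (Xgen hs a).
Proof. by rewrite bimod_extE ract1 lact1. Qed.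

Lemma bimod_ext_bihom : is_bihom (bimod_ext F).
Proof.
split; first (apply: linear_is_lhom => e x; rewrite lactE).
- pose g1 : {linear X cpP r s -> M} := bimod_ext F \o lmulT _ e.
  pose g2 : {linear X cpP r s -> M} := lactl M e \o bimod_ext F.
  suff e1 : g1 =1 g2 by exact: (e1 x).
  apply: Xgen_ext => e' hs a e''; rewrite [LHS]lcompE [RHS]lcompE lmulTE.
  by rewrite bimod_extE [bimod_ext _ _]bimod_extE -lactA.
- move=> x e.
  pose g1 : {linear X cpP r s -> M} := bimod_ext F \o ractl (X cpP r s) e.
  pose g2 : {linear X cpP r s -> M} := ractl M e \o bimod_ext F.
  suff e1 : g1 =1 g2 by exact: (e1 x).
  apply: Xgen_ext => e' hs a e''; rewrite [LHS]lcompE [RHS]lcompE.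
  rewrite -[ractl (X cpP r s) e _]/(ract _ e) ract_ind ract_Xtail bimod_extE.
  by rewrite [bimod_ext _ _]bimod_extE -[RHS]/(ract _ e) lractA ractA.
Qed.
End BimodExt.

(** The section t is not right linear, but only the values of t h on generators are kept: their
    bimodule extension, followed by g, agrees with h on generators and hence everywhere. *)
Lemma X_rel_projective r s : rel_projective (X cpP r s).
Proof.
move=> M N g h gb [t tl gt] hb.
have thl : linear (fun x => t (h x)) := (is_lhom_comp tl hb.1).1.
exists (bimod_ext (fun x => t (h x))); first exact: bimod_ext_bihom.
apply: (bihom_ext (is_bihom_comp gb (bimod_ext_bihom thl)) hb) => hs a.
by rewrite bimod_ext_gen.
Qed.

Lemma dfuel_bihom n l r s : is_bihom (dfuel (cpP := cpP) n l (r := r) (s := s)).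
Proof.
elim: n l r s => [|n IH] l r s /=; first exact: is_bihom0.
case: eqP => [_|_].
  case: eqP => [_|]; first exact: is_bihom0.
  case: r => // r _.
  exact: (is_bihom_comp (recast_bihom _ _ _ _) (d0_bihom r s)).
case: ifP => _; apply: bimod_ext_bihom.
  move=> c x y; rewrite (recast_bihom _ _ _ _).1.1 !linearP.
  by rewrite (recast_bihom _ _ _ _).1.1 opprD scalerN.
apply: (is_lhomN _).1; apply: is_lhom_sum => j _.
exact: (is_lhom_comp (recast_bihom _ _ _ _).1 (is_lhom_comp (sigma_lhom _ _)
  (is_lhom_comp (recast_bihom _ _ _ _).1
    (is_lhom_comp (IH _ _ _).1 (IH _ _ _).1)))).
Qed.

Lemma dl_bihom l r s : is_bihom (dl (cpP := cpP) l (r := r) (s := s)).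
Proof. exact: dfuel_bihom. Qed.

(** The recursion is stated at generators because [sigma] is not right linear while [dl] is. *)
Lemma dl_gen_rec l r s (hs : s.-tuple H) (a : r.-tuple A) :
  (0 < l)%N -> (1 < r + l)%N -> dl l (Xgen hs a) =
  - \sum_(0 <= j < l | (0 < r + j)%N)
      recast (r + l).-1 (s - l) (sigma cpP (r + l).-2 (s - l)
        (recast (r + l).-2 (s - l) (dl (l - j) (dl j (Xgen hs a))))).
Proof.
move=> l0 rl; rewrite dl_rec // bimod_ext_gen //.
apply: (is_lhomN _).1; apply: is_lhom_sum => j _.
exact: (is_lhom_comp (recast_bihom _ _ _ _).1 (is_lhom_comp (sigma_lhom _ _)
  (is_lhom_comp (recast_bihom _ _ _ _).1
    (is_lhom_comp (dl_bihom _ _ _).1 (dl_bihom _ _ _).1)))).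
Qed.

Lemma dl_gen_01 s (hs : s.-tuple H) (a : 0.-tuple A) : dl 1 (Xgen hs a) =
  - recast (0 + 1).-1 (s - 1) (sigmaY cpP s.-1 (partial_ cpP s (mu_ cpP s (Xgen hs a)))).
Proof.
rewrite dl_01 bimod_ext_gen // => c x y; rewrite !linearP.
by rewrite (recast_bihom _ _ _ _).1.1 opprD scalerN.
Qed.

(** * The total complex *)

Local Notation inX n x := (@inXn k H A act f cpP n _ _ x).
Local Notation Xn := (Xn cpP).

Lemma dsumDE n (x y : Xn n) j : (x + y) j = x j + y j.
Proof. by []. Qed.

Lemma dsum_sumE n (I : Type) (s : seq I) (Q : pred I) (F : I -> Xn n) j :
  (\sum_(i <- s | Q i) F i) j = \sum_(i <- s | Q i) F i j.
Proof. by apply: (big_morph (fun x : Xn n => x j)). Qed.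

Lemma dsum_lhom (M : bimodule E) n (g : M -> Xn n) :
  (forall j, is_lhom (fun x => g x j)) -> is_lhom g.
Proof.
move=> gj; split=> [c x y|e x]; apply: functional_extensionality_dep => j.
  exact: (gj j).1.
exact: (gj j).2.
Qed.

Lemma dsum_bihom (M : bimodule E) n (g : M -> Xn n) :
  (forall j, is_bihom (fun x => g x j)) -> is_bihom g.
Proof.
move=> gj; split=> [|x e]; first by apply: dsum_lhom => j; exact: (gj j).1.
by apply: functional_extensionality_dep => j; exact: (gj j).2.
Qed.

Lemma dsum_proj_bihom n j : is_bihom (fun x : Xn n => x j).
Proof. by []. Qed.

Lemma inXn_bihom n r s : is_bihom (@inXn k H A act f cpP n r s).
Proof. by apply: dsum_bihom => j; apply: recast_bihom. Qed.

Lemma inXn_recast n r s r' s' (x : X cpP r s) : (r, s) = (r', s') ->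
  inX n (recast r' s' x) = inX n x.
Proof. by case=> <- <-; rewrite recast_id. Qed.

Lemma Xn_decomp n (x : Xn n) : x = \sum_(s < n.+1) inX n (x s).
Proof.
apply: functional_extensionality_dep => j; rewrite dsum_sumE (bigD1 j) //=.
rewrite big1 ?addr0 => [|i ij]; first by rewrite /inXn recast_id.
rewrite /inXn recast_neq //; apply: contra ij => /eqP[_ ij].
by apply/eqP/val_inj.
Qed.

Lemma Xn_ind n (P : Xn n -> Prop) : P 0 -> (forall x y, P x -> P y -> P (x + y)) ->
  (forall r s (x : X cpP r s), (r + s = n)%N -> P (inX n x)) -> forall x, P x.
Proof.
move=> P0 PD Pin x; rewrite [x]Xn_decomp; apply: big_ind => // s _.
by apply: Pin; have := ltn_ord s; lia.
Qed.

Definition totX n (M : nmodType) (G : forall r s, X cpP r s -> M) (x : Xn n) : M :=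
  \sum_(s < n.+1) G (n - s)%N s (x s).

Lemma totX_in n (M : nmodType) (G : forall r s, X cpP r s -> M) r s (x : X cpP r s) :
  (forall r s, G r s 0 = 0) -> (r + s = n)%N -> totX G (inX n x) = G r s x.
Proof.
move=> G0 rs; have sn : (s < n.+1)%N by lia.
rewrite /totX (bigD1 (Ordinal sn)) //= big1 ?addr0 => [|i ij].
  have Gr r' s' : (r, s) = (r', s') -> G r' s' (recast r' s' x) = G r s x.
    by case=> <- <-; rewrite recast_id.
  by apply: (Gr (n - s)%N s); congr pair; lia.
rewrite /inXn recast_neq ?G0 //; apply: contra ij => /eqP[_ ij].
by apply/eqP/val_inj; rewrite /= ij.
Qed.

(** Collecting the d^l for fixed l turns the relations among them into equations between maps of
    [Xn], free of casts. The guard drops the cases in which truncated subtraction puts the target of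
    [dl] outside degree n. *)
Definition delta l n : Xn n.+1 -> Xn n :=
  totX (fun r s x => if (l <= s)%N && (0 < r + l)%N then inX n (dl l x) else 0).

Lemma delta_in l n r s (x : X cpP r s) : (r + s = n.+1)%N ->
  delta l (inX n.+1 x) =
  if (l <= s)%N && (0 < r + l)%N then inX n (dl l x) else 0.
Proof.
move=> rs; rewrite /delta totX_in // => {rs} r' s'.
by case: ifP => // _; rewrite (lhom0 (dl_bihom _ _ _).1) (lhom0 (inXn_bihom _ _ _).1).
Qed.

Lemma delta_bihom l n : is_bihom (@delta l n).
Proof.
apply: is_bihom_sum => s _; case: ((l <= s)%N && (0 < n.+1 - s + l)%N).
  exact: (is_bihom_comp (inXn_bihom _ _ _)
    (is_bihom_comp (dl_bihom _ _ _) (dsum_proj_bihom s))).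
exact: (is_bihom_comp (is_bihom0 (Xn n.+1) (Xn n)) (is_bihom_id _)).
Qed.

Lemma dn_delta n N (x : Xn n.+1) : (n.+1 < N)%N ->
  dn x = \sum_(0 <= l < N) delta l x.
Proof.
move=> nN; rewrite /delta /totX exchange_big; apply: eq_bigr => s _.
rewrite [RHS](big_cat_nat (n := s.+1)) //=; last by have := ltn_ord s; lia.
rewrite [X in _ = _ + X]big1_seq ?addr0; last first.
  by move=> l; rewrite mem_index_iota => /andP[_ /andP[sl _]]; rewrite leqNgt sl.
rewrite big_mkcond; apply: eq_big_nat => l /andP[_ ls].
by rewrite -[(l <= s)%N]ltnS ls.
Qed.

Definition sigmaX n : Xn n -> Xn n.+1 := totX (fun r s x => inX n.+1 (sigma cpP r s x)).

Lemma sigmaX_in n r s (x : X cpP r s) : (r + s = n)%N ->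
  sigmaX (inX n x) = inX n.+1 (sigma cpP r s x).
Proof.
move=> rs; rewrite /sigmaX totX_in // => {rs} r' s'.
by rewrite linear0 (lhom0 (inXn_bihom _ _ _).1).
Qed.

Lemma sigmaX_lhom n : is_lhom (@sigmaX n).
Proof.
apply: is_lhom_sum => s _; exact: (is_lhom_comp (inXn_bihom _ _ _).1
    (is_lhom_comp (sigma_lhom _ _) (dsum_proj_bihom s).1)).
Qed.

(** mu extended by zero to the components with r > 0. The cast is there because [n - n] is not
    convertible to 0. *)
Definition muX n (x : Xn n) : Y cpP n := mu_ cpP n (recast 0 n (x ord_max)).

Lemma recast_recast r s r' s' r'' s'' (x : X cpP r s) : (r', s') = (r'', s'') ->
  recast r'' s'' (recast r' s' x) = recast r'' s'' x.
Proof. by case=> <- <-; rewrite recast_id. Qed.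

Lemma muX_in n r s (x : X cpP r s) : muX (inX n x) = mu_ cpP n (recast 0 n x).
Proof. by rewrite /muX /inXn recast_recast //= subnn. Qed.

Lemma muX_linear n : linear (@muX n).
Proof.
move=> c x y; rewrite /muX -linearP; congr (mu_ _ _ _).
exact: (recast_bihom _ _ _ _).1.1.
Qed.

Lemma muX_lact n e (x : Xn n) : muX (lact e x) = lmulT _ e (muX x).
Proof. by rewrite /muX -mu_lact -(recast_bihom _ _ _ _).1.2. Qed.

Definition sigmaYX n (y : Y cpP n) : Xn n := inX n (sigmaY cpP n y).

Lemma muXD n (x y : Xn n) : muX (x + y) = muX x + muX y.
Proof. by have := muX_linear 1 x y; rewrite !scale1r. Qed.
Lemma muX0 n : muX (0 : Xn n) = 0.
Proof. by apply: (addrI (muX (0 : Xn n))); rewrite -muXD !addr0. Qed.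
Lemma muX_sum n (I : Type) (s : seq I) (Q : pred I) (F : I -> Xn n) :
  muX (\sum_(i <- s | Q i) F i) = \sum_(i <- s | Q i) muX (F i).
Proof. exact: (big_morph _ (@muXD n) (muX0 n)). Qed.

Lemma delta0_in0 n s (x : X cpP 0 s) : (s = n.+1)%N -> delta 0 (inX n.+1 x) = 0.
Proof. by move=> sn; rewrite delta_in. Qed.

Lemma delta0_inS n r s (x : X cpP r.+1 s) : (r + s = n)%N ->
  delta 0 (inX n.+1 x) = inX n (d0 cpP r.+1 s x).
Proof.
move=> rs; rewrite delta_in ?addSn ?rs //= dl_d0 inXn_recast //.
by rewrite addn0 subn0.
Qed.

Lemma muX_delta0 n (x : Xn n.+1) : muX (delta 0 x) = 0.
Proof.
move: x; apply: Xn_ind => [|x y ex ey|[|r] s x rs].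
- by rewrite (lhom0 (delta_bihom 0 n).1) muX0.
- by rewrite (lhomD (delta_bihom 0 n).1) muXD ex ey addr0.
- by rewrite delta0_in0 ?muX0.
- rewrite delta0_inS ?muX_in; last by lia.
  case: r x rs => [|r] x rs; last by rewrite recast_neq // linear0.
  have sn : s = n by lia.
  by rewrite -{n rs}sn recast_id mu_d0.
Qed.

Lemma muX_delta l n (x : Xn n.+1) : (1 < l)%N -> muX (delta l x) = 0.
Proof.
move=> l1; move: x; apply: Xn_ind => [|x y ex ey|r s x rs].
- by rewrite (lhom0 (delta_bihom l n).1) muX0.
- by rewrite (lhomD (delta_bihom l n).1) muXD ex ey addr0.
- rewrite delta_in //; case: ifP => [_|]; last by rewrite muX0.
  rewrite muX_in recast_neq ?linear0 // xpair_eqE; apply/negP => /andP[/eqP].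
  by lia.
Qed.

(** On generators this is the definition of d^1 and mu sigma = 1. In general, subtract [d1_lin],
    whose image under mu is known everywhere: the difference is a bimodule map that sends generators
    into the kernel of mu, and this kernel is stable on both sides. *)
Lemma mu_dl1 s (x : X cpP 0 s.+1) :
  mu_ cpP s (recast 0 s (dl 1 x)) = - partial_ cpP s.+1 (mu_ cpP s.+1 x).
Proof.
rewrite partial_linE opprK -mu_d1_lin; apply/eqP; rewrite -subr_eq0 -linearB /=.
pose G (x : X cpP 0 s.+1) : X cpP 0 s := recast 0 s (dl 1 x) - d1_lin s x.
have d1b : is_bihom (d1_lin s).
  split=> [|y e]; last exact: d1_lin_ract.
  by apply: linear_is_lhom => e y; apply: d1_lin_lact.
have Gb : is_bihom G.
  apply: is_bihomD; last exact: is_bihomN.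
  exact: (is_bihom_comp (recast_bihom _ _ _ _) (dl_bihom _ _ _)).
have Ggen (hs : s.+1.-tuple H) (a : 0.-tuple A) : mu_ cpP s (G (Xgen hs a)) = 0.
  rewrite /G dl_gen_01 (lhomN (recast_bihom _ _ _ _).1) recast_recast ?subn1 //.
  rewrite recast_id linearB linearN mu_sigmaY [mu_ cpP s (d1_lin s _)]mu_d1_lin.
  by rewrite partial_linE opprK subrr.
pose g : {linear X cpP 0 s.+1 -> Y cpP s} := mu_ cpP s \o
  (HB.pack G (GRing.isLinear.Build k _ _ _ G Gb.1.1) : {linear X cpP 0 s.+1 -> X cpP 0 s}).
suff e : g =1 (\0 : {linear X cpP 0 s.+1 -> Y cpP s}) by apply/eqP; exact: (e x).
apply: Xgen_ext => e hs a e'; rewrite -Xgen_mul.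
rewrite -[LHS]/(mu_ cpP s (G _)) Gb.1.2 Gb.2 mu_lact mu_ract0 //.
exact: linear0.
Qed.

Lemma muX_delta1 n (x : Xn n.+1) : muX (delta 1 x) = - partial_ cpP n.+1 (muX x).
Proof.
move: x; apply: Xn_ind => [|x y ex ey|r s x rs].
- by rewrite (lhom0 (delta_bihom 1 n).1) !muX0 linear0 oppr0.
- by rewrite (lhomD (delta_bihom 1 n).1) !muXD ex ey linearD opprD.
- rewrite delta_in // !muX_in (_ : (0 < r + 1)%N) ?addn1 // andbT.
  case: r x rs => [|r] x rs; last first.
    rewrite [recast 0 n.+1 x]recast_neq // !linear0.
    case: ifP => _; last by rewrite muX0.
    by rewrite muX_in recast_neq ?linear0 // xpair_eqE; lia.
  move: x; rewrite add0n in rs; rewrite rs => x.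
  by rewrite recast_id /= muX_in mu_dl1.
Qed.

Lemma delta0_delta0 n (x : Xn n.+2) : delta 0 (delta 0 x) = 0.
Proof.
move: x; apply: Xn_ind => [|x y ex ey|[|r] s x rs].
- by rewrite !(lhom0 (delta_bihom 0 _).1).
- by rewrite !(lhomD (delta_bihom 0 _).1) ex ey addr0.
- by rewrite delta0_in0 // (lhom0 (delta_bihom 0 _).1).
- rewrite delta0_inS; last by lia.
  case: r x rs => [|r] x rs; first by rewrite delta0_in0 //; lia.
  by rewrite delta0_inS ?d0_d0 ?(lhom0 (inXn_bihom _ _ _).1) //; lia.
Qed.

Lemma delta0_sigmaYX n (y : Y cpP n.+1) : delta 0 (sigmaYX y) = 0.
Proof. exact: delta0_in0. Qed.

Lemma delta0_sigmaX0 (x : Xn 0) :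
  delta 0 (sigmaX x) + sigmaYX (muX x) = x.
Proof.
move: x; apply: Xn_ind => [|x y ex ey|r s x rs].
- rewrite (lhom0 (sigmaX_lhom _)) (lhom0 (delta_bihom 0 _).1) muX0 /sigmaYX.
  by rewrite linear0 (lhom0 (inXn_bihom _ _ _).1) addr0.
- rewrite (lhomD (sigmaX_lhom _)) (lhomD (delta_bihom 0 _).1) muXD /sigmaYX.
  rewrite linearD (lhomD (inXn_bihom _ _ _).1) addrACA.
  exact: (congr2 +%R ex ey).
- case: r s x rs => [|//] [|//] x _.
  rewrite sigmaX_in // delta0_inS // muX_in recast_id /sigmaYX.
  by rewrite -(lhomD (inXn_bihom _ _ _).1) d0_sigma0.
Qed.

Lemma delta0_sigmaX n (x : Xn n.+1) : delta 0 (sigmaX x) +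
  sigmaX (delta 0 x) + sigmaYX (muX x) = x.
Proof.
move: x; apply: Xn_ind => [|x y ex ey|r s x rs].
- rewrite !(lhom0 (sigmaX_lhom _), lhom0 (delta_bihom 0 _).1) muX0 /sigmaYX.
  by rewrite linear0 (lhom0 (inXn_bihom _ _ _).1) !addr0.
- rewrite !(lhomD (sigmaX_lhom _), lhomD (delta_bihom 0 _).1) muXD /sigmaYX.
  rewrite linearD (lhomD (inXn_bihom _ _ _).1) [X in X + _ = _]addrACA [LHS]addrACA.
  exact: (congr2 +%R ex ey).
- rewrite sigmaX_in // delta0_inS // muX_in.
  case: r x rs => [|r] x rs.
    rewrite delta0_in0 // (lhom0 (sigmaX_lhom _)) addr0 /sigmaYX.
    move: x; rewrite add0n in rs; rewrite rs => x.
    by rewrite recast_id -(lhomD (inXn_bihom _ _ _).1) d0_sigma0.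
  rewrite delta0_inS; last by lia.
  rewrite sigmaX_in; last by lia.
  rewrite recast_neq // linear0 /sigmaYX linear0 (lhom0 (inXn_bihom _ _ _).1) addr0.
  by rewrite -(lhomD (inXn_bihom _ _ _).1) d0_sigma.
Qed.

(** All clauses of the recursion in one formula. For r = 0 the term j = 0 drops out because
    [delta 0] vanishes there. The last term is the clause for d^1_{0s}; for r > 0 it is zero because
    [muX u] is. *)
Lemma delta_gen l n r s (hs : s.-tuple H) (a : r.-tuple A) : (r + s = n.+2)%N ->
  (0 < l)%N -> let u := inX n.+2 (Xgen hs a) in
  delta l u = - \sum_(0 <= j < l) sigmaX (delta (l - j) (delta j u)) -
    (if l == 1%N then sigmaYX (partial_ cpP n.+2 (muX u)) else 0).
Proof.
move=> rs l0 u; have sigmaX0 := lhom0 (sigmaX_lhom n).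
have delta0 m := lhom0 (delta_bihom m n).1.
(* For l > s both sides vanish: lowering s by j and then by l - j leaves the range. *)
have [sl|ls] := ltnP s l.
  rewrite delta_in // leqNgt sl /= big1_seq ?oppr0 ?add0r.
    case: eqP => [l1|_]; last by rewrite oppr0.
    rewrite muX_in recast_neq ?linear0 /sigmaYX ?linear0.
      by rewrite (lhom0 (inXn_bihom _ _ _).1) oppr0.
    by rewrite xpair_eqE; lia.
  move=> j /= /[!mem_index_iota] jl; rewrite delta_in //.
  case: ifP => [/andP[js rj]|_]; last by rewrite delta0.
  rewrite delta_in; last by lia.
  by rewrite ifN //; lia.
have [r1|r1] := leqP (r + l) 1.
  have [r0 l1] : r = 0%N /\ l = 1%N by lia.
  subst r l; have sn : s = n.+2 by lia.
  subst s; rewrite delta_in //= dl_gen_01 big_nat1 delta0_in0 // delta0 sigmaX0.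
  rewrite oppr0 add0r muX_in recast_id (lhomN (inXn_bihom _ _ _).1) inXn_recast //.
have -> : (if l == 1%N then sigmaYX (partial_ cpP n.+2 (muX u)) else 0) = 0.
  case: eqP => // l1; rewrite muX_in recast_neq ?linear0 /sigmaYX ?linear0.
    by rewrite (lhom0 (inXn_bihom _ _ _).1).
  by rewrite xpair_eqE; lia.
rewrite subr0 delta_in // ls (ltnW r1) /= dl_gen_rec //.
rewrite (lhomN (inXn_bihom _ _ _).1) (lhom_sum (inXn_bihom _ _ _).1); congr (- _).
rewrite big_mkcond; apply: eq_big_nat => j /andP[_ jl].
rewrite delta_in // (leq_trans (ltnW jl) ls) /=; case: ifP => rj; last first.
  by rewrite delta0 sigmaX0.
rewrite delta_in; last by lia.
rewrite ifT; last by lia.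
rewrite sigmaX_in; last by lia.
have eqX r0 s0 r1' s1 r' s' (y : X cpP r0 s0) : r0 = r1' -> s0 = s1 -> r' = r1'.+1 ->
    s' = s1 -> inX n.+1 (recast r' s' (sigma cpP r1' s1 (recast r1' s1 y))) =
    inX n.+1 (sigma cpP r0 s0 y).
  by move=> <- <- -> ->; rewrite !recast_id.
by apply: eqX; lia.
Qed.

(* The component of dn \o dn lowering s by l. *)
Definition square l n (x : Xn n.+2) : Xn n :=
  \sum_(0 <= j < l.+1) delta (l - j) (delta j x).

(** * The components of the square of the differential vanish *)

Lemma square_bihom l n : is_bihom (@square l n).
Proof.
by apply: is_bihom_sum => j _; apply: is_bihom_comp; apply: delta_bihom.
Qed.

Lemma squareE l n (x : Xn n.+2) :
  square l x = \sum_(0 <= j < l) delta (l - j) (delta j x) + delta 0 (delta l x).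
Proof. by rewrite /square big_nat_recr //= subnn. Qed.

(** Only the term with d^1 outermost, j = l - 1, survives mu, and it gives - partial mu d^(l-1).
    Here mu d^(l-1) is zero unless l = 2, and for l = 2 the term vanishes by partial partial = 0. *)
Lemma muX_lower l n (x : Xn n.+2) : (0 < l)%N ->
  muX (\sum_(0 <= j < l) delta (l - j) (delta j x)) = 0.
Proof.
case: l => // l _; rewrite big_nat_recr //= muXD muX_sum big1_seq ?add0r.
  rewrite subSnn muX_delta1.
  case: l => [|[|l]]; first by rewrite muX_delta0 linear0 oppr0.
    by rewrite muX_delta1 linearN partial_partial !oppr0.
  by rewrite muX_delta // linear0 oppr0.
move=> j /= /[!mem_index_iota] jl; apply: muX_delta; lia.
Qed.

Lemma square_gen l n r s (hs : s.-tuple H) (a : r.-tuple A) : (r + s = n.+2)%N ->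
  (forall m, (m < l)%N -> forall n x, square (n := n) m x = 0) ->
  (forall n', n = n'.+1 ->
     square (n := n') l (delta 0 (inX n'.+3 (Xgen hs a))) = 0) ->
  (0 < l)%N -> square l (inX n.+2 (Xgen hs a)) = 0.
Proof.
move=> rs IHl IHr l0; set u := inX _ _; rewrite squareE.
set Z := \sum_(0 <= j < l) _.
have -> : delta 0 (delta l u) = - delta 0 (sigmaX Z).
  rewrite delta_gen // -(lhom_sum (sigmaX_lhom n)) -/Z -/u.
  rewrite (lhomB (delta_bihom 0 _).1) (lhomN (delta_bihom 0 _).1).
  by case: ifP => _; rewrite ?delta0_sigmaYX ?(lhom0 (delta_bihom 0 _).1) subr0.
have MZ : muX Z = 0 by apply: muX_lower.
have SY0 m : sigmaYX (0 : Y cpP m) = 0.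
  by rewrite /sigmaYX linear0 (lhom0 (inXn_bihom _ _ _).1).
(* In total degree 0 there is no d^0 Z, and the homotopy identity has no term sigma d^0. *)
case: n => [|n] in u Z MZ rs IHr *.
  by have := delta0_sigmaX0 Z; rewrite MZ SY0 addr0 => ->; rewrite subrr.
have := delta0_sigmaX Z; rewrite MZ SY0 addr0 => eZ.
suff Z0 : delta 0 Z = 0.
  by rewrite -[X in X - _]eZ Z0 (lhom0 (sigmaX_lhom n)) addr0 subrr.
rewrite /Z (lhom_sum (delta_bihom 0 _).1).
(* Each d^0 d^(l-j) at d^j u is minus the rest of a component of the square: one of lower degree for
   j > 0, the one at d^0 u for j = 0. *)
transitivity (- \sum_(0 <= j < l) \sum_(0 <= i < l - j)
    delta (l - j - i) (delta i (delta j u))).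
  rewrite -sumrN; apply: eq_big_nat => j /andP[_ jl].
  apply/eqP; rewrite -addr_eq0 addrC -squareE; apply/eqP.
  case: j jl => [|j] jl; first by rewrite subn0; apply: IHr.
  by apply: IHl; lia.
apply/eqP; rewrite oppr_eq0; apply/eqP.
(* Grouped by m = i + j, the inner sums are components of degree m < l, followed by d^(l-m). *)
rewrite (big_triangle (fun i j => delta (l - j - i) (delta i (delta j u)))).
apply: big1_seq => m /= /[!mem_index_iota] ml.
transitivity (delta (l - m) (square m u)); last first.
  by rewrite IHl // (lhom0 (delta_bihom _ _).1).
rewrite /square (lhom_sum (delta_bihom _ _).1); apply: eq_big_nat => j jm.
by have -> : (l - j - (m - j) = l - m)%N by lia.
Qed.

(** Induction on l and, for fixed l, on r, which d^0 lowers. Generators suffice because [square] is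
    a bimodule map. *)
Lemma square_eq0 l n (x : Xn n.+2) : square l x = 0.
Proof.
move: l n x; apply: ltn_ind => l IHl n.
have [->|l0] := posnP l.
  by move=> x; rewrite /square big_nat1 subn0 delta0_delta0.
suff main r s (x : X cpP r s) : (r + s = n.+2)%N -> square l (inX n.+2 x) = 0.
  by apply: Xn_ind => [|x y ex ey|r s x /main//];
    rewrite ?(lhom0 (square_bihom _ _).1) ?(lhomD (square_bihom _ _).1) ?ex ?ey ?addr0.
elim: r n s x => [|r IHr] n s x rs.
  apply: (bihom_ext (is_bihom_comp (square_bihom l n) (inXn_bihom _ _ _))
    (is_bihom0 _ _) _ x) => hs a.
  apply: square_gen => // n' en; rewrite delta0_in0 ?(lhom0 (square_bihom _ _).1) //.
  by lia.
apply: (bihom_ext (is_bihom_comp (square_bihom l n) (inXn_bihom _ _ _))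
  (is_bihom0 _ _) _ x) => hs a.
apply: square_gen => // n' en; rewrite delta0_inS; last by lia.
by apply: IHr; lia.
Qed.

Lemma delta_delta0 l l' n (x : Xn n.+2) : (n.+2 < l + l')%N ->
  delta l (delta l' x) = 0.
Proof.
move=> nl; move: x; apply: Xn_ind => [|x y ex ey|r s x rs].
- by rewrite !(lhom0 (delta_bihom _ _).1).
- by rewrite !(lhomD (delta_bihom _ _).1) ex ey addr0.
- rewrite delta_in //; case: ifP => h; last by rewrite (lhom0 (delta_bihom _ _).1).
  rewrite delta_in; last by lia.
  by rewrite ifN //; lia.
Qed.

Lemma dn_dn n (x : Xn n.+2) : dn (dn x) = 0.
Proof.
rewrite (@dn_delta n.+1 n.+3) // (dn_delta (N := n.+3)) //.
transitivity (\sum_(0 <= l < n.+3) \sum_(0 <= m < n.+3 - l) delta m (delta l x)).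
  rewrite (eq_bigr _ (fun l _ => lhom_sum (delta_bihom l n).1 _ _ _)).
  rewrite exchange_big /=; apply: eq_big_nat => l /andP[_ ln].
  rewrite (big_cat_nat (n := n.+3 - l)) ?leq_subr //= [X in _ + X]big1_seq ?addr0 //.
  move=> m /= /[!mem_index_iota] ml; apply: delta_delta0; lia.
rewrite (big_triangle (fun m l => delta m (delta l x))).
by apply: big1_seq => m _; rewrite -/(square m x) square_eq0.
Qed.

(** [contrY] appends 1, so [sigmaY] sends its values to left multiples of generators, where d^1 is
    given by its definition. This is an equality in X_{0s}, not merely modulo the kernel of mu. *)
Lemma dl1_contract s (y : Y cpP s) :
  recast 0 s (dl 1 (sigmaY cpP s.+1 (contrY y))) =
  - sigmaY cpP s (partial_ cpP s.+1 (contrY y)).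
Proof.
pose g x : X cpP 0 s := recast 0 s (dl 1 (x : X cpP 0 s.+1)).
have gb : is_bihom g by exact: (is_bihom_comp (recast_bihom _ _ _ _) (dl_bihom _ _ _)).
rewrite -/(g _) /contrY [sigmaY cpP s.+1 _]linearZZ (lhomZ gb.1).
rewrite [partial_ _ _ _]linearZZ [sigmaY cpP s _]linearZZ -scalerN; congr (_ *: _).
pose g1 : {linear Y cpP s -> X cpP 0 s} :=
  (HB.pack g (GRing.isLinear.Build k _ _ _ g gb.1.1) : {linear X cpP 0 s.+1 -> X cpP 0 s})
  \o (sigmaY cpP s.+1 \o contractY s).
pose g2 : {linear Y cpP s -> X cpP 0 s} :=
  sigmaY cpP s \o (partial_ cpP s.+1 \o contractY s).
suff e : (g1 \+ g2 : {linear Y cpP s -> X cpP 0 s}) =1 (\0 : {linear Y cpP s -> X cpP 0 s}).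
  by apply/eqP; rewrite -addr_eq0; apply/eqP; exact: (e y).
apply: tens_ext => e t.
pose h : {linear TY s -> X cpP 0 s} :=
  (g1 \+ g2 : {linear Y cpP s -> X cpP 0 s}) \o tpurel (TY s) e.
suff E1 : h =1 (\0 : {linear TY s -> X cpP 0 s}) by exact: (E1 t).
apply: (@towpure_ext _ _ TY H id) => // hs c.
set y0 := e \ox towpure (T := TY) s (map (@tobar k H) hs) c : Y cpP s.
rewrite -[LHS]/(g (sigmaY cpP s.+1 (contractY s y0)) +
  sigmaY cpP s (partial_ cpP s.+1 (contractY s y0))).
rewrite -[X in partial_ _ _ X](mu_sigmaY (contractY s y0)) sigmaY_contract.
rewrite gb.1.2 mu_lact partial_lact sigmaY_lact -linearDr /=.
rewrite /g dl_gen_01 (lhomN (recast_bihom _ _ _ _).1) recast_recast ?subn1 //.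
by rewrite recast_id addNr linear0r.
Qed.

(** * The contraction *)

(* x lies in the p-th step of the filtration by s: its components with s >= p
   vanish. *)
Definition low p n (x : Xn n) := forall j : 'I_n.+1, (p <= j)%N -> x j = 0.

Lemma low0 p n : low p (0 : Xn n). Proof. by []. Qed.
Lemma lowD p n (x y : Xn n) : low p x -> low p y -> low p (x + y).
Proof. by move=> lx ly j pj; rewrite dsumDE lx // ly // addr0. Qed.
Lemma lowN p n (x : Xn n) : low p x -> low p (- x).
Proof. by move=> lx j pj; rewrite -[LHS]/(- x j) lx // oppr0. Qed.
Lemma low_sum p n (I : eqType) (s : seq I) (Q : pred I) (F : I -> Xn n) :
  (forall i, i \in s -> Q i -> low p (F i)) -> low p (\sum_(i <- s | Q i) F i).
Proof.
move=> lF; rewrite big_seq_cond; apply: big_ind => [|x y|i /andP[? ?]]; first exact: low0.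
  exact: lowD.
exact: lF.
Qed.
Lemma low_le p q n (x : Xn n) : (p <= q)%N -> low p x -> low q x.
Proof. by move=> pq lx j qj; apply: lx; apply: leq_trans qj. Qed.
Lemma low_in p n r s (x : X cpP r s) : (s < p)%N -> low p (inX n x).
Proof.
move=> sp j pj; rewrite /inXn recast_neq // xpair_eqE negb_and orbC.
by rewrite (_ : s != j) //; lia.
Qed.

Lemma low_delta p l n r s (x : X cpP r s) : (r + s = n.+1)%N -> (s - l < p)%N ->
  low p (delta l (inX n.+1 x)).
Proof.
by move=> rs sl; rewrite delta_in //; case: ifP => _; [apply: low_in | apply: low0].
Qed.

(** The minus sign compensates the one in [delta1_sigmaYX]. *)
Definition htpy n (x : Xn n) : Xn n.+1 := sigmaX x - sigmaYX (contrY (muX x)).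

Lemma sigmaYX_linear n : linear (@sigmaYX n).
Proof. by move=> c x y; rewrite /sigmaYX linearP (inXn_bihom _ _ _).1.1. Qed.

Lemma sigmaYXD n (x y : Y cpP n) : sigmaYX (x + y) = sigmaYX x + sigmaYX y.
Proof. by rewrite /sigmaYX linearD (lhomD (inXn_bihom _ _ _).1). Qed.

Lemma sigmaYXN n (x : Y cpP n) : sigmaYX (- x) = - sigmaYX x.
Proof. by rewrite /sigmaYX linearN (lhomN (inXn_bihom _ _ _).1). Qed.

Lemma sigmaYX0 n : sigmaYX (0 : Y cpP n) = 0.
Proof. by rewrite /sigmaYX linear0 (lhom0 (inXn_bihom _ _ _).1). Qed.

Lemma contrY0 s : contrY (0 : Y cpP s) = 0.
Proof. by rewrite /contrY linear0 scaler0. Qed.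

Lemma htpy_lhom n : is_lhom (@htpy n).
Proof.
apply: is_lhomD; first exact: sigmaX_lhom.
apply: is_lhomN; split=> [c x y|e x].
  by rewrite muX_linear contrY_linear sigmaYX_linear.
rewrite muX_lact contrY_lact /sigmaYX [sigmaY cpP n.+1 _]sigmaY_lact.
exact: (inXn_bihom _ _ _).1.2.
Qed.

Lemma delta1_sigmaYX n (y : Y cpP n) :
  delta 1 (sigmaYX (contrY y)) = - sigmaYX (partial_ cpP n.+1 (contrY y)).
Proof.
rewrite /sigmaYX delta_in //= -(lhomN (inXn_bihom _ _ _).1) -dl1_contract.
by rewrite inXn_recast // subn1.
Qed.

(** The second summand of [htpy] raises s by one, so its d^1 part still lies at level s and is a
    leading term, while its d^0 part is zero since r = 0 there. All remaining parts fall strictly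
    below s. *)
Lemma low_dn_htpy n r s (x : X cpP r s) : (r + s = n)%N -> let u := inX n x in
  low s (dn (htpy u) -
    (delta 0 (sigmaX u) + sigmaYX (partial_ cpP n.+1 (contrY (muX u))))).
Proof.
move=> rs u; rewrite (dn_delta (N := n.+2)) //.
rewrite big_ltn // big_ltn //.
rewrite !(lhomB (delta_bihom _ _).1) delta0_sigmaYX subr0 delta1_sigmaYX opprK.
rewrite -[X in _ + X - _]addrA [X in X - _]addrA addrACA [X in X - _]addrC addrK.
apply: lowD.
  rewrite sigmaX_in //; case: s x rs u => [|s] x rs u; last by apply: low_delta; lia.
  by rewrite delta_in //; lia.
apply: low_sum => l /[!mem_index_iota] /andP[l2 ln] _.
rewrite (lhomB (delta_bihom _ _).1); apply: lowD.
  rewrite sigmaX_in //; case: s x rs u => [|s] x rs u; last by apply: low_delta; lia.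
  rewrite delta_in; last by lia.
  by rewrite ifN; [apply: low0 | lia].
apply: lowN; rewrite /u muX_in; case: r x rs {u} => [|r] x rs.
  by rewrite /sigmaYX; apply: low_delta => //; lia.
rewrite recast_neq // linear0 contrY0 sigmaYX0 (lhom0 (delta_bihom _ _).1).
exact: low0.
Qed.

Lemma low_htpy_dn n r s (x : X cpP r s) : (r + s = n.+1)%N -> let u := inX n.+1 x in
  low s (htpy (dn u) -
    (sigmaX (delta 0 u) + sigmaYX (contrY (partial_ cpP n.+1 (muX u))))).
Proof.
move=> rs u; rewrite (dn_delta (N := n.+3)) // (lhom_sum (htpy_lhom _)).
rewrite big_ltn // big_ltn // /htpy muX_delta0 contrY0 sigmaYX0 subr0.
rewrite muX_delta1 (_ : contrY (- _) = - contrY (partial_ cpP n.+1 (muX u))); last first.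
  by rewrite /contrY linearN scalerN.
rewrite sigmaYXN opprK.
rewrite -[X in _ + X - _]addrA [X in X - _]addrA addrACA [X in X - _]addrC addrK.
have lowS l : (0 < l)%N -> low s (sigmaX (delta l u)).
  move=> l0; rewrite delta_in //; case: ifP => [/andP[ls rl]|_].
    by rewrite sigmaX_in; [apply: low_in; lia | lia].
  by rewrite (lhom0 (sigmaX_lhom _)); apply: low0.
apply: lowD; first exact: lowS.
apply: low_sum => l /[!mem_index_iota] /andP[l2 ln] _.
rewrite muX_delta // contrY0 sigmaYX0 subr0; apply: lowS; lia.
Qed.

(** Through this factorisation over the augmentation g (x) h -> g (1 # h) of [Y], left linearity of
    [mulE] and its vanishing on boundaries reduce to facts about [Y]. *)
Lemma mulE_muX (x : Xn 0) : mulE x = sval lY (muX x) :> E.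
Proof.
rewrite /mulE /muX (_ : ord_max = ord0); last exact: val_inj.
rewrite recast_id; move: (x ord0) => {x} x.
pose g1 : {linear X cpP 0 0 -> E} := tlift (@reg_mul k E).
pose g2 : {linear X cpP 0 0 -> E} := (sval lY : {linear tens E H -> E}) \o mu_ cpP 0.
suff e : g1 =1 g2 by exact: (e x).
apply: tens_ext => e e'; rewrite [LHS]tliftE [RHS]lcompE.
rewrite mu_linE /mu_lin lextE lcompE.
by rewrite -[RHS]/(sval lY (lmulT H e (tens_in H (e' : tens A H)))) mulY_tens_in.
Qed.

Lemma eps_bihom : is_bihom (M := Xn 0) (N := reg_bimodule E) (fun x => - mulE x).
Proof.
apply: is_bihomN; split; first split=> [c x y|e x].
- by rewrite !mulE_muX muX_linear linearP.
- by rewrite !mulE_muX muX_lact; apply: mulY_lmulT.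
- move=> x e; rewrite /mulE -[ract x e ord0]/(ract (x ord0) e).
  move: (x ord0) => {x} x.
  pose g1 : {linear X cpP 0 0 -> E} := tlift (@reg_mul k E) \o ractl (X cpP 0 0) e.
  pose g2 : {linear X cpP 0 0 -> E} :=
    ractl (reg_bimodule E) e \o (tlift (@reg_mul k E) : {linear X cpP 0 0 -> E}).
  suff e1 : g1 =1 g2 by exact: (e1 x).
  apply: tens_ext => e' e''.
  rewrite -[LHS]/(tlift (@reg_mul k E) (ract (e' \ox e'' : X cpP 0 0) e)) ract_ind.
  rewrite -[RHS]/(tlift (@reg_mul k E) (e' \ox e'') * e).
  by rewrite [LHS]tliftE [X in X * _]tliftE; apply: mulrA.
Qed.

Lemma mulE_dn (x : Xn 1) : mulE (dn x) = 0.
Proof.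
rewrite mulE_muX (dn_delta (N := 2)) // muX_sum big_ltn // big_ltn // big_geq // addr0.
rewrite muX_delta0 add0r muX_delta1 partial_linE opprK.
exact: mulY_partialN.
Qed.

Definition unitX (e : E) : Xn 0 := inX 0 (- (e \ox (1 : E)) : X cpP 0 0).

Lemma unitX_lhom : is_lhom (M := reg_bimodule E) (N := Xn 0) unitX.
Proof.
apply: (is_lhom_comp (inXn_bihom 0 0 0).1); apply: is_lhomN; split=> [c x y|e x].
  by rewrite linearPl.
by rewrite lactE lmulTE.
Qed.

Lemma mulE_unitX e : - mulE (unitX e) = e.
Proof.
rewrite /mulE /unitX /inXn recast_id linearN opprK.
exact: etrans (tliftE (@reg_mul k E) e 1) (mulr1 e).
Qed.

Lemma sigmaYX_unit (e : E) : sigmaYX ((e \ox 1 : Y cpP 0)) = - unitX e.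
Proof.
rewrite /unitX (lhomN (inXn_bihom _ _ _).1) opprK /sigmaYX sigmaY_linE.
by congr (inX 0 _); apply: tmapE.
Qed.

(** In degree 0 only s = 0 occurs and nothing lies below it, so the leading terms are the whole
    answer and no correction arises. *)
Lemma htpy_aug (x : Xn 0) : unitX (- mulE x) + dn (htpy x) = x.
Proof.
have ul := unitX_lhom; have nl := (htpy_lhom 0).
have low00 (y : Xn 0) : low 0 y -> y = 0.
  by move=> ly; apply: functional_extensionality_dep => j; apply: ly.
suff e : dn (htpy x) = delta 0 (sigmaX x) + sigmaYX (partial_ cpP 1 (contrY (muX x))).
  rewrite e partial_contrY0 sigmaYXD sigmaYXN sigmaYX_unit opprK [X in _ + X]addrA.
  by rewrite delta0_sigmaX0 addrCA -(lhomD ul) mulE_muX addNr (lhom0 ul) addr0.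
rewrite [x]Xn_decomp big_ord1.
by apply/eqP; rewrite -subr_eq0; apply/eqP/low00; apply: (low_dn_htpy (s := 0)).
Qed.

(** * Nilpotent correction of the homotopy *)

Definition defect n (x : Xn n.+1) : Xn n.+1 := x - (htpy (dn x) + dn (htpy x)).

Lemma dn_bihom n : is_bihom (@dn k H A act f cpP n).
Proof.
have e (x : Xn n.+1) : \sum_(0 <= l < n.+2) delta l x = dn x.
  by rewrite (dn_delta (N := n.+2)).
by apply: (is_bihom_ext e); apply: is_bihom_sum => l _; apply: delta_bihom.
Qed.

Lemma defect_lhom n : is_lhom (@defect n).
Proof.
apply: is_lhomD; first exact: (is_bihom_id _).1.
apply: is_lhomN; apply: is_lhomD.
  exact: (is_lhom_comp (htpy_lhom _) (dn_bihom _).1).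
exact: (is_lhom_comp (dn_bihom _).1 (htpy_lhom _)).
Qed.

Lemma low_defect_in n r s (x : X cpP r s) : (r + s = n.+1)%N ->
  low s (defect (inX n.+1 x)).
Proof.
move=> rs; set u := inX _ _; rewrite /defect.
have l1 := low_htpy_dn x rs; have l2 := low_dn_htpy x rs; rewrite -/u in l1 l2.
suff e : u = (sigmaX (delta 0 u) + sigmaYX (contrY (partial_ cpP n.+1 (muX u)))) +
    (delta 0 (sigmaX u) + sigmaYX (partial_ cpP n.+2 (contrY (muX u)))).
  rewrite [X in X - _]e opprD addrACA; apply: lowD; rewrite -opprB; exact: lowN.
rewrite addrACA -sigmaYXD addrC [contrY _ + _]addrC partial_contrY addrC.
by rewrite [X in X + _]addrC delta0_sigmaX.
Qed.

Lemma low_defect p n (x : Xn n.+1) : low p.+1 x -> low p (defect x).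
Proof.
move=> lx; rewrite [x]Xn_decomp (lhom_sum (defect_lhom n)).
apply: low_sum => s _ _; have [sp|ps] := ltnP p s.
  rewrite lx // (lhom0 (inXn_bihom _ _ _).1) (lhom0 (defect_lhom n)).
  exact: low0.
by apply: low_le ps _; apply: low_defect_in; have := ltn_ord s; lia.
Qed.

(** The start value n + 2 is the number of values of s in [Xn n.+1]; each application lowers the
    bound by one. *)
Lemma low_iter_defect m n (x : Xn n.+1) : low (n.+2 - m) (iter m (@defect n) x).
Proof.
elim: m => [|m IH] /=; first by move=> j; rewrite subn0 leqNgt ltn_ord.
apply: low_defect; apply: low_le IH; lia.
Qed.

Lemma dn_defect n (x : Xn n.+2) : dn (defect x) = defect (dn x).
Proof.
rewrite /defect (lhomB (dn_bihom n.+1).1) (lhomD (dn_bihom n.+1).1) !dn_dn.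
by rewrite (lhom0 (htpy_lhom n)) addr0 add0r.
Qed.

(* The inverse of 1 - defect, a Neumann series because defect is nilpotent. *)
Definition neumann n : Xn n -> Xn n :=
  if n is n'.+1 then fun x => \sum_(0 <= i < n'.+2) iter i (@defect n') x
  else fun x => x.

Lemma neumann_lhom n : is_lhom (@neumann n).
Proof.
case: n => [|n]; first exact: (is_bihom_id _).1.
apply: is_lhom_sum => i _; elim: i => [|i IH]; first exact: (is_bihom_id _).1.
exact: (is_lhom_comp (defect_lhom n) IH).
Qed.

Lemma iter_defect0 n (x : Xn n.+1) : iter n.+2 (@defect n) x = 0.
Proof.
apply: functional_extensionality_dep => j; apply: low_iter_defect.
by rewrite subnn.
Qed.

Lemma neumann_defect n (x : Xn n.+1) : neumann x - defect (neumann x) = x.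
Proof.
rewrite /= (lhom_sum (defect_lhom n)).
rewrite big_nat_recl // [X in _ - X]big_nat_recr //=.
by rewrite -[defect (defect _)]/(iter n.+2 (@defect n) x) iter_defect0 addr0 addrK.
Qed.

(** [defect] commutes with [dn], and the sum in the higher degree has one extra term, which [dn]
    sends to zero. At the bottom there is no [defect] on X_0; instead [htpy_aug] shows that [dn]
    kills the defect. *)
Lemma dn_neumann n (x : Xn n.+1) : neumann (dn x) = dn (neumann x).
Proof.
case: n x => [|n] x.
  rewrite /= (lhom_sum (dn_bihom 0).1) big_ltn // big_ltn // big_geq // addr0 /=.
  rewrite /defect (lhomB (dn_bihom 0).1) (lhomD (dn_bihom 0).1) dn_dn addr0.
  have e := htpy_aug (dn x); rewrite mulE_dn oppr0 (lhom0 unitX_lhom) add0r in e.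
  by rewrite e subrr addr0.
rewrite /= (lhom_sum (dn_bihom n.+1).1) [RHS]big_nat_recr //.
have di i : dn (iter i (@defect n.+1) x) = iter i (@defect n) (dn x).
  by elim: i => //= i IH; rewrite dn_defect IH.
rewrite [X in _ = _ + X]di iter_defect0 addr0.
by apply: eq_bigr => i _; rewrite di.
Qed.

Lemma Xn_rel_projective n : rel_projective (Xn n).
Proof.
move=> M N g h gb tg hb.
have lift (s : 'I_n.+1) : {h' : X cpP (n - s) s -> M | is_bihom h' /\
    forall x, g (h' x) = h (inX n x)}.
  apply: cid; have [h' h'b gh'] := X_rel_projective (r := n - s) (s := s) gb tg
    (is_bihom_comp hb (inXn_bihom n (n - s) s)).
  by exists h'.
exists (fun x => \sum_(s < n.+1) sval (lift s) (x s)).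
  apply: is_bihom_sum => s _.
  exact: (is_bihom_comp (svalP (lift s)).1 (dsum_proj_bihom s)).
move=> x; rewrite (lhom_sum gb.1) [in RHS](Xn_decomp x) (lhom_sum hb.1).
by apply: eq_bigr => s _; apply: (svalP (lift s)).2.
Qed.

Lemma crossed_resolution : rel_projective_resolution (fun n x => dn (n := n) x)
    (fun x => - mulE (cpP := cpP) x).
Proof.
split.
- by split; [exact: eps_bihom | exact: dn_bihom].
- by split=> [x|n x]; [rewrite mulE_dn oppr0 | exact: dn_dn].
- exists unitX, (fun n x => htpy (neumann x)); split.
  + split; first exact: unitX_lhom.
    by move=> n; exact: (is_lhom_comp (htpy_lhom n) (neumann_lhom n)).
  + exact: mulE_unitX.
  + exact: htpy_aug.
  (* Once [neumann] has moved past [dn], the homotopy sum is 1 - [defect] applied to [neumann x]. *)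
  + move=> n x; rewrite dn_neumann -[RHS](neumann_defect x) [in RHS]/defect.
    by rewrite opprB addrCA subrr addr0.
- exact: Xn_rel_projective.
Qed.

End Crossed.

Theorem theorem1p1p1 (k : comNzRingType) (H : hopfAlgType k) (A : algType k)
    (act : weak_action H A) (f : {linear tens H H -> A})
    (E_crossed : is_crossed_product act f) :
  rel_projective_resolution (fun n x => dn (n := n) x)
    (fun x => - mulE (cpP := E_crossed) x).
Proof. exact: crossed_resolution. Qed.
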